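(* There is an element $Q\in R_0[[\epsilon]]$ with $Q\equiv w^{(0)}\bmod\epsilon$ and with $\mathcal I_Q$ invariant under all the Toda derivations $\mathcal D_{T_k}$, such that in $\mathcal F[[\epsilon]]/I_Q'$, with the induced bracket $\{\ ,\ \}_2$, the images of the elements $\hat\beta_n$ satisfy, for all $n,m\in\mathbb Z$, $$\{\hat\beta_n,\hat\beta_m\}_2\equiv i\,\epsilon^2\left(\pi(n-m)\hat\beta_{n+m}-\delta_{n,-m}\,\pi^3n^3\right)\mod\epsilon^3 .$$ Moreover, the ring $\mathcal F[[\epsilon]]/I_Q'$ is generated topologically by the images of the $\hat\beta_k$ ($k\in\mathbb Z$) and $\epsilon$.
   Context: **Rings.** $R=\mathbb C[v^{(0)},v^{(1)},\ldots;w^{(0)},w^{(1)},\ldots]$, $R_0=\mathbb C[w^{(0)},w^{(1)},\ldots]$, with the derivation $\partial v^{(k)}=v^{(k+1)}$, $\partial w^{(k)}=w^{(k+1)}$, $\partial\epsilon=0$ on $R[[\epsilon]]$. For $Q\in R_0[[\epsilon]]$, $\mathcal I_Q$ is the ($\epsilon$-adic) closure of the ideal of $R[[\epsilon]]$ generated by $\partial^j(v^{(0)}-Q)$, $j\ge0$. **Toda derivations.** Let $S_1=\mathbb C[X_j,Y_j:j\in\mathbb Z]$, and let $C$ be the $\mathbb Z\times\mathbb Z$ matrix with $C_{i+1,i}=1$, $C_{i,i}=X_i$, $C_{i,i+1}=Y_i$, other entries $0$; $E^+$ denotes the strictly upper triangular part of a matrix $E$. Let $P_k,Q_k\in S_1$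 be the $(0,0)$ and $(0,1)$ entries of $[C,(C^k)^+]$. With $E_j=\exp(j\epsilon\partial)$, let $p_k,q_k\in R[[\epsilon]]$ be obtained from $P_k,Q_k$ by substituting $X_j=E_j(v^{(0)})$, $Y_j=E_j(w^{(0)})$. Let $\Phi$ be the continuous $\mathbb C[[\epsilon]]$-algebra endomorphism of $R[[\epsilon]]$ commuting with $\partial$ with $\Phi(v^{(0)})=-2+\epsilon^2v^{(0)}$, $\Phi(w^{(0)})=1+\epsilon^2w^{(0)}$. $\mathcal D_{T_k}$ is the continuous $\mathbb C[[\epsilon]]$-linear derivation of $R[[\epsilon]]$ commuting with $\partial$ with $\mathcal D_{T_k}(v^{(0)})=\epsilon^{-2}\Phi(p_k)$, $\mathcal D_{T_k}(w^{(0)})=\epsilon^{-2}\Phi(q_k)$. **Fourier ring.** In $\mathbb C[\hat a_k,\hat b_k:k\in\mathbb Z]$ a monomial has weight equal to the sum of its subscripts; $I_k$ is the span of the monomials of weight $k$; $M_N$ is the ideal generated by all $\hat a_j,\hat b_j$ with $|j|\ge N$; $\hat I_k$ is the completion of $I_k$ with respect to the subspaces $I_k\cap M_N$, $N\to\infty$; $\mathcal F=\bigoplus_k\hat I_k$. $\mathcal F[[\epsilon]]$ carries the topology defined by the $M_N$ and powers of $\epsilon$. There are continuous $\mathbb C[[\epsilon]]$-linear maps $f_n:R[[\epsilon]]\to\mathcal F[[\epsilon]]$, $n\in\mathbb Z$, determined by $f_n(1)=\delta_{n,0}$, $f_n(v^{(k)})=(2\pi i n)^k\hat a_n$, $f_n(w^{(k)})=(2\pi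 in)^k\hat b_n$, $f_n(FG)=\sum_{l}f_l(F)f_{n-l}(G)$. **Poisson bracket.** Put $Z(n)=\exp(2\pi i n\epsilon)$, $\tilde a_r=-2\delta_{r,0}+\epsilon^2\hat a_r$, $\tilde b_r=\delta_{r,0}+\epsilon^2\hat b_r$. $\{\ ,\ \}_2$ is the continuous $\mathbb C[[\epsilon]]$-bilinear Poisson bracket on $\mathcal F[[\epsilon]]$ with $$\{\hat b_n,\hat b_m\}_2=\tfrac1\epsilon\sum_{r+s=n+m}\tilde b_r\tilde b_s\,(Z(s-m)-Z(s-n)),$$ $$\{\hat b_n,\hat a_m\}_2=\tfrac1\epsilon\sum_{r+s=n+m}\tilde b_r\tilde a_s\,(Z(s-m)-1),\qquad \{\hat a_n,\hat a_m\}_2=\tfrac1\epsilon\,\tilde b_{n+m}(Z(-m)-Z(-n)).$$ **Ideal and induced bracket.** Let $L_n=f_n(v^{(0)}-Q)$, and let $X=\sum_{l\ge0}\frac{(-1)^l}{l+1}\epsilon^{2l}f_0\big((w^{(0)})^{l+1}\big)$, which is a Casimir of $\{\ ,\ \}_2$ with leading term $\hat b_0$. $I'_Q$ is the closure of the ideal of $\mathcal F[[\epsilon]]$ generated by $X$ and all $L_q$ with $q\ne0$. A good extension of $\bar p\in\mathcal F[[\epsilon]]/I'_Q$ is a representative $p\in\mathcal F[[\epsilon]]$ with $\{L_q,p\}_2\in I'_Q+(\epsilon^n)$ for all $q\ne0$ and all $n>0$; good extensions exist. The induced bracket on $\mathcal F[[\epsilon]]/I_Q'$ (also denoted $\{\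 ,\ \}_2$) of $\bar p,\bar p'$ is the class of $\{p,p'\}_2$ for good extensions $p,p'$; it is well defined. **The elements $\hat\beta_n$.** For $n\neq0$, $$\hat\beta_n=\hat b_n+\Big(\tfrac12+\tfrac{n\epsilon i\pi}{2}-\tfrac{\epsilon^2\pi^2n^2}{4}\Big)L_n+\epsilon^2\sum_{k\ne0}\Big(-\tfrac n8+\tfrac{3k}8\Big)\hat b_{n-k}\frac{L_k}{k},$$ and $\hat\beta_0=\tfrac12(\hat a_0+\hat b_0)+\tfrac12\sum_{k\neq0}L_k\hat b_{-k}$. (Since $L_k\in I'_Q$ for $k\ne0$, the image of $\hat\beta_n$ in the quotient is that of $\hat b_n$ for $n\ne0$ and that of $\frac12(\hat a_0+\hat b_0)$ for $n=0$.)
   Formalization: The bracket does not converge on all of F[[ε]] (e.g. Σ b_n b_{-1}^n with Σ b_{-n} b_1^n), so the induced bracket is taken over pairs of good extensions at least one of which has partial derivatives tending to 0; such pairs are shown to exist for all β̂_n, β̂_m. *)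

(* Defs.v *)
(* MathComp world (MathComp-Analysis, real-closed, multinomials' monalg). *)
From HB Require Import structures.
From mathcomp Require Import all_boot all_order all_algebra finmap.
From mathcomp Require Import all_classical all_reals all_analysis.
From mathcomp Require Import complex zify.
(* the notations of monalg clash with those of MathComp-Analysis *)
From mathcomp Require Import -(notations) monalg.

Set Implicit Arguments.
Unset Strict Implicit.
Unset Printing Implicit Defensive.

Import Order.TTheory GRing.Theory Num.Theory.
Local Open Scope classical_set_scope.
Local Open Scope ring_scope.

(** * Polynomials in an arbitrary set of indeterminates *)

Notation pol K I := (malg (monalg_cmonom__canonical__choice_Choice I) K).

(* locked, to keep unification from comparing finite sums *)
HB.lock Definition pder (K : comNzRingType) (I : choiceType) (i : I)
    (F : pol K I) : pol K I :=
  \sum_(m <- msupp F) mkmalgU (divcm m (ucm i)) (mcoeff m F *+ m i).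

(* keeps the terms whose monomial satisfies [p] *)
HB.lock Definition pkeep (K : comNzRingType) (I : choiceType)
    (p : pred (cmonom I)) (F : pol K I) : pol K I :=
  \sum_(m <- msupp F | p m) mkmalgU m (mcoeff m F).

Section Polynomials.
Variables (K : comNzRingType) (I : choiceType).
Implicit Types (m : cmonom I) (F G : pol K I).

Definition pvar (i : I) : pol K I := mkmalgU (ucm i) 1.

(* the value at [g] of a monomial *)
Definition meval (A : comNzRingType) (g : I -> A) m : A :=
  \prod_(i <- finsupp m) g i ^+ m i.

Lemma mevalEw (A : comNzRingType) (g : I -> A) m (d : {fset I}) :
  (finsupp m `<=` d)%fset -> meval g m = \prod_(i <- d) g i ^+ m i.
Proof.
move=> le; rewrite /meval (big_fset_incl _ le) // => i _.
by rewrite -cmE_neq0 negbK => /eqP ->; rewrite expr0.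
Qed.

Lemma meval_is_mmorphism (A : comNzRingType) (g : I -> A) :
  mmorphism (meval g).
Proof.
split; last by rewrite /meval mdom1 big_seq_fset0.
move=> m1 m2.
rewrite (@mevalEw _ _ m1 (finsupp m1 `|` finsupp m2)%fset) ?fsubsetUl //.
rewrite (@mevalEw _ _ m2 (finsupp m1 `|` finsupp m2)%fset) ?fsubsetUr //.
rewrite /meval mdomD -big_split /=; apply: eq_bigr => i _.
by rewrite cmM exprD.
Qed.

HB.instance Definition _ (A : comNzRingType) (g : I -> A) :=
  isMultiplicative.Build _ _ (meval g) (meval_is_mmorphism g).

(* substitution of [g i] for the indeterminate [i] *)
Definition peval (A : comAlgType K) (g : I -> A) : pol K I -> A :=
  mmap (in_alg A) (meval g).

Lemma mcoeff_pkeep p F m : mcoeff m (pkeep p F) = mcoeff m F *+ p m.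
Proof.
rewrite pkeep.unlock big_mkcond raddf_sum /=.
have [mF|mF] := boolP (m \in msupp F).
  rewrite (big_fsetD1 m) //= big_seq big1 ?addr0 => [|k].
    by case: (p m); rewrite ?mcoeffU ?mcoeff0 ?eqxx.
  rewrite in_fsetD1 => /andP[km _]; case: (p k); rewrite ?mcoeff0 //.
  by rewrite mcoeffU (negbTE km).
rewrite (mcoeff_outdom mF) mul0rn big_seq big1 // => k kF.
case: (p k); rewrite ?mcoeff0 // mcoeffU.
by case: eqP => // km; rewrite -km kF in mF.
Qed.

Lemma mcoeff_pder i F m :
  mcoeff m (pder i F) = mcoeff (mulcm m (ucm i)) F *+ (m i).+1.
Proof.
set m' := mulcm m (ucm i).
have m'i : m' i = (m i).+1 by rewrite mulcmE ucmE eqxx addn1.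
have divE (k : cmonom I) : k i != 0%N -> (divcm k (ucm i) == m) = (k == m').
  move=> ki; apply/eqP/eqP => [km|->]; apply/eqP/cmP => j.
    by rewrite /m' -km mulcmE divcmE ucmE; case: eqVneq => [<-|]; lia.
  by rewrite divcmE mulcmE ucmE addnK.
have term (k : cmonom I) : mcoeff m (mkmalgU (divcm k (ucm i)) (mcoeff k F *+ k i)) =
    (mcoeff k F *+ k i) *+ (k == m').
  rewrite mcoeffU; have [->|ki] := eqVneq (k i) 0%N.
    by rewrite mulr0n !mul0rn.
  by rewrite divE.
rewrite pder.unlock raddf_sum /= (eq_bigr _ (fun k _ => term k)).
have [mF|mF] := boolP (m' \in msupp F).
  rewrite (big_fsetD1 m') //= big_seq big1 ?addr0 ?eqxx ?m'i // => k.
  by rewrite in_fsetD1 => /andP[/negbTE -> _].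
rewrite (mcoeff_outdom mF) mul0rn big_seq big1 // => k kF.
by case: eqP => // km; rewrite -km kF in mF.
Qed.

Lemma pkeepM (p : pred (cmonom I)) F G : p mone -> (forall m1 m2, p (mulcm m1 m2) = p m1 && p m2) ->
  pkeep p (F * G) = pkeep p F * pkeep p G.
Proof.
move=> p1 pM; apply/malgP => m; rewrite mcoeff_pkeep.
have sub (H : pol K I) : (msupp (pkeep p H) `<=` msupp H)%fset.
  apply/fsubsetP => k; rewrite -!mcoeff_neq0 mcoeff_pkeep.
  by apply: contraNneq => ->; rewrite mul0rn.
apply: (etrans (congr1 (fun z => z *+ p m) (mcoeffMl F G m))).
apply: etrans (esym (mcoeffMlw m (sub F) (sub G))).
rewrite -sumrMnl.
apply: eq_bigr => k1 _; rewrite -sumrMnl; apply: eq_bigr => k2 _.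
rewrite !mcoeff_pkeep; case: eqP => [<-|_]; last by rewrite !mulr0n mul0rn.
rewrite (pM k1 k2); case: (p k1); case: (p k2);
  by rewrite ?mulr1n ?mulr0n ?mulr0 ?mul0r.
Qed.

Lemma pkeep_linear (p : pred (cmonom I)) : linear (@pkeep K I p).
Proof.
move=> c F G; apply/malgP => m.
rewrite mcoeff_pkeep mcoeffD mcoeffZ mulrnDl -mulrnAr.
by rewrite -!mcoeff_pkeep -mcoeffZ -mcoeffD.
Qed.

End Polynomials.

HB.instance Definition _ (K : comNzRingType) (I : choiceType) p :=
  GRing.isLinear.Build K (pol K I) (pol K I) _ (@pkeep K I p)
    (pkeep_linear p).

Section Substitution.
Variables (K : comNzRingType) (I : choiceType).

HB.instance Definition _ (A : comAlgType K) (g : I -> A) :=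
  GRing.RMorphism.copy (peval g) (mmap (in_alg A) (meval g)).

Lemma pevalE (A : comAlgType K) (g : I -> A) (F : pol K I) :
  peval g F = \sum_(m <- msupp F) mcoeff m F *: meval g m.
Proof. by apply: eq_bigr => m _; rewrite mulr_algl. Qed.

End Substitution.

(** * Formal power series in epsilon *)

Record epseries (T : Type) := PSeries { pscoef : nat -> T }.
Coercion pscoef : epseries >-> Funclass.
Arguments PSeries {T} _.

HB.instance Definition _ (T : Type) := [isNew for @pscoef T].
HB.instance Definition _ (T : Type) := gen_eqMixin (epseries T).
HB.instance Definition _ (T : Type) := gen_choiceMixin (epseries T).

Lemma epseriesP (T : Type) (F G : epseries T) : F =1 G -> F = G.
Proof. by case: F G => [f] [g] /= /funext ->. Qed.

Section PowerSeriesZmod.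
Variable T : zmodType.
Implicit Types F G H : epseries T.

Definition psadd F G := PSeries (fun n => F n + G n).
Definition psopp F := PSeries (fun n => - F n).
Definition ps0 : epseries T := PSeries (fun=> 0).

Lemma psaddA : associative psadd.
Proof. by move=> F G H; apply: epseriesP => n /=; rewrite addrA. Qed.
Lemma psaddC : commutative psadd.
Proof. by move=> F G; apply: epseriesP => n /=; rewrite addrC. Qed.
Lemma psadd0 : left_id ps0 psadd.
Proof. by move=> F; apply: epseriesP => n /=; rewrite add0r. Qed.
Lemma psaddN : left_inverse ps0 psopp psadd.
Proof. by move=> F; apply: epseriesP => n /=; rewrite addNr. Qed.

HB.instance Definition _ :=
  GRing.isZmodule.Build (epseries T) psaddA psaddC psadd0 psaddN.

End PowerSeriesZmod.

Section PowerSeriesRing.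
Variable T : comNzRingType.
Implicit Types F G H : epseries T.

Definition psC (c : T) : epseries T := PSeries (fun n => c *+ (n == 0%N)).
Definition eps : epseries T := PSeries (fun n => (n == 1%N)%:R).
(* division by epsilon of a series without constant term *)
Definition epsdiv F : epseries T := PSeries (fun n => F n.+1).

Definition psmul F G : epseries T :=
  PSeries (fun n => \sum_(i < n.+1) F i * G (n - i)%N).

Let tr N F : {poly T} := \poly_(i < N) F i.

Let psmul_tr N n F G : (n < N)%N -> psmul F G n = (tr N F * tr N G)`_n.
Proof.
move=> nN; rewrite coefM /=; apply: eq_bigr => i _.
rewrite !coef_poly (leq_ltn_trans _ nN) ?(leq_ltn_trans _ nN) ?leq_subr //.
by rewrite -ltnS.
Qed.

Lemma psmulC : commutative psmul.
Proof.
by move=> F G; apply: epseriesP => n; rewrite !(psmul_tr _ _ (ltnSn n)) mulrC.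
Qed.

Lemma psmulA : associative psmul.
Proof.
move=> F G H; apply: epseriesP => n.
transitivity (tr n.+1 F * (tr n.+1 G * tr n.+1 H))`_n.
  rewrite coefM /=; apply: eq_bigr => i _.
  by rewrite -psmul_tr ?coef_poly ?ltn_ord // ltnS leq_subr.
rewrite mulrA coefM /=; apply: eq_bigr => i _.
by rewrite -psmul_tr // coef_poly ltnS leq_subr.
Qed.

Lemma psmul1 : left_id (psC 1) psmul.
Proof.
move=> F; apply: epseriesP => n /=.
rewrite big_ord_recl /= mul1r subn0 big1 ?addr0 // => i _.
by rewrite mul0r.
Qed.

Lemma psmulD : left_distributive psmul +%R.
Proof.
move=> F G H; apply: epseriesP => n /=; rewrite -big_split /=.
by apply: eq_bigr => i _; rewrite mulrDl.
Qed.

Lemma psC1_neq0 : psC 1 != 0.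
Proof.
by apply/eqP => /(congr1 (fun F : epseries T => F 0%N)) /eqP;
  rewrite /= oner_eq0.
Qed.

HB.instance Definition _ := GRing.Zmodule_isComNzRing.Build (epseries T)
  psmulA psmulC psmul1 psmulD psC1_neq0.

End PowerSeriesRing.

Arguments eps {T}.

Section PowerSeriesAlgebra.
Variables (K : comNzRingType) (T : comAlgType K).
Implicit Types F G H : epseries T.

Definition psscale (c : K) F : epseries T := PSeries (fun n => c *: F n).

Lemma psscaleA a b F : psscale a (psscale b F) = psscale (a * b) F.
Proof. by apply: epseriesP => n /=; rewrite scalerA. Qed.
Lemma psscale1 : left_id 1 psscale.
Proof. by move=> F; apply: epseriesP => n /=; rewrite scale1r. Qed.
Lemma psscaleDr : right_distributive psscale +%R.
Proof. by move=> a F G; apply: epseriesP => n /=; rewrite scalerDr. Qed.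
Lemma psscaleDl F : {morph psscale^~ F : a b / a + b}.
Proof. by move=> a b; apply: epseriesP => n /=; rewrite scalerDl. Qed.

HB.instance Definition _ := GRing.Zmodule_isLmodule.Build K (epseries T)
  psscaleA psscale1 psscaleDr psscaleDl.

Lemma psscaleAl (c : K) F G : c *: (F * G) = (c *: F) * G.
Proof.
apply: epseriesP => n /=; rewrite scaler_sumr.
by apply: eq_bigr => i _; rewrite scalerAl.
Qed.

HB.instance Definition _ :=
  GRing.Lmodule_isLalgebra.Build K (epseries T) psscaleAl.
HB.instance Definition _ :=
  GRing.Lalgebra_isComAlgebra.Build K (epseries T).

End PowerSeriesAlgebra.

(** * The ring F of the Fourier coefficients *)

(* [inl j] stands for a_j (resp. X_j), [inr j] for b_j (resp. Y_j). *)
Definition zvar : choiceType := (int + int)%type.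

Definition idx (x : zvar) : int := match x with inl j | inr j => j end.

(* the integers j with |j| < N, and the variables with these subscripts *)
Definition zrange (N : nat) : seq int :=
  [seq i%:Z - N.-1%:Z | i <- iota 0 (N.*2).-1].
Definition vrange (N : nat) : seq zvar :=
  [seq inl j | j <- zrange N] ++ [seq inr j | j <- zrange N].

Lemma mem_zrange N (j : int) : (j \in zrange N) = (`|j| < N)%N.
Proof.
apply/mapP/idP => [[i iN ->]|jN]; first by move: iN; rewrite mem_iota; lia.
by exists (absz (j + N.-1%:Z)); [rewrite mem_iota; lia|lia].
Qed.

Lemma uniq_zrange N : uniq (zrange N).
Proof. by rewrite map_inj_uniq ?iota_uniq // => i j; lia. Qed.

Definition weight (m : cmonom zvar) : int :=
  \sum_(x <- finsupp m) idx x *+ m x.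

(* the monomial [m] only involves variables of subscript |j| < N *)
Definition below (N : nat) : pred (cmonom zvar) :=
  fun m => [forall x : finsupp m, (`|idx (val x)| < N)%N].

Section Weights.
Implicit Types m : cmonom zvar.

Lemma belowP N m :
  reflect (forall x, m x != 0%N -> (`|idx x| < N)%N) (below N m).
Proof.
apply: (iffP forallP) => [h x|h x]; last by apply: h; rewrite cmE_neq0 (valP x).
by rewrite cmE_neq0 => xm; apply: (h [` xm]%fset).
Qed.

Lemma below1 N : below N mone.
Proof. by apply/belowP => x; rewrite cm1. Qed.

Lemma belowM N m1 m2 : below N (mulcm m1 m2) = below N m1 && below N m2.
Proof.
apply/belowP/andP => [h|[/belowP h1 /belowP h2] x]; last first.
  by rewrite mulcmE addn_eq0 negb_and => /orP[/h1|/h2].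
by split; apply/belowP => x xm; apply: h; rewrite mulcmE addn_eq0 negb_and xm
  ?orbT.
Qed.

Lemma belowW N M m : (N <= M)%N -> below N m -> below M m.
Proof. by move=> NM /belowP h; apply/belowP => x /h /leq_trans; apply. Qed.

Lemma weightEw m (d : {fset zvar}) :
  (finsupp m `<=` d)%fset -> weight m = \sum_(x <- d) idx x *+ m x.
Proof.
move=> le; rewrite /weight (big_fset_incl _ le) // => x _.
by rewrite -cmE_neq0 negbK => /eqP ->; rewrite mulr0n.
Qed.

Lemma weight1 : weight mone = 0.
Proof. by rewrite /weight mdom1 big_seq_fset0. Qed.

Lemma weightM m1 m2 : weight (mulcm m1 m2) = weight m1 + weight m2.
Proof.
rewrite (@weightEw m1 (finsupp m1 `|` finsupp m2)%fset) ?fsubsetUl //.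
rewrite (@weightEw m2 (finsupp m1 `|` finsupp m2)%fset) ?fsubsetUr //.
rewrite /weight mdomD -big_split /=; apply: eq_bigr => x _.
by rewrite mulcmE mulrnDr.
Qed.

Lemma weightU x : weight (ucm x) = idx x.
Proof. by rewrite /weight mdomU big_seq_fset1 ucmE eqxx mulr1n. Qed.

End Weights.

Section FourierRing.
Variable K : comNzRingType.
Implicit Types f : nat -> pol K zvar.

(* reduction modulo M_N: kills the variables of subscript |j| >= N *)
Definition ftrunc (N : nat) : pol K zvar -> pol K zvar := pkeep (below N).

Lemma ftruncM N : {morph ftrunc N : F G / F * G}.
Proof. by move=> F G; rewrite /ftrunc pkeepM ?below1 // => *; rewrite belowM. Qed.

Lemma ftrunc1 N : ftrunc N 1 = 1.
Proof.
apply/malgP => m; rewrite mcoeff_pkeep mcoeff1.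
by case: eqP => [->|]; rewrite ?below1 ?mul0rn.
Qed.

HB.instance Definition _ N := GRing.Linear.on (ftrunc N).
HB.instance Definition _ N :=
  GRing.isMonoidMorphism.Build _ _ (ftrunc N) (conj (ftrunc1 N) (@ftruncM N)).

Lemma ftrunc_ftrunc N M F : (N <= M)%N -> ftrunc N (ftrunc M F) = ftrunc N F.
Proof.
move=> NM; apply/malgP => m; rewrite /ftrunc !mcoeff_pkeep -mulrnA mulnb.
by case: (boolP (below N m)) => [/(belowW NM) ->|]; rewrite ?andbF.
Qed.

(* F is the direct sum over k of the completions of I_k for the subspaces
   M_N of I_k. The quotient of C[a_j, b_j] by M_N is the ring of polynomials
   in the variables of subscript |j| < N, so that an element of F is a
   sequence of such polynomials, compatible under truncation, in which only
   finitely many weights occur. *)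
Definition fourier_seq : {pred nat -> pol K zvar} := fun f =>
  `[< (forall N M, (N <= M)%N -> ftrunc N (f M) = f N) /\
      (exists B : nat, forall N m, m \in msupp (f N) -> (`|weight m| <= B)%N) >].

Lemma fourier_seqP f : reflect
  ((forall N M, (N <= M)%N -> ftrunc N (f M) = f N) /\
   (exists B : nat, forall N m, m \in msupp (f N) -> (`|weight m| <= B)%N))
  (f \in fourier_seq).
Proof. exact: asboolP. Qed.

Fact fourier_seq0 : (fun=> 0) \in fourier_seq.
Proof.
apply/fourier_seqP; split=> [N M _|]; first exact: raddf0.
by exists 0%N => N m; rewrite msupp0.
Qed.

Fact fourier_seq1 : (fun=> 1) \in fourier_seq.
Proof.
apply/fourier_seqP; split=> [N M _|]; first exact: ftrunc1.
exists 0%N => N m; rewrite -mcoeff_neq0 mcoeff1.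
case: (m =P mone) => [E|]; last by rewrite eqxx.
by rewrite E weight1.
Qed.

Fact fourier_seqD f g : f \in fourier_seq -> g \in fourier_seq ->
  (fun N => f N + g N) \in fourier_seq.
Proof.
move=> /fourier_seqP[fc [A fA]] /fourier_seqP[gc [B gB]].
apply/fourier_seqP; split=> [N M NM|].
  by rewrite raddfD /= fc // gc.
exists (maxn A B) => N m; rewrite -mcoeff_neq0 mcoeffD leq_max => fg.
have [/fA -> //|] := boolP (m \in msupp (f N)).
rewrite -mcoeff_neq0 negbK => /eqP f0; rewrite (gB N) ?orbT //.
by rewrite -mcoeff_neq0; apply: contraNneq fg => ->; rewrite f0 addr0.
Qed.

Fact fourier_seqM f g : f \in fourier_seq -> g \in fourier_seq ->
  (fun N => f N * g N) \in fourier_seq.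
Proof.
move=> /fourier_seqP[fc [A fA]] /fourier_seqP[gc [B gB]].
apply/fourier_seqP; split=> [N M NM|].
  apply: (etrans (ftruncM N (f M) (g M))).
  by rewrite (fc N M NM) (gc N M NM).
exists (A + B)%N => N m /msuppM_le[m1 [m2 [/fA h1 /gB h2 ->]]].
by rewrite [weight _]weightM; lia.
Qed.

Fact fourier_seqZ c f : f \in fourier_seq ->
  (fun N => c *: f N) \in fourier_seq.
Proof.
move=> /fourier_seqP[fc [B fB]]; apply/fourier_seqP; split=> [N M NM|].
  by rewrite linearZ /= fc.
exists B => N m; rewrite -mcoeff_neq0 mcoeffZ => cf; apply: (fB N).
by rewrite -mcoeff_neq0; apply: contraNneq cf => ->; rewrite mulr0.
Qed.

Fact fourier_seqN f : f \in fourier_seq -> (fun N => - f N) \in fourier_seq.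
Proof.
move=> /fourier_seqP[fc [B fB]]; apply/fourier_seqP; split=> [N M NM|].
  by rewrite raddfN /= fc.
by exists B => N m; rewrite msuppN; exact: fB.
Qed.

Record fourier_ring := FourierRing {
  fseq : nat -> pol K zvar; fseqP : fseq \in fourier_seq }.

HB.instance Definition _ := [isSub for fseq].
HB.instance Definition _ := [Choice of fourier_ring by <:].

Lemma fseq_inj (x y : fourier_ring) : (forall N, fseq x N = fseq y N) -> x = y.
Proof. by move=> /funext/val_inj. Qed.

Implicit Types x y z : fourier_ring.

Definition fzero := FourierRing fourier_seq0.
Definition fone := FourierRing fourier_seq1.
Definition fadd x y := FourierRing (fourier_seqD (fseqP x) (fseqP y)).
Definition fopp x := FourierRing (fourier_seqN (fseqP x)).
Definition fmul x y := FourierRing (fourier_seqM (fseqP x) (fseqP y)).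
Definition fscale c x := FourierRing (fourier_seqZ c (fseqP x)).

Fact faddA : associative fadd.
Proof. by move=> x y z; apply: fseq_inj => N /=; rewrite addrA. Qed.
Fact faddC : commutative fadd.
Proof. by move=> x y; apply: fseq_inj => N /=; rewrite addrC. Qed.
Fact fadd0 : left_id fzero fadd.
Proof. by move=> x; apply: fseq_inj => N /=; rewrite add0r. Qed.
Fact faddN : left_inverse fzero fopp fadd.
Proof. by move=> x; apply: fseq_inj => N /=; rewrite addNr. Qed.

HB.instance Definition _ :=
  GRing.isZmodule.Build fourier_ring faddA faddC fadd0 faddN.

Fact fmulA : associative fmul.
Proof. by move=> x y z; apply: fseq_inj => N /=; rewrite mulrA. Qed.
Fact fmulC : commutative fmul.
Proof. by move=> x y; apply: fseq_inj => N /=; rewrite mulrC. Qed.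
Fact fmul1 : left_id fone fmul.
Proof. by move=> x; apply: fseq_inj => N /=; rewrite mul1r. Qed.
Fact fmulD : left_distributive fmul fadd.
Proof. by move=> x y z; apply: fseq_inj => N /=; rewrite mulrDl. Qed.
Fact fone_neq0 : fone != fzero.
Proof.
by apply/eqP => /(congr1 (fun x => fseq x 0%N))/eqP; rewrite /= oner_eq0.
Qed.

HB.instance Definition _ := GRing.Zmodule_isComNzRing.Build fourier_ring
  fmulA fmulC fmul1 fmulD fone_neq0.

Fact fscaleA a b x : fscale a (fscale b x) = fscale (a * b) x.
Proof. by apply: fseq_inj => N /=; rewrite scalerA. Qed.
Fact fscale1 : left_id 1 fscale.
Proof. by move=> x; apply: fseq_inj => N /=; rewrite scale1r. Qed.
Fact fscaleDr : right_distributive fscale fadd.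
Proof. by move=> c x y; apply: fseq_inj => N /=; rewrite scalerDr. Qed.
Fact fscaleDl x : {morph fscale^~ x : a b / a + b >-> fadd a b}.
Proof. by move=> a b; apply: fseq_inj => N /=; rewrite scalerDl. Qed.

HB.instance Definition _ := GRing.Zmodule_isLmodule.Build K fourier_ring
  fscaleA fscale1 fscaleDr fscaleDl.

Fact fscaleAl c x y : fscale c (fmul x y) = fmul (fscale c x) y.
Proof. by apply: fseq_inj => N /=; rewrite scalerAl. Qed.

HB.instance Definition _ :=
  GRing.Lmodule_isLalgebra.Build K fourier_ring fscaleAl.
HB.instance Definition _ :=
  GRing.Lalgebra_isComAlgebra.Build K fourier_ring.

End FourierRing.

Section FourierElements.
Variable K : comNzRingType.

Let gen_seq (x : zvar) : nat -> pol K zvar :=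
  fun N => if (`|idx x| < N)%N then pvar K x else 0.

Lemma ftrunc_pvar N x :
  ftrunc N (pvar K x) = if (`|idx x| < N)%N then pvar K x else 0.
Proof.
apply/malgP => m; rewrite mcoeff_pkeep mcoeffU.
have below_ucm : below N (ucm x) = (`|idx x| < N)%N.
  apply/belowP/idP => [h|h y]; first by apply: h; rewrite ucmE eqxx.
  by rewrite ucmE; case: (x =P y) => [<- _|].
case: eqVneq => [<-|xm]; last first.
  by rewrite !mul0rn; case: ifP; rewrite ?mcoeff0 // mcoeffU (negbTE xm).
by rewrite below_ucm; case: ifP; rewrite ?mcoeff0 // mcoeffU eqxx.
Qed.

Fact fgen_subproof x : gen_seq x \in @fourier_seq K.
Proof.
apply/fourier_seqP; split=> [N M NM|].
  rewrite /gen_seq; case: ltnP => xM; last first.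
    by rewrite raddf0 ltnNge (leq_trans NM xM).
  exact: ftrunc_pvar.
exists `|idx x|%N => N m; rewrite /gen_seq; case: ifP => _.
  by rewrite msuppU oner_eq0 in_fset1 => /eqP ->; rewrite weightU.
by rewrite msupp0.
Qed.

(* the generators a_j and b_j of F *)
Definition fgen (x : zvar) : fourier_ring K := FourierRing (fgen_subproof x).

Let der_seq (x : zvar) (F : fourier_ring K) : nat -> pol K zvar :=
  fun N => ftrunc N (pder x (fseq F (N + `|idx x|.+1))).

Lemma ftrunc_pder N x (G : pol K zvar) :
  (`|idx x| < N)%N -> ftrunc N (pder x G) = pder x (ftrunc N G).
Proof.
move=> xN; apply/malgP => m.
rewrite mcoeff_pkeep !mcoeff_pder mcoeff_pkeep belowM mulrnAC.
suff -> : below N (ucm x) by rewrite andbT.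
by apply/belowP => y; rewrite ucmE; case: (x =P y) => [<- _|].
Qed.

Fact fder_subproof x (F : fourier_ring K) : der_seq x F \in @fourier_seq K.
Proof.
have /fourier_seqP[Fc [B FB]] := fseqP F.
apply/fourier_seqP; split=> [N M NM|].
  rewrite /der_seq ftrunc_ftrunc // -(Fc (N + `|idx x|.+1)%N (M + `|idx x|.+1)%N);
    last by rewrite leq_add2r.
  rewrite -ftrunc_pder ?ftrunc_ftrunc ?leq_addr //.
  by rewrite addnS ltnS leq_addl.
exists (B + `|idx x|)%N => N m.
rewrite -mcoeff_neq0 mcoeff_pkeep mcoeff_pder => h.
have : mulcm m (ucm x) \in msupp (fseq F (N + `|idx x|.+1)).
  by rewrite -mcoeff_neq0; apply: contraNneq h => ->; rewrite !mul0rn.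
by move=> /FB; rewrite weightM weightU; lia.
Qed.

(* The partial derivative in x: the level N of the result depends on a level
   of F at which x is not killed. *)
Definition fder (x : zvar) (F : fourier_ring K) : fourier_ring K :=
  FourierRing (fder_subproof x F).

End FourierElements.

(** * The topology of F[[epsilon]] *)

Section FourierTopology.
Variable K : comNzRingType.
Local Notation FE := (epseries (fourier_ring K)).

(* the ideal M_N + (epsilon^n) *)
Definition fnbhd (N n : nat) : set FE :=
  [set F | forall k, (k < n)%N -> fseq (F k) N = 0].

Lemma fnbhd0 N n : fnbhd N n 0.
Proof. by []. Qed.

Lemma fnbhdD N n F G : fnbhd N n F -> fnbhd N n G -> fnbhd N n (F + G).
Proof.
move=> hF hG k kn; change (fseq (F k) N + fseq (G k) N = 0).
by rewrite hF // hG // addr0.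
Qed.

Lemma fnbhdW N N' n n' :
  (N <= N')%N -> (n <= n')%N -> fnbhd N' n' `<=` fnbhd N n.
Proof.
move=> NN' nn' F hF k kn; have /fourier_seqP[Fc _] := fseqP (F k).
by rewrite -(Fc _ _ NN') hF ?raddf0 // (leq_trans kn).
Qed.

Definition fnbhs (F : FE) : set_system FE :=
  [set B | exists N n, forall G, fnbhd N n (G - F) -> B G].

HB.instance Definition _ := hasNbhs.Build FE fnbhs.

Fact fnbhs_filter (F : FE) : ProperFilter (nbhs F).
Proof.
split; first by move=> [N [n]] /(_ F); rewrite subrr => /(_ (@fnbhd0 N n)).
split=> [|A B [N [n hA]] [N' [n' hB]]|A B AB [N [n hA]]].
- by exists 0%N, 0%N.
- exists (maxn N N'), (maxn n n') => G h; split.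
    by apply: hA; apply: fnbhdW h; rewrite leq_maxl.
  by apply: hB; apply: fnbhdW h; rewrite leq_maxr.
- by exists N, n => G /hA; apply: AB.
Qed.

Fact fnbhs_singleton (F : FE) (A : set FE) : nbhs F A -> A F.
Proof. by move=> [N [n]] /(_ F); rewrite subrr; apply. Qed.

Fact fnbhs_nbhs (F : FE) (A : set FE) : nbhs F A -> nbhs F (nbhs^~ A).
Proof.
move=> [N [n hA]]; exists N, n => G GF; exists N, n => H HG; apply: hA.
by rewrite -(subrK G H) -addrA; apply: fnbhdD.
Qed.

HB.instance Definition _ := Nbhs_isNbhsTopological.Build FE
  fnbhs_filter fnbhs_singleton fnbhs_nbhs.
HB.instance Definition _ := isPointed.Build FE 0.

(* the sum over all integers, resp. over all pairs of variables *)
Definition zsum (u : int -> FE) : FE :=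
  lim ((fun N => \sum_(j <- zrange N) u j) @ \oo).

Definition vsum2 (u : zvar -> zvar -> FE) : FE :=
  lim ((fun N => \sum_(x <- vrange N) \sum_(y <- vrange N) u x y) @ \oo).

Definition fderE (x : zvar) (F : FE) : FE := PSeries (fun k => fder x (F k)).

End FourierTopology.

Section IdealsAndAlgebras.

Definition ideal_gen (A : comNzRingType) (S : set A) : set A :=
  [set x | exists s : seq (A * A),
     (forall p, p \in s -> S p.2) /\ x = \sum_(p <- s) p.1 * p.2].

(* S + (epsilon^n) *)
Definition mod_eps (T : comNzRingType) (S : set (epseries T)) (n : nat) :
    set (epseries T) :=
  [set x | exists y z, S y /\ x = y + eps ^+ n * z].

Definition eps_closure (T : comNzRingType) (S : set (epseries T)) :
  set (epseries T) := \bigcap_n mod_eps S n.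

End IdealsAndAlgebras.

(** * Differential polynomials *)

(* [inl k] stands for v^(k), [inr k] for w^(k). *)
Definition dvar : choiceType := (nat + nat)%type.

(* The derivation along the ring morphism [phi] that maps each indeterminate
   x to [h x]: F |-> sum over x of phi (dF/dx) h_x. *)
Definition pderivation (K : comNzRingType) (I : choiceType)
    (A : comNzRingType) (phi : pol K I -> A) (h : I -> A) (F : pol K I) : A :=
  \sum_(m <- msupp F) \sum_(x <- finsupp m)
    phi (mkmalgU (divcm m (ucm x)) (mcoeff m F *+ m x)) * h x.

(* the continuous linear extension of [phi] to power series *)
Definition psextend (S T : comNzRingType) (phi : S -> epseries T)
    (F : epseries S) : epseries T :=
  PSeries (fun n => \sum_(k < n.+1) phi (F k) (n - k)%N).

Section DifferentialRing.
Variable R : realType.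
Local Notation C := R[i].
Local Notation DR := (pol C dvar).
Local Notation DE := (epseries DR).

Definition dsucc (x : dvar) : dvar :=
  match x with inl k => inl k.+1 | inr k => inr k.+1 end.

Definition dR (F : DR) : DR := pderivation id (fun x => pvar C (dsucc x)) F.
Definition dE (F : DE) : DE := PSeries (fun n => dR (F n)).

Definition v0 : DE := psC (pvar C (inl 0%N)).
Definition w0 : DE := psC (pvar C (inr 0%N)).

Definition in_R0 (Q : DE) : Prop :=
  forall n (m : cmonom dvar), m \in msupp (Q n) -> forall k, m (inl k) = 0%N.

Definition diff_ideal (Q : DE) : set DE :=
  eps_closure (ideal_gen (range (fun j => iter j dE (v0 - Q)))).

(* exp(j epsilon d) *)
Definition shiftE (j : int) (F : DE) : DE :=
  PSeries (fun n => \sum_(m < n.+1)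
    (j%:~R ^+ m / m`!%:R) *: iter m dR (F (n - m)%N)).

(** * The Toda derivations *)

Local Notation S1 := (pol C zvar).
Local Notation zmatrix := (int -> int -> S1).

Definition toda_mx : zmatrix := fun i j =>
  if i == j + 1 then 1 else if i == j then pvar C (inl i)
  else if j == i + 1 then pvar C (inr i) else 0.

(* a sum of finite support for the band matrices used below *)
Definition zmx_mul (A B : zmatrix) : zmatrix := fun i j =>
  \sum_(l \in [set: int]) A i l * B l j.

Definition zmx_exp (A : zmatrix) (k : nat) : zmatrix :=
  iter k (zmx_mul A) (fun i j => (i == j)%:R).

Definition zmx_upper (A : zmatrix) : zmatrix := fun i j =>
  if i < j then A i j else 0.

Definition toda_comm (k : nat) : zmatrix :=
  let E := zmx_upper (zmx_exp toda_mx k) in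
  fun i j => zmx_mul toda_mx E i j - zmx_mul E toda_mx i j.

Definition toda_subst (x : zvar) : DE :=
  match x with inl j => shiftE j v0 | inr j => shiftE j w0 end.

Definition toda_p (k : nat) : DE := peval toda_subst (toda_comm k 0 0).
Definition toda_q (k : nat) : DE := peval toda_subst (toda_comm k 0 1).

Definition Phi : DE -> DE := psextend (peval (fun x : dvar =>
  match x with
  | inl k => iter k dE (- 2%:R + eps ^+ 2 * v0)
  | inr k => iter k dE (1 + eps ^+ 2 * w0)
  end)).

(* [Phi (toda_p k)] and [Phi (toda_q k)] are divisible by epsilon^2, since
   bi-infinite Toeplitz matrices commute. *)
Definition toda_der (k : nat) : DE -> DE :=
  psextend (pderivation (@psC DR) (fun x : dvar =>
    match x with
    | inl j => iter j dE (epsdiv (epsdiv (Phi (toda_p k))))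
    | inr j => iter j dE (epsdiv (epsdiv (Phi (toda_q k))))
    end)).

(** * The maps f_n *)

Definition twopii : C := 2 * (pi : R)%:C%C * 'i%C.

Definition mode_sum (N : nat) (x : dvar) : S1 :=
  match x with
  | inl k => \sum_(j <- zrange N) (twopii * j%:~R) ^+ k *: pvar C (inl j)
  | inr k => \sum_(j <- zrange N) (twopii * j%:~R) ^+ k *: pvar C (inr j)
  end.

(* The rules defining the f_n say that f_n(F) is the component of weight n of
   the series obtained from F by v^(k) |-> sum over j of (2 pi i j)^k a_j and
   w^(k) |-> sum over j of (2 pi i j)^k b_j. *)
Let fcoef_seq (n : int) (F : DR) : nat -> S1 :=
  fun N => pkeep (fun m => weight m == n) (peval (mode_sum N) F).

Lemma ftrunc_mode_sum N M x :
  (N <= M)%N -> ftrunc N (mode_sum M x) = mode_sum N x.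
Proof.
move=> NM.
have aux (c : int -> C) (y : int -> zvar) : (forall j, idx (y j) = j) ->
    ftrunc N (\sum_(j <- zrange M) c j *: pvar C (y j)) =
    \sum_(j <- zrange N) c j *: pvar C (y j).
  move=> yj; rewrite linear_sum /=.
  transitivity (\sum_(j <- zrange M | (`|j| < N)%N) c j *: pvar C (y j)).
    rewrite [RHS]big_mkcond /=; apply: eq_bigr => j _.
    by rewrite linearZ /= ftrunc_pvar yj; case: ifP; rewrite ?scaler0.
  rewrite -[LHS]big_filter; apply: perm_big; apply: uniq_perm.
  - by rewrite filter_uniq ?uniq_zrange.
  - exact: uniq_zrange.
  by move=> j; rewrite mem_filter !mem_zrange; lia.
by case: x => k /=; rewrite aux.
Qed.

Fact fcoef_subproof n F : fcoef_seq n F \in @fourier_seq C.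
Proof.
apply/fourier_seqP; split=> [N M NM|].
  have -> : fcoef_seq n F N =
      pkeep (fun m => weight m == n) (ftrunc N (peval (mode_sum M) F)).
    rewrite /fcoef_seq; congr pkeep; rewrite !pevalE linear_sum /=.
    apply: eq_bigr => m _; rewrite linearZ /= /meval rmorph_prod /=.
    by congr (_ *: _); apply: eq_bigr => x _; rewrite rmorphXn /= ftrunc_mode_sum.
  by apply/malgP => m; rewrite !mcoeff_pkeep mulrnAC.
exists `|n|%N => N m; rewrite -mcoeff_neq0 mcoeff_pkeep.
by case: (weight m =P n) => [->|_]; rewrite ?mulr0n ?eqxx.
Qed.

Definition fcoef (n : int) (F : DR) : fourier_ring C :=
  FourierRing (fcoef_subproof n F).
Definition fE (n : int) (F : DE) : epseries (fourier_ring C) :=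
  PSeries (fun k => fcoef n (F k)).

End DifferentialRing.

(** * The Poisson bracket and the quotient by I'_Q *)

Section Poisson.
Variable R : realType.
Local Notation C := R[i].
Local Notation DE := (epseries (pol C dvar)).
Local Notation FE := (epseries (fourier_ring C)).
Local Notation piC := (pi : R)%:C%C.
Local Notation I := 'i%C.

Definition ahat (r : int) : FE := psC (fgen C (inl r)).
Definition bhat (r : int) : FE := psC (fgen C (inr r)).
Definition atilde (r : int) : FE := - 2%:R *+ (r == 0) + eps ^+ 2 * ahat r.
Definition btilde (r : int) : FE := 1 *+ (r == 0) + eps ^+ 2 * bhat r.

(* exp(2 pi i n epsilon) *)
Definition Zexp (n : int) : FE :=
  PSeries (fun k => ((twopii R * n%:~R) ^+ k / k`!%:R)%:A).

Definition bracket_ba (n m : int) : FE :=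
  epsdiv (zsum (fun r => let s := n + m - r in
    btilde r * atilde s * (Zexp (s - m) - 1))).

Definition bracket_gen (x y : zvar) : FE :=
  match x, y with
  | inr n, inr m => epsdiv (zsum (fun r => let s := n + m - r in
      btilde r * btilde s * (Zexp (s - m) - Zexp (s - n))))
  | inr n, inl m => bracket_ba n m
  | inl n, inr m => - bracket_ba m n
  | inl n, inl m => epsdiv (btilde (n + m) * (Zexp (- m) - Zexp (- n)))
  end.

(* The extension of [bracket_gen] to a continuous C[[epsilon]]-linear
   biderivation. The sum does not converge for all F and G: for
   F = sum_n b_n (b_{-1})^n and G = sum_n b_{-n} (b_1)^n it has a term
   4 pi i n (b_1 b_{-1})^n for every n > 1. It converges as soon as F or G is
   tame in the sense below, and { F , - } is then a continuous derivation of
   F[[epsilon]] for tame F. *)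
Definition pbracket (F G : FE) : FE :=
  vsum2 (fun x y => fderE x F * fderE y G * bracket_gen x y).

(* The partial derivatives of F tend to 0. Every series whose coefficients
   are of bounded degree is tame, in particular the L_n and the betahat_n. *)
Definition tame (F : FE) : Prop :=
  forall N n, exists M : nat, forall x : zvar,
    (M <= `|idx x|)%N -> fnbhd N n (fderE x F).

Definition Lser (Q : DE) (n : int) : FE := fE n (v0 R - Q).

Definition Xcas : FE :=
  \big[+%R/0]_(0 <= l <oo)
    (((-1) ^+ l / l.+1%:R) *: (eps ^+ (2 * l) * fE 0 (w0 R ^+ l.+1))).

Definition IQ' (Q : DE) : set FE :=
  closure (ideal_gen ([set Xcas] `|` [set Lser Q q | q in [set q | q != 0]])).

Definition good_extension (Q : DE) (x p : FE) : Prop :=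
  IQ' Q (p - x) /\
  forall q : int, q != 0 -> forall n : nat, (0 < n)%N ->
    mod_eps (IQ' Q) n (pbracket (Lser Q q) p).

(* [h] represents the induced bracket of the classes of [x] and [y] *)
Definition induced_bracket (Q : DE) (x y h : FE) : Prop :=
  exists p p', [/\ good_extension Q x p, good_extension Q y p',
    tame p \/ tame p' & IQ' Q (h - pbracket p p')].

Definition betahat (Q : DE) (n : int) : FE :=
  if n == 0 then
    2^-1 *: (ahat 0 + bhat 0) +
    2^-1 *: zsum (fun k => if k == 0 then 0 else Lser Q k * bhat (- k))
  else
    bhat n +
    (2^-1%:A + (n%:~R * I * piC / 2) *: eps
       - (piC ^+ 2 * n%:~R ^+ 2 / 4) *: eps ^+ 2) * Lser Q n +
    eps ^+ 2 * zsum (fun k => if k == 0 then 0 else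
      ((- (n%:~R / 8) + 3 * k%:~R / 8) / k%:~R) *:
        (bhat (n - k) * Lser Q k)).

Definition virasoro_rhs (Q : DE) (n m : int) : FE :=
  I *: (eps ^+ 2 * ((piC * (n - m)%:~R) *: betahat Q (n + m)
                    - (piC ^+ 3 * n%:~R ^+ 3 *+ (n == - m))%:A)).

(* the polynomials in epsilon and the beta_k *)
Definition beta_polynomials (Q : DE) : set FE :=
  range (peval (fun g : option int =>
    if g is Some k then betahat Q k else eps)).

End Poisson.

(* Main.v *)
(** Put S = exp(eps d / 2) and let c = 1 + eps^2 U be the solution of
    c * S c = 1 + eps^2 w. With c_j = S^j c, the substitution
    X_i = c_(2i-1) + c_(2i) - 4, Y_i = c_(2i) c_(2i+1) turns the Toda lattice
    into the square of a Volterra lattice, so that the Toda derivations restrict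
    to Volterra flows on the reduction -2 + eps^2 Q = c_(-1) + c_0 - 4. The
    defect e of c under such a derivation satisfies e * S c + c * S e = 0, which
    forces e = 0; hence the ideal of v - Q is invariant.

    Write t = i pi. Modulo eps^3, { betahat_n, L_m } is a multiple of
    eps^2 L_(n+m), once betahat_0 is changed by an element of the ideal. As
    { L_q, L_k } = 16 t q delta_(q,-k) + O(eps^2), a Neumann series gives a
    correction eps^3 sum_k mu_k L_k that makes all brackets with the L_q lie in
    the ideal. The induced bracket is thus that of the uncorrected elements
    modulo eps^3. It does not depend on the good extensions, because X is a
    Casimir: the derivatives of X are the Fourier coefficients of
    1 / (1 + eps^2 w), which are inverse to the btilde_r for the convolution.
    Finally the a_n and b_n are, modulo eps, linear combinations of betahat_n,
    X and elements of the ideal, and successive approximation gives density. *)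

From HB Require Import structures.
Require Import Defs.
From mathcomp Require Import all_boot all_order all_algebra finmap.
From mathcomp Require Import all_classical all_reals all_analysis complex.
From mathcomp Require Import zify ring.
From mathcomp Require Import -(notations) monalg.

Set Implicit Arguments.
Unset Strict Implicit.
Unset Printing Implicit Defensive.

Import Order.TTheory GRing.Theory Num.Theory.
Local Open Scope classical_set_scope.
Local Open Scope ring_scope.

(** * Polynomials and power series *)

(** The relations L_q = 0 with q <> 0 are second-class constraints, so that the good extensions play
    the part of a Dirac reduction, and the betahat_n are built to be nearly in involution with the
    L_m. This determines their constants. For n <> 0 the factors 1/2, t n / 2 and t^2 n^2 / 4 of L_n
    cancel the scalar terms of { L_m, betahat_n } at the orders eps^0, eps and eps^2, and the
    coefficient of b_(n-k) L_k makes the coefficients of a_(m+n) and b_(m+n) at order eps^2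
    opposite, as they are in the leading term of L_(m+n).

    The obstacle is convergence. The bracket is an infinite sum over pairs of variables that need
    not converge, and a coefficient in the Fourier ring may involve only finitely many weights.
    Hence the series constructed on the way, including the correction, are shown to be homogeneous
    in the weight, with the degree of the k-th coefficient at most k + D for some D. This is why
    degree bounds are proved for Q and carried through the fixed-point constructions. *)

Lemma leibnizM (A : comNzRingType) (D : A -> A) (a b : A) :
  (forall c, D (a * c) = D a * c + a * D c) ->
  (forall c, D (b * c) = D b * c + b * D c) ->
  forall c, D (a * b * c) = D (a * b) * c + a * b * D c.
Proof. by move=> ha hb c; rewrite -mulrA ha hb ha; ring. Qed.

Section PolynomialTools.
Variables (K : comNzRingType) (I : choiceType).
Implicit Types (m : cmonom I) (F G : pol K I).

Lemma mkmalgUM m1 m2 (c1 c2 : K) :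
  mkmalgU m1 c1 * mkmalgU m2 c2 = mkmalgU (mulcm m1 m2) (c1 * c2) :> pol K I.
Proof. by rewrite malgM_def fgmulUU. Qed.

Lemma mkmalgUZM m (c d : K) : mkmalgU m (c * d) = c *: mkmalgU m d :> pol K I.
Proof.
apply/malgP => k; rewrite (mcoeffZ c (mkmalgU m d) k).
rewrite [in LHS]mcoeffU [in RHS]mcoeffU; case: (m == k).
  by rewrite !mulr1n.
by rewrite !mulr0n mulr0.
Qed.

Lemma mkmalgUZ m (c : K) : mkmalgU m c = c *: mkmalgU m 1 :> pol K I.
Proof. by rewrite -mkmalgUZM mulr1. Qed.

Lemma divcmK m (i : I) : m i != 0%N -> mulcm (divcm m (ucm i)) (ucm i) = m.
Proof.
move=> mi; apply/eqP/cmP => j; rewrite mulcmE divcmE ucmE.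
by case: (i =P j) => [<-|_]; lia.
Qed.

(** Replaces expansions into monomials: identities between derivations or substitutions are checked
    on constants and variables and propagate through sums and products. A monomial is reached by
    splitting off one variable at a time, by induction on its degree. *)
Lemma pol_ind (P : pol K I -> Prop) :
  (forall c, P c%:A) -> (forall i, P (pvar K i)) ->
  (forall F G, P F -> P G -> P (F + G)) ->
  (forall F G, P F -> P G -> P (F * G)) -> forall F, P F.
Proof.
move=> PC PX PD PM F.
have PU m : P (mkmalgU m 1).
  have [n] := ubnP (mdeg m); elim: n m => // n IHn m mn.
  have [->|m1] := eqVneq m mone; first by move: (PC 1); rewrite scale1r.
  have [i mi] : exists i, m i != 0%N.
    apply: contrapT => h; case/eqP: m1; apply/eqP/cmP => i.
    by rewrite cm1; apply/eqP/negPn/negP => mi; apply: h; exists i.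
  have -> : mkmalgU m 1 = mkmalgU (divcm m (ucm i)) 1 * pvar K i.
    by rewrite mkmalgUM mulr1 divcmK.
  apply: PM (PX i); apply: IHn; move: mn; rewrite -{1}(divcmK mi).
  by rewrite [mdeg _]mdegM mdegU addn1.
rewrite (monalgE F); apply: big_ind => //; first by move: (PC 0); rewrite scale0r.
by move=> m _; rewrite mkmalgUZ -mulr_algl; apply: PM.
Qed.

Lemma peval_scalar (A : comAlgType K) (g : I -> A) (c : K) :
  peval g c%:A = c%:A.
Proof. by rewrite /peval mmapZ rmorph1 mulr1. Qed.

Lemma pevalZ (A : comAlgType K) (g : I -> A) (c : K) F :
  peval g (c *: F) = c *: peval g F.
Proof. by rewrite -mulr_algl rmorphM /= peval_scalar mulr_algl. Qed.

Lemma peval_var (A : comAlgType K) (g : I -> A) i : peval g (pvar K i) = g i.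
Proof.
rewrite /peval /pvar mmapU /= scale1r mul1r /meval mdomU big_seq_fset1.
by rewrite ucmE eqxx expr1.
Qed.

Lemma pol_rmorphism_ext (A : nzRingType) (f g : {rmorphism pol K I -> A}) :
  (forall c, f c%:A = g c%:A) -> (forall i, f (pvar K i) = g (pvar K i)) ->
  f =1 g.
Proof.
move=> hc hx; apply: pol_ind => // F G hF hG.
  by rewrite !rmorphD hF hG.
by rewrite !rmorphM hF hG.
Qed.

Lemma pderZ i (c : K) F : pder i (c *: F) = c *: pder i F.
Proof.
by apply/malgP => m; rewrite mcoeff_pder (mcoeffZ c F) (mcoeffZ c (pder i F)) mcoeff_pder mulrnAr.
Qed.

Lemma pderD i F G : pder i (F + G) = pder i F + pder i G.
Proof.
by apply/malgP => m; rewrite (mcoeffD m (pder i F) (pder i G)) mcoeff_pder (mcoeffD _ F G) mulrnDl -!mcoeff_pder.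
Qed.

Lemma pder0 i : pder i 0 = 0 :> pol K I.
Proof. by rewrite -[0 in LHS](scale0r 0) pderZ scale0r. Qed.

Lemma pder_sum i (J : Type) (r : seq J) (F : J -> pol K I) :
  pder i (\sum_(j <- r) F j) = \sum_(j <- r) pder i (F j).
Proof. exact: (big_morph (pder i) (pderD i) (pder0 i)). Qed.

Lemma pderU i m (c : K) :
  pder i (mkmalgU m c) = mkmalgU (divcm m (ucm i)) (c *+ m i).
Proof.
apply/malgP => k; rewrite mcoeff_pder mcoeffU mcoeffU.
have [mi|mi] := eqVneq (m i) 0%N.
  rewrite mi mulr0n mul0rn.
  case: (m =P mulcm k (ucm i)) => [mk|_]; last by rewrite mulr0n mul0rn.
  by move: mi; rewrite mk mulcmE ucmE eqxx; lia.
have -> : (m == mulcm k (ucm i)) = (divcm m (ucm i) == k).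
  apply/eqP/eqP => [->|<-]; last by rewrite divcmK.
  by apply/eqP/cmP => j; rewrite divcmE mulcmE addnK.
case: eqP => [<-|_]; last by rewrite !mulr0n mul0rn.
rewrite !mulr1n divcmE ucmE eqxx; congr (_ *+ _); lia.
Qed.

Lemma pder_var i j : pder i (pvar K j) = (i == j)%:R :> pol K I.
Proof.
rewrite pderU ucmE eq_sym; case: eqVneq => [->|_]; last first.
  by rewrite mulr0n monalgU0.
rewrite !mulr1n; suff -> : divcm (ucm j) (ucm j) = mone by [].
by apply/eqP/cmP => k; rewrite divcmE subnn cm1.
Qed.

Lemma pder_scalar i (c : K) : pder i (c%:A : pol K I) = 0.
Proof. by rewrite pderZ pderU cm1 mulr0n monalgU0 scaler0. Qed.

Lemma pderM i F G : pder i (F * G) = pder i F * G + F * pder i G.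
Proof.
elim/pol_ind: F G => [c|j|F1 F2 h1 h2|F1 F2 h1 h2] G.
- by rewrite pder_scalar mul0r add0r !mulr_algl pderZ.
- have XU m c : pvar K j * mkmalgU m c = mkmalgU (mulcm (ucm j) m) c.
    by rewrite mkmalgUM (mul1r c).
  rewrite pder_var (monalgE G) mulr_sumr !pder_sum !mulr_sumr -big_split /=.
  apply: eq_bigr => m _; move: (mcoeff m G) => c.
  rewrite [in LHS]XU [in LHS]pderU [in RHS]pderU [X in _ + X]XU mulcmE ucmE.
  have [<-|ij] := eqVneq j i.
    rewrite mulrnDr.
    have -> : divcm (mulcm (ucm j) m) (ucm j) = m.
      by apply/eqP/cmP => k; rewrite divcmE mulcmE addKn.
    rewrite monalgUD [X in _ = X * _ + _]mulr1n [X in _ = X + _]mul1r [c *+ true]mulr1n.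
    suff -> : mkmalgU (mulcm (ucm j) (divcm m (ucm j))) (c *+ m j) =
      mkmalgU m (c *+ m j) by [].
    (* If [m] lacks the variable, [divcm] truncates and multiplication does not undo it, but the
       coefficient is zero. *)
    have [->|mj] := eqVneq (m j) 0%N; first by rewrite mulr0n !monalgU0.
    by rewrite mulcmC divcmK.
  rewrite add0n [X in _ = X * _ + _]mulr0n [X in _ = X + _]mul0r [RHS]add0r.
  suff -> : divcm (mulcm (ucm j) m) (ucm i) = mulcm (ucm j) (divcm m (ucm i)) by [].
  apply/eqP/cmP => k; rewrite divcmE !mulcmE divcmE !ucmE.
  by case: (i =P k) => [<-|_]; [rewrite (negbTE ij); lia|lia].
- rewrite [in LHS]mulrDl [in LHS]pderD [X in X + _]h1 [X in _ + X = _]h2 [in RHS]pderD.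
  rewrite [X in _ = X + _]mulrDl [X in _ = _ + X]mulrDl; exact: addrACA.
- exact: (leibnizM h1 h2).
Qed.

Definition pvars F : {fset I} := (\bigcup_(m <- msupp F) finsupp m)%fset.

Section Pderivation.
Variables (A : comNzRingType) (phi : {additive pol K I -> A}) (h : I -> A).

(** The definition sums over the support of each monomial separately. Summing over one set [d] that
    contains all variables allows two polynomials and their sum or product to be compared term by
    term. *)
Lemma pderivationEw F (d : {fset I}) : (pvars F `<=` d)%fset ->
  pderivation phi h F = \sum_(x <- d) phi (pder x F) * h x.
Proof.
move=> Fd; rewrite /pderivation.
under [RHS]eq_bigr do rewrite pder.unlock raddf_sum mulr_suml.
rewrite exchange_big /= big_seq [RHS]big_seq; apply: eq_bigr => m mF.
have md : (finsupp m `<=` d)%fset.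
  by apply: fsubset_trans Fd; apply: bigfcup_sup.
rewrite (big_fset_incl _ md) // => x _.
rewrite -cmE_neq0 negbK => /eqP ->.
by rewrite mulr0n monalgU0 raddf0 mul0r.
Qed.

Lemma pderivationD F G :
  pderivation phi h (F + G) = pderivation phi h F + pderivation phi h G.
Proof.
pose d := (pvars F `|` pvars G `|` pvars (F + G)%R)%fset.
have dF : (pvars F `<=` d)%fset by rewrite /d -fsetUA fsubsetUl.
have dG : (pvars G `<=` d)%fset by rewrite /d fsetUC fsetUA fsubsetUr.
have dS : (pvars (F + G)%R `<=` d)%fset by rewrite fsubsetUr.
rewrite (pderivationEw dF) (pderivationEw dG) (pderivationEw dS) -big_split /=.
by apply: eq_bigr => x _; rewrite pderD raddfD mulrDl.
Qed.

Lemma pderivation_scalar (c : K) : pderivation phi h c%:A = 0.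
Proof.
rewrite (pderivationEw (fsubset_refl _)) big1 // => x _.
by rewrite pder_scalar raddf0 mul0r.
Qed.

End Pderivation.

Section PderivationMorphism.
Variables (A : comNzRingType) (phi : {rmorphism pol K I -> A}) (h : I -> A).

Lemma pderivation_var i : pderivation phi h (pvar K i) = h i.
Proof.
have sub : (pvars (pvar K i) `<=` [fset i])%fset.
  apply/bigfcupsP => m; rewrite msuppU oner_eq0 in_fset1 => /eqP -> _.
  by rewrite mdomU.
rewrite (pderivationEw _ _ sub) big_seq_fset1 pder_var eqxx.
rewrite [X in X * _](_ : _ = 1) ?mul1r //; exact: (rmorph1 phi).
Qed.

Lemma pderivationM F G : pderivation phi h (F * G) =
  pderivation phi h F * phi G + phi F * pderivation phi h G.
Proof.
pose d := (pvars F `|` pvars G `|` pvars (F * G)%R)%fset.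
have dF : (pvars F `<=` d)%fset by rewrite /d -fsetUA fsubsetUl.
have dG : (pvars G `<=` d)%fset by rewrite /d fsetUC fsetUA fsubsetUr.
have dS : (pvars (F * G) `<=` d)%fset by rewrite fsubsetUr.
rewrite (pderivationEw _ _ dF) (pderivationEw _ _ dG) (pderivationEw _ _ dS).
rewrite mulr_suml mulr_sumr -big_split /=; apply: eq_bigr => x _.
rewrite (pderM x F G) [X in X * _ = _](rmorphD phi) mulrDl.
rewrite [X in X * _ + _ = _](rmorphM phi) [X in _ + X * _ = _](rmorphM phi).
move: (phi _) (phi _) (phi _) (phi _) (h x) => a b e f g.
by rewrite mulrAC mulrA.
Qed.

End PderivationMorphism.
End PolynomialTools.

(** * Power series in epsilon and epsilon-linear maps *)

Section SeriesTools.
Variable T : comNzRingType.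
Implicit Types F G : epseries T.

Lemma ps0coef n : (0 : epseries T) n = 0.
Proof. by []. Qed.

Lemma psMcoef F G n : (F * G) n = \sum_(i < n.+1) F i * G (n - i)%N.
Proof. by []. Qed.

Lemma psMcoef0 F G : (F * G) 0%N = F 0%N * G 0%N.
Proof. by rewrite psMcoef big_ord1. Qed.

Lemma psCMcoef (c : T) F n : (psC c * F) n = c * F n.
Proof.
rewrite psMcoef big_ord_recl /= subn0 mulr1n big1 ?addr0 // => i _.
by rewrite mul0r.
Qed.

Lemma epsMcoef0 F : (eps * F) 0%N = 0.
Proof. by rewrite psMcoef0 mul0r. Qed.

Lemma epsMcoefS F n : (eps * F) n.+1 = F n.
Proof.
rewrite psMcoef !big_ord_recl /= mul0r add0r mul1r big1 ?addr0 /bump //=.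
  by rewrite subSS subn0.
by move=> i _; rewrite mul0r.
Qed.

Lemma epsXMcoef n F k :
  (eps ^+ n * F) k = if (k < n)%N then 0 else F (k - n)%N.
Proof.
elim: n k => [|n IHn] k; first by rewrite expr0 mul1r subn0.
by rewrite exprS -mulrA; case: k => [|k]; rewrite ?epsMcoef0 ?epsMcoefS ?IHn.
Qed.

Definition epsdrop n F : epseries T := PSeries (fun k => F (n + k)%N).

Lemma epsdropK n F : (forall k, (k < n)%N -> F k = 0) ->
  F = eps ^+ n * epsdrop n F.
Proof.
move=> h; apply: epseriesP => k; rewrite epsXMcoef; case: ltnP => [/h //|nk].
by rewrite /= subnKC.
Qed.

Lemma epsdivK F : F 0%N = 0 -> eps * epsdiv F = F.
Proof.
by move=> F0; apply: epseriesP => -[|k]; rewrite ?epsMcoef0 ?epsMcoefS.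
Qed.

Lemma epsMK F : epsdiv (eps * F) = F.
Proof. by apply: epseriesP => k; rewrite /epsdiv /= -epsMcoefS. Qed.

Lemma epsM_inj : injective (fun F => eps * F).
Proof. by move=> F G /= /(congr1 (@epsdiv _)); rewrite !epsMK. Qed.

Lemma epsX_inj n : injective (fun F => eps ^+ n * F).
Proof.
elim: n => [|n IHn] F G /=; first by rewrite !expr0 !mul1r.
by rewrite exprS -!mulrA => /epsM_inj /IHn.
Qed.

Lemma psC_eps_decomp F : F = psC (F 0%N) + eps * epsdiv F.
Proof.
apply: epseriesP => -[|k].
  by change (F 0%N = F 0%N + (eps * epsdiv F) 0%N); rewrite epsMcoef0 addr0.
change (F k.+1 = 0 + (eps * epsdiv F) k.+1).
by rewrite epsMcoefS add0r.
Qed.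

Fact psC_additive : additive (@psC T).
Proof. by move=> a b; apply: epseriesP => k /=; rewrite mulrnBl. Qed.
Fact psC_multiplicative : multiplicative (@psC T).
Proof.
split=> [a b|//]; apply: epseriesP => k; rewrite psCMcoef /=.
by rewrite mulrnAr.
Qed.
HB.instance Definition _ :=
  GRing.isAdditive.Build T (epseries T) (@psC T) psC_additive.
HB.instance Definition _ :=
  GRing.isMultiplicative.Build T (epseries T) (@psC T) psC_multiplicative.

End SeriesTools.

Lemma psCZ (K : comNzRingType) (T : comAlgType K) (c : K) (x : T) :
  psC (c *: x) = c *: psC x.
Proof. by apply: epseriesP => k /=; rewrite scalerMnr. Qed.

Section EpsLinear.
Variables (S T : comNzRingType).

(** Compatibility with eps gives continuity, as a multiple of eps^n is sent to a multiple of eps^n.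
    Such a map is therefore determined by its values on constant series, with no separate hypothesis
    on limits. *)
Definition epslin (f : epseries S -> epseries T) : Prop :=
  (forall F G, f (F + G) = f F + f G) /\ (forall F, f (eps * F) = eps * f F).

Lemma epslin_ext f g : epslin f -> epslin g ->
  (forall s, f (psC s) = g (psC s)) -> f =1 g.
Proof.
move=> [fD fE] [gD gE] fg F; apply: epseriesP => k.
elim: k F => [|k IHk] F; rewrite (psC_eps_decomp F) fD gD fE gE fg.
  by congr (_ + _); rewrite !epsMcoef0.
by congr (_ + _); rewrite !epsMcoefS.
Qed.

Lemma epslinX f n F : epslin f -> f (eps ^+ n * F) = eps ^+ n * f F.
Proof.
move=> [_ fE]; elim: n F => [|n IHn] F; first by rewrite !expr0 !mul1r.
by rewrite !exprS -!mulrA fE IHn.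
Qed.

Lemma epslinD f g : epslin f -> epslin g -> epslin (fun F => f F + g F).
Proof.
move=> [fD fE] [gD gE]; split=> [F G|F]; first by rewrite fD gD addrACA.
by rewrite fE gE mulrDr.
Qed.

Lemma epslin0 f : epslin f -> f 0 = 0.
Proof. by move=> [fD _]; apply: (addrI (f 0)); rewrite -fD !addr0. Qed.

Lemma epslinN f F : epslin f -> f (- F) = - f F.
Proof.
move=> lf; have [fD _] := lf; apply/eqP; rewrite -addr_eq0 -fD addNr.
by rewrite epslin0.
Qed.

Lemma epslinB f F G : epslin f -> f (F - G) = f F - f G.
Proof. by move=> lf; have [fD _] := lf; rewrite fD epslinN. Qed.

Lemma epslin_cont f n (F G : epseries S) : epslin f ->
  (forall k, (k < n)%N -> F k = G k) -> forall k, (k < n)%N -> f F k = f G k.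
Proof.
move=> lf FG k kn.
have h : forall j, (j < n)%N -> (F - G) j = 0.
  by move=> j jn; change (F j - G j = 0); rewrite FG ?subrr.
have : f F - f G = eps ^+ n * f (epsdrop n (F - G)).
  by rewrite -epslinX // -epsdropK // epslinB.
move=> /(congr1 (fun H : epseries T => H k)); rewrite epsXMcoef kn.
by move=> /eqP; rewrite subr_eq0 => /eqP.
Qed.

Section Psextend.
Variable phi : {additive S -> epseries T}.

Lemma psextend_psC s : psextend phi (psC s) = phi s.
Proof.
apply: epseriesP => n; rewrite /= big_ord_recl /= subn0 mulr1n big1 ?addr0 //.
by move=> i _; rewrite mulr0n raddf0.
Qed.

Lemma psextend_epslin : epslin (psextend phi).
Proof.
split=> [F G|F]; apply: epseriesP => n /=.
  change (\sum_(k < n.+1) phi (F k + G k) (n - k)%N =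
    \sum_(k < n.+1) phi (F k) (n - k)%N + \sum_(k < n.+1) phi (G k) (n - k)%N).
  by rewrite -big_split /=; apply: eq_bigr => k _; rewrite raddfD.
change (\sum_(k < n.+1) phi ((eps * F) k) (n - k)%N = (eps * psextend phi F) n).
rewrite big_ord_recl epsMcoef0 raddf0 ps0coef add0r.
case: n => [|n]; first by rewrite big_ord0 epsMcoef0.
rewrite epsMcoefS; apply: eq_bigr => k _.
by rewrite lift0 epsMcoefS subSS.
Qed.

End Psextend.
End EpsLinear.

Lemma epslinM_l (S T : comNzRingType) (f : epseries S -> epseries T) G :
  epslin f -> epslin (fun F => f F * G).
Proof.
move=> [fD fE]; split=> [F H|F]; first by rewrite fD mulrDl.
by rewrite fE mulrA.
Qed.

Lemma epslinM_r (S T : comNzRingType) (f : epseries S -> epseries T) G :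
  epslin f -> epslin (fun F => G * f F).
Proof.
move=> [fD fE]; split=> [F H|F]; first by rewrite fD mulrDr.
by rewrite fE mulrCA.
Qed.

Lemma epslin_id (S : comNzRingType) : epslin (@id (epseries S)).
Proof. by []. Qed.

Lemma epslin_comp (S T U : comNzRingType) (f : epseries S -> epseries T)
  (g : epseries T -> epseries U) : epslin f -> epslin g -> epslin (g \o f).
Proof.
move=> [fD fE] [gD gE]; split=> [F G|F] /=; first by rewrite fD gD.
by rewrite fE gE.
Qed.

(** Both sides are epsilon-linear in each argument, so [epslin_ext] applies twice and leaves only
    constant series. *)
Lemma epslin_leibniz (S T : comNzRingType)
  (f p q : epseries S -> epseries T) : epslin f -> epslin p -> epslin q ->
  (forall s t, f (psC s * psC t) = f (psC s) * p (psC t) + q (psC s) * f (psC t)) ->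
  forall F G, f (F * G) = f F * p G + q F * f G.
Proof.
move=> lf lp lq h F G.
have lM G' : epslin (fun F => f (F * G')).
  exact: (epslin_comp (epslinM_l G' (@epslin_id S)) lf).
have lMr F' : epslin (fun G => f (F' * G)).
  exact: (epslin_comp (epslinM_r F' (@epslin_id S)) lf).
apply: (epslin_ext (f := fun F => f (F * G))
  (g := fun F => f F * p G + q F * f G)) => //.
  by apply: epslinD; apply: epslinM_l.
move=> s; apply: (epslin_ext (f := fun G => f (psC s * G))
  (g := fun G => f (psC s) * p G + q (psC s) * f G)) => //.
by apply: epslinD; apply: epslinM_r.
Qed.

Lemma epslin_mul (S T : comNzRingType) (f : epseries S -> epseries T) :
  epslin f ->
  (forall s t, f (psC s * psC t) = f (psC s) * f (psC t)) ->
  forall F G, f (F * G) = f F * f G.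
Proof.
move=> lf h F G.
have lM G' : epslin (fun F => f (F * G')).
  exact: (epslin_comp (epslinM_l G' (@epslin_id S)) lf).
have lMr F' : epslin (fun G => f (F' * G)).
  exact: (epslin_comp (epslinM_r F' (@epslin_id S)) lf).
apply: (epslin_ext (f := fun F => f (F * G)) (g := fun F => f F * f G)) => //.
  exact: epslinM_l.
move=> s; apply: (epslin_ext (f := fun G => f (psC s * G))
  (g := fun G => f (psC s) * f G)) => //.
exact: epslinM_r.
Qed.

HB.instance Definition _ (S T : comNzRingType) (phi : {additive S -> epseries T}) :=
  GRing.isAdditive.Build (epseries S) (epseries T) (psextend phi)
    (fun F G => epslinB F G (psextend_epslin phi)).

Section PsextendMorphism.
Variables (S T : comNzRingType) (phi : {rmorphism S -> epseries T}).

Fact psextend_multiplicative : multiplicative (psextend phi).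
Proof.
split.
  move=> F G; apply: (epslin_mul (psextend_epslin phi)) => s t.
  rewrite -(rmorphM (@psC S)) !psextend_psC; exact: (rmorphM phi).
by change (psextend phi (psC 1) = 1); rewrite psextend_psC; exact: (rmorph1 phi).
Qed.
HB.instance Definition _ := GRing.isMultiplicative.Build _ _
  (psextend phi) psextend_multiplicative.

End PsextendMorphism.

Section SeriesFixpoint.
Variables (J : Type) (T : zmodType).
Implicit Types u v : J -> epseries T.

(** Contraction principle for the eps-adic topology: [G] determines one more coefficient than it is
    given. The invariant [P] can carry weight and degree bounds to the fixed point, provided that it
    passes to diagonal limits. *)
Lemma epseries_fixpoint (P : (J -> epseries T) -> Prop)
    (G : (J -> epseries T) -> (J -> epseries T)) :
  P (fun=> 0) -> (forall u, P u -> P (G u)) ->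
  (forall u v n, P u -> P v -> (forall j k, (k < n)%N -> u j k = v j k) ->
     forall j k, (k <= n)%N -> G u j k = G v j k) ->
  (forall s : nat -> J -> epseries T, (forall i, P (s i)) ->
     P (fun j => PSeries (fun k => s k.+1 j k))) ->
  exists u, P u /\ forall j, G u j = u j.
Proof.
move=> P0 PG Gc Plim.
pose s i := iter i G (fun=> 0).
have Ps i : P (s i) by elim: i => //= i; apply: PG.
have stab i : forall j k, (k < i)%N -> s i.+1 j k = s i j k.
  elim: i => // i IHi j k ki /=.
  exact: (Gc _ _ i (Ps _) (Ps _) IHi).
have stab' i i' : (i <= i')%N -> forall j k, (k < i)%N -> s i' j k = s i j k.
  move=> ii' j k ki; rewrite -(subnK ii'); elim: (i' - i)%N => // d IHd.
  by rewrite addSn stab ?IHd // (leq_trans ki) ?leq_addl.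
(* The coefficient of eps^k is final from the iterate k + 1 on. *)
exists (fun j => PSeries (fun k => s k.+1 j k)); split; first exact: Plim.
move=> j; apply: epseriesP => k.
rewrite [RHS]/= -/(s k).
apply: (Gc _ _ k) => //; first exact: Plim.
by move=> j' k' kk' /=; rewrite (stab' k'.+1 k).
Qed.

End SeriesFixpoint.

Arguments psmul : simpl never.

(** * Shifts and the Volterra lattice *)

Lemma zscaleE (K : comNzRingType) (T : comAlgType K) (c : K) (F : epseries T) n :
  (c *: F) n = c *: F n.
Proof. by []. Qed.

Lemma psCoef_sum (T : comNzRingType) (J : Type) (r : seq J) (P : pred J)
    (F : J -> epseries T) n :
  (\sum_(j <- r | P j) F j) n = \sum_(j <- r | P j) F j n.
Proof. exact: (big_morph (fun G : epseries T => G n) (fun _ _ => erefl) erefl). Qed.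

Section ShiftSeries.
Variables (K : numFieldType) (A : comAlgType K) (d : {linear A -> A}).
Hypothesis dM : forall a b, d (a * b) = d a * b + a * d b.

Definition dser (F : epseries A) : epseries A := PSeries (fun n => d (F n)).

(** The operator exp(c eps d). The scalar [c] ranges over the field because shifts by half a lattice
    step are needed. *)
Definition sh (c : K) (F : epseries A) : epseries A :=
  PSeries (fun n => \sum_(m < n.+1) (c ^+ m / m`!%:R) *: iter m d (F (n - m)%N)).

(** Divided powers of [d]; with them the Leibniz rule is a plain convolution, free of binomial
    coefficients. *)
Definition divpow (n : nat) (a : A) : A := (n`!%:R)^-1 *: iter n d a.

Lemma iter_derD n a b : iter n d (a + b) = iter n d a + iter n d b.
Proof. by elim: n => //= n ->; rewrite linearD. Qed.

Lemma iter_der0 n : iter n d 0 = 0.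
Proof. by elim: n => //= n ->; rewrite linear0. Qed.

Lemma iter_derZ n (c : K) a : iter n d (c *: a) = c *: iter n d a.
Proof. by elim: n => //= n ->; rewrite linearZ. Qed.

Lemma dser_epslin : epslin dser.
Proof.
split=> [F G|F]; apply: epseriesP => n.
  by rewrite /= -linearD.
change (d ((eps * F) n) = (eps * dser F) n).
by case: n => [|n]; rewrite ?epsMcoef0 ?linear0 // !epsMcoefS.
Qed.

Lemma dser_psC a : dser (psC a) = psC (d a).
Proof. by apply: epseriesP => -[|n] /=; rewrite ?mulr1n ?mulr0n ?linear0. Qed.

Lemma dserM F G : dser (F * G) = dser F * G + F * dser G.
Proof.
apply: (epslin_leibniz (p := id) (q := id) dser_epslin) => // a b.
by rewrite -(rmorphM (@psC A)) !dser_psC dM rmorphD !(rmorphM (@psC A)).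
Qed.

Lemma divpowS n a : n.+1%:R *: divpow n.+1 a = d (divpow n a).
Proof.
have n1 : n.+1%:R != 0 :> K by rewrite pnatr_eq0.
rewrite /divpow scalerA [RHS]linearZ /=; congr (_ *: _).
by rewrite factS natrM invfM mulrA divff ?mul1r.
Qed.

Lemma divpowM n a b :
  divpow n (a * b) = \sum_(i < n.+1) divpow i a * divpow (n - i) b.
Proof.
elim: n => [|n IHn]; first by rewrite big_ord1 /divpow /= fact0 invr1 !scale1r.
have n1 : n.+1%:R != 0 :> K by rewrite pnatr_eq0.
apply: (scalerI n1); rewrite divpowS IHn linear_sum /=.
transitivity (\sum_(i < n.+1) (i.+1%:R *: (divpow i.+1 a * divpow (n - i) b)
    + (n - i).+1%:R *: (divpow i a * divpow (n - i).+1 b))).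
  apply: eq_bigr => i _; rewrite dM -!divpowS.
  by rewrite scalerAl scalerAr.
rewrite big_split /= scaler_sumr.
(* Split n + 1 as i + (n + 1 - i): the two parts match the derivatives of the first and of the
   second factor. *)
have split_n (i : 'I_n.+2) : n.+1%:R *: (divpow i a * divpow (n.+1 - i) b) =
    i%:R *: (divpow i a * divpow (n.+1 - i) b) +
    (n.+1 - i)%:R *: (divpow i a * divpow (n.+1 - i) b).
  by rewrite -scalerDl -natrD subnKC // -ltnS.
rewrite (eq_bigr _ (fun i _ => split_n i)) big_split /=; congr (_ + _).
  rewrite [RHS]big_ord_recl scale0r add0r; apply: eq_bigr => i _.
  by rewrite lift0 subSS.
rewrite [RHS]big_ord_recr /= subnn scale0r addr0; apply: eq_bigr => i _.
by rewrite subSn // -ltnS.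
Qed.

Lemma sh_psC c a n : sh c (psC a) n = c ^+ n *: divpow n a.
Proof.
rewrite /= big_ord_recr /= subnn mulr1n big1 ?add0r.
  by rewrite /divpow scalerA.
by move=> i _; rewrite subn_eq0 leqNgt ltn_ord mulr0n iter_der0 scaler0.
Qed.

Lemma sh_epslin c : epslin (sh c).
Proof.
split=> [F G|F]; apply: epseriesP => n.
  rewrite /= -big_split /=; apply: eq_bigr => m _.
  by rewrite -scalerDr -iter_derD.
change (\sum_(m < n.+1) (c ^+ m / m`!%:R) *: iter m d ((eps * F) (n - m)%N) =
  (eps * sh c F) n).
rewrite big_ord_recr.
have -> : (eps * F) (n - @ord_max n)%N = 0 by rewrite [(n - _)%N]subnn epsMcoef0.
rewrite iter_der0 scaler0 [LHS]addr0.
case: n => [|n]; first by rewrite big_ord0 epsMcoef0.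
rewrite epsMcoefS; apply: eq_bigr => m _.
rewrite -[nat_of_ord (widen_ord _ m)]/(nat_of_ord m).
by rewrite subSn ?epsMcoefS // -ltnS.
Qed.

Lemma sh_coef0 c F : sh c F 0%N = F 0%N.
Proof. by rewrite /= big_ord1 /= expr0 divr1 scale1r. Qed.

Lemma shM c F G : sh c (F * G) = sh c F * sh c G.
Proof.
apply: epslin_mul (sh_epslin c) _ F G => a b; apply: epseriesP => n.
rewrite -(rmorphM (@psC A)) sh_psC psMcoef divpowM scaler_sumr.
apply: eq_bigr => i _; rewrite !sh_psC -[in RHS]scalerAl -[in RHS]scalerAr.
by rewrite scalerA -(exprD c) subnKC // -ltnS.
Qed.

Lemma sh1 c : sh c 1 = 1.
Proof.
have d1 : d 1 = 0.
  by apply: (addrI (d 1)); rewrite addr0 -{3}[1]mulr1 dM mulr1 mul1r.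
apply: epseriesP => -[|n]; first by rewrite sh_coef0.
change (sh c (psC 1) n.+1 = 0); rewrite sh_psC /divpow iterSr d1 iter_der0.
by rewrite !scaler0.
Qed.

Lemma sh_id F : sh 0 F = F.
Proof.
apply: epseriesP => n; rewrite /= big_ord_recl /= subn0 expr0 divr1.
rewrite scale1r big1 ?addr0 // => i _.
by rewrite expr0n mul0r scale0r.
Qed.

Lemma sh_comp a b F : sh a (sh b F) = sh (a + b) F.
Proof.
apply: (epslin_ext (epslin_comp (sh_epslin b) (sh_epslin a)) (sh_epslin _)) => x.
apply: epseriesP => n; rewrite sh_psC addrC exprDn scaler_suml.
rewrite -[LHS]/(\sum_(m < n.+1) (a ^+ m / m`!%:R) *: iter m d (sh b (psC x) (n - m)%N)).
apply: eq_bigr => m _; have mn : (m <= n)%N by rewrite -ltnS.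
rewrite sh_psC /divpow iter_derZ iter_derZ -iterD subnKC //.
rewrite !scalerA; congr (_ *: _).
have fK k : k`!%:R != 0 :> K by rewrite pnatr_eq0 -lt0n fact_gt0.
have bK : 'C(n, m)%:R != 0 :> K by rewrite pnatr_eq0 -lt0n bin_gt0.
rewrite -[_ *+ 'C(n, m)]mulr_natr -(bin_fact mn) !natrM.
move: (fK m) (fK (n - m)%N) bK; move: (m`!%:R : K) ((n - m)`!%:R : K) ('C(n, m)%:R : K).
by move=> u y z u0 y0 z0; field; rewrite u0 y0 z0.
Qed.

Lemma sh_approx c n F k : (k < n)%N ->
  sh c F k = (\sum_(m < n) (c ^+ m / m`!%:R) *: (eps ^+ m * iter m dser F)) k.
Proof.
move=> kn; rewrite psCoef_sum -[LHS]/(\sum_(m < k.+1) (c ^+ m / m`!%:R) *: iter m d (F (k - m)%N)).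
rewrite (big_ord_widen n (fun m => (c ^+ m / m`!%:R) *: iter m d (F (k - m)%N)) kn).
rewrite big_mkcond; apply: eq_bigr => m _; rewrite zscaleE epsXMcoef ltnS.
case: leqP => mk; last by rewrite scaler0.
congr (_ *: _); elim: (nat_of_ord m) (k - m)%N => //= m' IH k'.
by rewrite IH.
Qed.

(** Below any given order in eps the exponential is a finite sum of terms eps^m d^m, and [f]
    commutes with each of them. *)
Lemma sh_commute (f : epseries A -> epseries A) c F : epslin f ->
  (forall (e : K) G, f (e *: G) = e *: f G) ->
  (forall G, f (dser G) = dser (f G)) -> f (sh c F) = sh c (f F).
Proof.
move=> lf fZ fd; apply: epseriesP => n.
rewrite (sh_approx _ _ (ltnSn n)).
rewrite (epslin_cont lf (fun k => @sh_approx c n.+1 F k) (ltnSn n)).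
have f_sum : forall k, f (\sum_(m < k) (c ^+ m / m`!%:R) *: (eps ^+ m * iter m dser F))
    = \sum_(m < k) (c ^+ m / m`!%:R) *: (eps ^+ m * iter m dser (f F)).
  elim=> [|k IHk]; first by rewrite !big_ord0 epslin0.
  rewrite !big_ord_recr /=; have [fD _] := lf; rewrite fD IHk fZ epslinX //.
  have -> : f (iter k dser F) = iter k dser (f F); last by [].
  by elim: k {IHk} => //= k IHk; rewrite fd IHk.
by rewrite f_sum.
Qed.

Lemma sh_coef1 F c : sh c F 1%N = F 1%N + c *: d (F 0%N).
Proof.
by rewrite /= !big_ord_recl big_ord0 /= expr0 !divr1 scale1r expr1 addr0.
Qed.

Lemma sh_coef2 F c : sh c F 2%N = F 2%N + c *: d (F 1%N) + (c ^+ 2 / 2) *: d (d (F 0%N)).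
Proof.
by rewrite /= !big_ord_recl big_ord0 /= expr0 !divr1 scale1r expr1 addr0 addrA.
Qed.

End ShiftSeries.

Section Volterra.
Variables (A : comNzRingType) (c : int -> A).

(** The k-th power of L^2 - 4, computed by left multiplication, for the Volterra matrix L described
    below. The shift by 4 matches [Phi]: at c = 1 the diagonal entries become 1 + 1 - 4 = -2 and the
    upper ones 1. *)
Definition volterra_square (k : nat) : int -> int -> A :=
  iter k (fun N j l => N (j - 2) l + (c (j - 1) + c j - 4%:R) * N j l
                       + c j * c (j + 1) * N (j + 2) l) (fun j l => (j == l)%:R).

(* With the half-integer lattice rescaled to the integers, X_i and Y_i below
   are the entries of L^2 - 4 at even sites, where L is the Volterra matrix
   with entries 1 below and c_j above the diagonal; L commutes with its
   powers. *)
Lemma volterra_commute k j l : let N := volterra_square k in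
  N (j - 1) l + c j * N (j + 1) l = N j (l + 1) + c (l - 1) * N j (l - 1).
Proof.
elim: k j l => [|k IHk] j l /=.
  have -> : (j - 1 == l) = (j == l + 1) by apply/eqP/eqP; lia.
  have -> : (j + 1 == l) = (j == l - 1) by apply/eqP/eqP; lia.
  by case: (j =P l - 1) => [->|]; rewrite ?mulr1 ?mulr0.
rewrite -/(volterra_square k); set N := volterra_square k in IHk *.
have h0 := IHk j l; have hm := IHk (j - 2) l; have hp := IHk (j + 2) l.
have e1 : j - 1 - 2 = j - 2 - 1 by lia.
have e2 : j - 1 + 1 = j by lia.
have e3 : j - 1 + 2 = j + 1 by lia.
have e4 : j + 1 - 2 = j - 1 by lia.
have e5 : j + 1 - 1 = j by lia.
have e6 : j + 1 + 2 = j + 2 + 1 by lia.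
have e7 : j - 2 + 1 = j - 1 by lia.
have e8 : j + 2 - 1 = j + 1 by lia.
have e9 : j - 1 - 1 = j - 2 by lia.
have e10 : j + 1 + 1 = j + 2 by lia.
rewrite e1 e2 e3 e4 e5 e6 e9 e10; rewrite e7 in hm; rewrite e8 in hp.
transitivity ((N (j - 2 - 1) l + c (j - 2) * N (j - 1) l)
  + (c (j - 1) + c j - 4%:R) * (N (j - 1) l + c j * N (j + 1) l)
  + c j * c (j + 1) * (N (j + 1) l + c (j + 2) * N (j + 2 + 1) l)); first by ring.
by rewrite h0 hm hp; ring.
Qed.

(** The (j, j+1) entry of the commutator of L with the strictly upper part of (L^2 - 4)^k, that is,
    the derivative of c_j along the Volterra flow. The entries of that part on the diagonal are
    zero, which leaves two terms. *)
Definition volterra_flow (k : nat) (j : int) : A :=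
  volterra_square k (j - 1) (j + 1) - volterra_square k j (j + 2).

(** On the left stands the (0,1) entry of the Toda commutator in terms of c, on the right the
    derivative of Y_0 = c_0 c_1. Two instances of [volterra_commute] eliminate the entries (-2,2)
    and (-1,3). *)
Lemma volterra_flow_toda k : let N := volterra_square k in
  N (-2) 2 - N 0 4 + (c (-1) + c 0 - c 1 - c 2) * N 0 2 =
  volterra_flow k 0 * c 1 + c 0 * volterra_flow k 1.
Proof.
have := volterra_commute k (-1) 2; have := volterra_commute k 0 3.
rewrite /volterra_flow /=; set N := volterra_square k => h1 h2.
have {}h1 : N (-1) 3 + c 0 * N 1 3 = N 0 4 + c 2 * N 0 2 := h1.
have {}h2 : N (-2) 2 + c (-1) * N 0 2 = N (-1) 3 + c 1 * N (-1) 1 := h2.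
change (N (-2) 2 - N 0 4 + (c (-1) + c 0 - c 1 - c 2) * N 0 2 =
  (N (-1) 1 - N 0 2) * c 1 + c 0 * (N 0 2 - N 1 3)).
have -> : N (-2) 2 = N (-1) 3 + c 1 * N (-1) 1 - c (-1) * N 0 2 by rewrite -h2; ring.
have -> : N (-1) 3 = N 0 4 + c 2 * N 0 2 - c 0 * N 1 3 by rewrite -h1; ring.
by ring.
Qed.

End Volterra.

Section RmorphismExpansion.
Variables (P A : comNzRingType) (f : {rmorphism P -> A}).

(** The products with 0 and 1 in these facts come from the band matrix and from the strictly upper
    part of its power. In an abstract ring the rewriting never meets the concrete polynomial
    structures. *)
Fact add3_mul1l (a b c x y : P) : 1 * a + (x * b + y * c) = a + x * b + y * c.
Proof. by rewrite mul1r addrA. Qed.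

Fact add3_mulr1 (a b c x y : P) : a * x + (b * y + c * 1) = a * x + b * y + c.
Proof. by rewrite mulr1 addrA. Qed.

Fact rmorph_recurrence a x b y c :
  f (a + x * b + y * c) = f a + f x * f b + f y * f c.
Proof. by rewrite !rmorphD !rmorphM. Qed.

Fact rmorph_commutator00 a x y z w b :
  f (a + x * 0 + y * 0 - (0 * z + 0 * w + b)) = f a - f b.
Proof. by rewrite !mulr0 !mul0r !addr0 add0r rmorphB. Qed.

Fact rmorph_commutator01 a x b y z w c :
  f (a + x * b + y * 0 - (0 * z + b * w + c)) = f a - f c + (f x - f w) * f b.
Proof.
rewrite !mulr0 !mul0r !addr0 add0r rmorphB !rmorphD !rmorphM.
by ring.
Qed.

End RmorphismExpansion.

(** * Entries of the Toda commutators under a substitution *)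

Section TodaEval.
Variable R : realType.
Local Notation C := R[i].
Variables (A : comAlgType C) (g : zvar -> A).

Lemma toda_mx_mull (B : int -> int -> pol C zvar) i j :
  zmx_mul (toda_mx R) B i j =
  B (i - 1) j + pvar C (inl i) * B i j + pvar C (inr i) * B (i + 1) j.
Proof.
rewrite /zmx_mul (@fsbigTE _ _ _ _ [fset (i - 1)%R; i; (i + 1)%R]%fset) /=; last first.
  move=> l; rewrite !inE /toda_mx => h.
  case: ifP => [/eqP|_]; first by lia.
  case: ifP => [/eqP|_]; first by lia.
  case: ifP => [/eqP|_]; first by lia.
  by rewrite mul0r.
have n1 : i - 1 \notin [fset i; (i + 1)%R]%fset by rewrite !inE; lia.
have n2 : i \notin [fset (i + 1)%R]%fset by rewrite !inE; lia.
rewrite -fsetUA big_fsetU1 // big_fsetU1 // big_seq_fset1.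
rewrite /toda_mx.
have -> : i == i - 1 + 1 by lia.
have -> : (i == i + 1) = false by lia.
have -> : (i == i + 1 + 1) = false by lia.
rewrite !eqxx; exact: add3_mul1l.
Qed.

Lemma toda_mx_mulr (B : int -> int -> pol C zvar) i j :
  zmx_mul B (toda_mx R) i j =
  B i (j - 1) * pvar C (inr (j - 1)) + B i j * pvar C (inl j) + B i (j + 1).
Proof.
rewrite /zmx_mul (@fsbigTE _ _ _ _ [fset (j - 1)%R; j; (j + 1)%R]%fset) /=; last first.
  move=> l; rewrite !inE /toda_mx => h.
  case: ifP => [/eqP|_]; first by lia.
  case: ifP => [/eqP|_]; first by lia.
  case: ifP => [/eqP|_]; first by lia.
  by rewrite mulr0.
have n1 : j - 1 \notin [fset j; (j + 1)%R]%fset by rewrite !inE; lia.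
have n2 : j \notin [fset (j + 1)%R]%fset by rewrite !inE; lia.
rewrite -fsetUA big_fsetU1 // big_fsetU1 // big_seq_fset1.
rewrite /toda_mx.
have -> : (j - 1 == j + 1) = false by lia.
have -> : (j - 1 == j) = false by lia.
have -> : (j == j + 1) = false by lia.
have -> : j == j - 1 + 1 by lia.
rewrite !eqxx; exact: add3_mulr1.
Qed.

Definition toda_power (k : nat) : int -> int -> A :=
  iter k (fun N i l => N (i - 1) l + g (inl i) * N i l + g (inr i) * N (i + 1) l)
    (fun i l => (i == l)%:R).

Lemma peval_toda_exp k i l :
  peval g (zmx_exp (toda_mx R) k i l) = toda_power k i l.
Proof.
elim: k i l => [|k IHk] i l /=; first by rewrite /zmx_exp /= rmorph_nat.
rewrite /zmx_exp /= -/(zmx_exp _ k) toda_mx_mull.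
apply: etrans (rmorph_recurrence (peval g) _ _ _ _ _) _ => /=.
congr (_ + _ * _ + _ * _); [exact: IHk|exact: peval_var|exact: IHk|exact: peval_var|exact: IHk].
Qed.

Lemma peval_toda_comm00 k :
  peval g (toda_comm R k 0 0) = toda_power k (-1) 0 - toda_power k 0 1.
Proof.
rewrite /toda_comm toda_mx_mull toda_mx_mulr /zmx_upper /=.
apply: etrans (rmorph_commutator00 (peval g) _ _ _ _ _ _) _ => /=.
congr (_ - _); exact: peval_toda_exp.
Qed.

Lemma peval_toda_comm01 k :
  peval g (toda_comm R k 0 1) = toda_power k (-1) 1 - toda_power k 0 2
    + (g (inl 0) - g (inl 1)) * toda_power k 0 1.
Proof.
rewrite /toda_comm toda_mx_mull toda_mx_mulr /zmx_upper /=.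
apply: etrans (rmorph_commutator01 (peval g) _ _ _ _ _ _ _) _ => /=.
congr (_ - _ + (_ - _) * _); [exact: peval_toda_exp|exact: peval_toda_exp|exact: peval_var|exact: peval_var|exact: peval_toda_exp].
Qed.

Lemma toda_power_volterra (c : int -> A) k i l :
  (forall j, g (inl j) = c (2 * j - 1) + c (2 * j) - 4%:R) ->
  (forall j, g (inr j) = c (2 * j) * c (2 * j + 1)) ->
  toda_power k i l = volterra_square c k (2 * i) (2 * l).
Proof.
move=> gX gY; elim: k i l => [|k IHk] i l /=.
  by congr (_%:R); congr (nat_of_bool _); apply/eqP/eqP; lia.
rewrite -/(toda_power k) -/(volterra_square c k) !IHk gX gY.
by rewrite !mulrDr mulrN !mulr1.
Qed.

(** The powers of a Toeplitz matrix are Toeplitz. This is the source of the divisibility by eps^2 on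
    which [toda_der] relies. *)
Lemma toda_power_const (x y : A) k i l :
  (forall j, g (inl j) = x) -> (forall j, g (inr j) = y) ->
  toda_power k (i + 1) (l + 1) = toda_power k i l.
Proof.
move=> gX gY; elim: k i l => [|k IHk] i l /=.
  by congr (_%:R); congr (nat_of_bool _); apply/eqP/eqP; lia.
rewrite -/(toda_power k) !gX !gY.
have -> : i + 1 - 1 = i - 1 + 1 by lia.
by rewrite !IHk.
Qed.

End TodaEval.

Section EqualBelow.
Variable A : comNzRingType.
Implicit Types F G H : epseries A.

Definition eqlt (n : nat) F G : Prop := forall k, (k < n)%N -> F k = G k.

Lemma eqlt_refl n F : eqlt n F F. Proof. by []. Qed.

Lemma eqltD n F F' G G' : eqlt n F F' -> eqlt n G G' -> eqlt n (F + G) (F' + G').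
Proof. by move=> h h' k kn; congr (_ + _); [apply: h|apply: h']. Qed.

Lemma eqltN n F F' : eqlt n F F' -> eqlt n (- F) (- F').
Proof. by move=> h k kn; congr (- _); apply: h. Qed.

Lemma eqltM n F F' G G' : eqlt n F F' -> eqlt n G G' -> eqlt n (F * G) (F' * G').
Proof.
move=> h h' k kn; rewrite !psMcoef; apply: eq_bigr => i _.
by rewrite h ?h' // (leq_ltn_trans _ kn) ?leq_subr // -ltnS.
Qed.

Lemma eqlt_epsX m n F F' : eqlt n F F' -> eqlt (m + n) (eps ^+ m * F) (eps ^+ m * F').
Proof.
move=> h k kn; rewrite !epsXMcoef; case: ltnP => // mk.
by apply: h; rewrite ltn_subLR.
Qed.

Lemma eqltW m n F F' : (m <= n)%N -> eqlt n F F' -> eqlt m F F'.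
Proof. by move=> mn h k km; apply: h; apply: leq_trans km mn. Qed.

Lemma eqlt_subP n F G : eqlt n F G -> exists H, F = G + eps ^+ n * H.
Proof.
move=> h; exists (epsdrop n (F - G)); rewrite -epsdropK ?subrKC // => k kn.
by apply/eqP; rewrite subr_eq0; apply/eqP/h.
Qed.

Lemma eqlt_eps n F G H : F = G + eps ^+ n * H -> eqlt n F G.
Proof.
move=> -> k kn; change (G k + (eps ^+ n * H) k = G k).
by rewrite epsXMcoef kn addr0.
Qed.

End EqualBelow.

(** * The solution of c * S c = 1 + eps^2 w and the reduction it defines *)

Section VolterraReduction.
Variables (K : numFieldType) (A : comAlgType K) (d : {linear A -> A}).
Hypothesis dM : forall a b, d (a * b) = d a * b + a * d b.
Local Notation AE := (epseries A).
Implicit Types F G : AE.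

Let half : K := 2^-1.

Lemma sh_sub_contracting c n F G : eqlt n F G ->
  eqlt n.+1 (sh d c F - F) (sh d c G - G).
Proof.
move=> /eqlt_subP[H ->]; have [sD _] := sh_epslin d c.
rewrite sD epslinX; last exact: sh_epslin.
have H0 : (sh d c H - H) 0%N = 0.
  by change (sh d c H 0%N - H 0%N = 0); rewrite sh_coef0 subrr.
apply: (eqlt_eps (H := epsdiv (sh d c H - H))).
by rewrite exprSr -mulrA epsdivK //; ring.
Qed.

(** The equation (1 + eps^2 U) (1 + eps^2 S U) = 1 + eps^2 w says that U + S U = w - eps^2 U * S U.
    Writing S U = U + (S U - U) and solving for U gives this map, a contraction because S - 1 is
    divisible by eps. *)
Definition root_step (w U : AE) : AE :=
  half *: (w - (sh d half U - U) - eps ^+ 2 * (U * sh d half U)).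

Lemma root_step_contracting w n F G : eqlt n F G ->
  eqlt n.+1 (root_step w F) (root_step w G).
Proof.
move=> FG k kn; rewrite !zscaleE; congr (_ *: _).
move: k kn; apply: eqltD; [apply: eqltD|apply: eqltN].
- exact: eqlt_refl.
- by apply: eqltN; apply: sh_sub_contracting.
apply: (@eqltW _ _ (2 + n)); first by rewrite !addSn.
apply: eqlt_epsX; apply: eqltM => //.
by apply: epslin_cont => //; apply: sh_epslin.
Qed.

Lemma root_exists w : exists U, root_step w U = U.
Proof.
have [//|//|u v n _ _ h _ k kn|//|u [_ uE]] := @epseries_fixpoint unit A
    (fun=> True) (fun u _ => root_step w (u tt)).
  by apply: (@root_step_contracting w n) => // j; apply: h.
by exists (u tt); apply: uE.
Qed.

Lemma root_unique w U V : root_step w U = U -> root_step w V = V -> U = V.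
Proof.
move=> hU hV; apply: epseriesP => k.
suff : eqlt k.+1 U V by apply.
elim: k.+1 => // n IHn; rewrite -hU -hV; exact: root_step_contracting.
Qed.

Variables (w U : AE).
Hypothesis rootU : root_step w U = U.

Lemma half_half (F : AE) : half *: F + half *: F = F.
Proof.
rewrite -scalerDl -[X in X *: _](_ : 1 = _) ?scale1r //.
by rewrite /half; field.
Qed.

Lemma rootE : U + sh d half U = w - eps ^+ 2 * (U * sh d half U).
Proof.
have := congr1 (fun F => F + F) rootU; rewrite /root_step half_half.
move: (sh d half U) => S; move: (eps ^+ 2 * (U * S)) => P h.
have -> : U + S = (U + U) + (S - U) by ring.
by rewrite -h; ring.
Qed.

Definition vfield (j : int) : AE := sh d (j%:~R * half) (1 + eps ^+ 2 * U).

Lemma sh_half_vfield j : sh d half (vfield j) = vfield (j + 1).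
Proof. by rewrite /vfield sh_comp intrD mulrDl mul1r addrC. Qed.

Lemma sh_nat e (n : nat) : sh d e n%:R = n%:R.
Proof.
have [sD _] := sh_epslin d e.
elim: n => [|n IHn]; first by rewrite (epslin0 (sh_epslin d e)).
by rewrite -natr1 sD sh1 // IHn.
Qed.

Lemma vfieldE j : vfield j = 1 + eps ^+ 2 * sh d (j%:~R * half) U.
Proof.
rewrite /vfield; have [sD _] := sh_epslin d (j%:~R * half).
by rewrite sD sh1 // epslinX //; apply: sh_epslin.
Qed.

Lemma vfield0 j : (vfield j) 0%N = 1.
Proof.
rewrite vfieldE; change (1 + (eps ^+ 2 * sh d (j%:~R * half) U) 0%N = 1).
by rewrite epsXMcoef addr0.
Qed.

Lemma vfield_prod : vfield 0 * vfield 1 = 1 + eps ^+ 2 * w.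
Proof.
rewrite !vfieldE mul0r sh_id mul1r.
have -> : w = U + sh d half U + eps ^+ 2 * (U * sh d half U) by rewrite rootE; ring.
by ring.
Qed.

Lemma sh_vfield j i : sh d (i%:~R) (vfield j) = vfield (2 * i + j).
Proof.
rewrite /vfield sh_comp; congr (sh d _ _); rewrite intrD intrM /half.
have -> : (2 : int)%:~R = 2%:R :> K by [].
by field.
Qed.

Definition reduction : AE := U + sh d (- half) U.

(** The inverse of S applied to [rootE]. As U remains only behind eps^2, the coefficients of Q up to
    order 2 require nothing beyond U = w / 2 + O(eps). *)
Lemma reductionE : reduction = sh d (- half) (w - eps ^+ 2 * (U * sh d half U)).
Proof.
rewrite -rootE; have [sD _] := sh_epslin d (- half).
by rewrite sD sh_comp addNr sh_id addrC.
Qed.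

(** Expansion of exp(- eps d / 2) (w - eps^2 w^2 / 4) up to eps^2. The Poisson computations use no
    further coefficient of Q. *)
Lemma reduction_coefs (x : A) : w = psC x ->
  [/\ reduction 0%N = x, reduction 1%N = - half *: d x &
      reduction 2%N = (half ^+ 2 / 2) *: d (d x) - half ^+ 2 *: (x * x)].
Proof.
move=> wx; set P := U * sh d half U.
have c0 : (w - eps ^+ 2 * P) 0%N = x.
  by change (w 0%N - (eps ^+ 2 * P) 0%N = x); rewrite epsXMcoef wx subr0.
have c1 : (w - eps ^+ 2 * P) 1%N = 0.
  by change (w 1%N - (eps ^+ 2 * P) 1%N = 0); rewrite epsXMcoef wx subr0.
have U0 : U 0%N = half *: x.
  rewrite -rootU zscaleE; congr (_ *: _).
  change (w 0%N - (sh d half U 0%N - U 0%N) - (eps ^+ 2 * P) 0%N = x).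
  by rewrite epsXMcoef sh_coef0 subrr wx !subr0.
have c2 : (w - eps ^+ 2 * P) 2%N = - (half ^+ 2 *: (x * x)).
  change (w 2%N - (eps ^+ 2 * P) 2%N = - (half ^+ 2 *: (x * x))).
  rewrite epsXMcoef wx /P psMcoef0 sh_coef0 U0 -scalerAl -scalerAr scalerA.
  by rewrite [psC x 2%N]mulr0n sub0r.
rewrite reductionE; split; first by rewrite sh_coef0.
  by rewrite sh_coef1 c0 c1 add0r.
by rewrite sh_coef2 c0 c1 c2 linear0 scaler0 addr0 sqrrN addrC.
Qed.

Lemma vfield_reduction : vfield (-1) + vfield 0 - 4%:R = - 2%:R + eps ^+ 2 * reduction.
Proof. by rewrite !vfieldE mul0r sh_id mulN1r /reduction; ring. Qed.

Lemma sh_reduction_lattice j : sh d j%:~R (- 2%:R + eps ^+ 2 * reduction) =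
  vfield (2 * j - 1) + vfield (2 * j) - 4%:R.
Proof.
have sl := sh_epslin d j%:~R; have [sD _] := sl.
rewrite -vfield_reduction (epslinB _ _ sl) sD !sh_vfield addr0.
by rewrite sh_nat.
Qed.

Lemma sh_product_lattice j : sh d j%:~R (1 + eps ^+ 2 * w) =
  vfield (2 * j) * vfield (2 * j + 1).
Proof. by rewrite -vfield_prod shM // !sh_vfield addr0. Qed.

Lemma sh_volterra_square k j l : sh d half (volterra_square vfield k j l) =
  volterra_square vfield k (j + 1) (l + 1).
Proof.
have sl := sh_epslin d half; have [sD _] := sl.
elim: k j l => [|k IHk] j l /=.
  by rewrite sh_nat; congr (_%:R); congr (nat_of_bool _); apply/eqP/eqP; lia.
rewrite -/(volterra_square vfield k) !sD (shM dM) (shM dM) (shM dM) !sh_half_vfield.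
rewrite epslinB // sD !sh_half_vfield sh_nat !IHk.
have -> : j - 2 + 1 = j + 1 - 2 by lia.
have -> : j - 1 + 1 = j + 1 - 1 by lia.
by have -> : j + 2 + 1 = j + 1 + 2 by lia.
Qed.

Lemma sh_volterra_flow k j :
  sh d half (volterra_flow vfield k j) = volterra_flow vfield k (j + 1).
Proof.
rewrite /volterra_flow epslinB; last exact: sh_epslin.
rewrite !sh_volterra_square.
have -> : j - 1 + 1 = j + 1 - 1 by lia.
by have -> : j + 2 + 1 = j + 1 + 2 by lia.
Qed.

Variables (rho T : AE -> AE) (v : AE) (k : nat).
Hypotheses (Tlin : epslin T) (TZ : forall (e : K) F, T (e *: F) = e *: T F).
Hypothesis Td : forall F, T (dser d F) = dser d (T F).
Hypothesis TM : forall F G, T (F * G) = T F * rho G + rho F * T G.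
Hypothesis rho_vfield : forall j, rho (vfield j) = vfield j.
Hypothesis rho1 : rho 1 = 1.
Let c := vfield.
Let N := volterra_square c k.
Hypothesis Tv : eps ^+ 2 * T v = N (-2) 0 - N 0 2.
Hypothesis Tw : eps ^+ 2 * T w =
  N (-2) 2 - N 0 4 + (c (-1) + c 0 - c 1 - c 2) * N 0 2.

Let Tsh e F : T (sh d e F) = sh d e (T F).
Proof. exact: sh_commute. Qed.

Lemma flow_derivation1 : T 1 = 0.
Proof. by apply: (addrI (T 1)); rewrite addr0 -{3}[1]mulr1 TM rho1 mulr1 mul1r. Qed.

(** [T] stands for the Toda derivation followed by [rho], the substitution of Q for v. Applying it
    to c_0 c_1 = 1 + eps^2 w and comparing with [volterra_flow_toda] shows that T (c 0) and the
    Volterra flow solve the same linear equation. *)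
Lemma flow_derivation_vfield : T (c 0) = volterra_flow c k 0.
Proof.
have [TD _] := Tlin.
have h : T (c 0) * c 1 + c 0 * sh d half (T (c 0)) =
    volterra_flow c k 0 * c 1 + c 0 * sh d half (volterra_flow c k 0).
  rewrite sh_volterra_flow add0r -volterra_flow_toda -/N -Tw.
  rewrite -[in LHS]Tsh sh_half_vfield add0r.
  have := TM (c 0) (c 1); rewrite !rho_vfield => <-.
  by rewrite vfield_prod TD flow_derivation1 add0r epslinX.
apply/eqP; rewrite -subr_eq0; apply/eqP; apply: epseriesP => n.
set e := T (c 0) - volterra_flow c k 0.
have {h} eE : e * c 1 + c 0 * sh d half e = 0.
  rewrite /e (epslinB _ _ (sh_epslin d half)).
  rewrite -[RHS](subrr (T (c 0) * c 1 + c 0 * sh d half (T (c 0)))).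
  by rewrite [X in _ = _ - X]h; ring.
suff: eqlt n.+1 e 0 by move=> /(_ n); apply.
(* If e = eps^n H, the constant term of the equation for H reads 2 H_0 = 0, since every c_j has
   constant term 1 and S is the identity modulo eps. *)
elim: n.+1 => // {}n IHn.
have [H eH] := eqlt_subP IHn; rewrite add0r in eH.
suff H0 : H 0%N = 0.
  by rewrite eH -(epsdivK H0) mulrA -exprSr -[X in eqlt _ X]add0r; apply: eqlt_eps.
have : eps ^+ n * (H * c 1 + c 0 * sh d half H) = eps ^+ n * 0.
  by rewrite mulr0 -eE eH epslinX; [ring|apply: sh_epslin].
move=> /epsX_inj /(congr1 (fun F : AE => F 0%N)).
change ((H * c 1) 0%N + (c 0 * sh d half H) 0%N = 0 -> H 0%N = 0).
rewrite !psMcoef0 !vfield0 mulr1 mul1r sh_coef0 => h2.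
have : (2%:R : K) *: H 0%N = 0 by rewrite scaler_nat mulr2n.
by move=> /(canRL (scalerK _)) ->; rewrite ?scaler0 // pnatr_eq0.
Qed.

(** Since eps^2 Q = c_(-1) + c_0 - 2, its image is the sum of the Volterra flows of c_(-1) and c_0,
    which telescopes to N(-2,0) - N(0,2), the value of eps^2 T v. *)
Lemma flow_derivation_reduction : T (v - reduction) = 0.
Proof.
apply: (@epsX_inj _ 2); rewrite mulr0 epslinB // mulrBr Tv -epslinX //.
have -> : eps ^+ 2 * reduction = c 0 + sh d (- half) (c 0) - 2%:R * 1.
  rewrite {2}/c /vfield mul0r sh_id.
  have [sD _] := sh_epslin d (- half).
  rewrite sD sh1 // (epslinX _ _ (sh_epslin d (- half))) /reduction.
  by rewrite /c vfieldE mul0r sh_id; ring.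
have [TD _] := Tlin; rewrite epslinB // TD Tsh flow_derivation_vfield.
have -> : T (2%:R * 1) = 0.
  by rewrite -[2%:R * 1]/((1 + 1) * 1) mulr1 TD flow_derivation1 addr0.
have -> : sh d (- half) (volterra_flow c k 0) = volterra_flow c k (-1).
  by rewrite -[0](addNr 1) -sh_volterra_flow sh_comp addNr sh_id.
rewrite /volterra_flow -/N.
change (N (-2) 0 - N 0 2 - (N (-1) 1 - N 0 2 + (N (-2) 0 - N (-1) 1) - 0) = 0).
by ring.
Qed.

End VolterraReduction.

(** * The invariant reduction of the Toda derivations *)

Lemma comp_leibniz (P A : comNzRingType) (f : {rmorphism P -> A}) (D : P -> P) :
  (forall a b, D (a * b) = D a * b + a * D b) ->
  forall a b, f (D (a * b)) = f (D a) * f b + f a * f (D b).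
Proof. by move=> DM a b; rewrite DM rmorphD !rmorphM. Qed.

Section AbstractDerivations.
Variables (K : comNzRingType) (P A : comAlgType K).

Lemma leibniz_scale (D : P -> A) (phi : {rmorphism P -> A}) :
  (forall c : K, phi c%:A = c%:A) -> (forall c : K, D c%:A = 0) ->
  (forall a b, D (a * b) = D a * phi b + phi a * D b) ->
  forall (c : K) a, D (c *: a) = c *: D a.
Proof.
move=> phiC DC DM c a; rewrite -mulr_algl DM DC mul0r add0r phiC.
by rewrite mulr_algl.
Qed.

Lemma der_commute_add (f : P -> A) (D : P -> P) (D' : A -> A) :
  (forall a b, f (a + b) = f a + f b) -> (forall a b, D (a + b) = D a + D b) ->
  (forall a b, D' (a + b) = D' a + D' b) ->
  forall a b, f (D a) = D' (f a) -> f (D b) = D' (f b) ->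
  f (D (a + b)) = D' (f (a + b)).
Proof. by move=> fD DD DD' a b ha hb; rewrite DD !fD DD' ha hb. Qed.

Lemma morphism_der_mul (f : {rmorphism P -> A}) (D : P -> P) (D' : A -> A) :
  (forall a b, D (a * b) = D a * b + a * D b) ->
  (forall a b, D' (a * b) = D' a * b + a * D' b) ->
  forall a b, f (D a) = D' (f a) -> f (D b) = D' (f b) ->
  f (D (a * b)) = D' (f (a * b)).
Proof.
by move=> DM DM' a b ha hb; rewrite DM rmorphD !rmorphM DM' ha hb.
Qed.

Lemma der_commute_mul (T : P -> A) (phi : {rmorphism P -> A}) (D : P -> P)
    (D' : A -> A) :
  (forall a b, T (a * b) = T a * phi b + phi a * T b) ->
  (forall a b, T (a + b) = T a + T b) ->
  (forall a b, D (a * b) = D a * b + a * D b) ->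
  (forall a b, D' (a * b) = D' a * b + a * D' b) ->
  (forall a b, D' (a + b) = D' a + D' b) ->
  (forall a, phi (D a) = D' (phi a)) ->
  forall a b, T (D a) = D' (T a) -> T (D b) = D' (T b) ->
  T (D (a * b)) = D' (T (a * b)).
Proof.
move=> TM TD DM DM' DD' phiD a b ha hb.
by rewrite DM TD !TM DD' !DM' !phiD ha hb; ring.
Qed.

Lemma rmorph_sub_mul (f : {rmorphism P -> A}) (g : {rmorphism P -> A}) a b :
  f (a * b) - g (a * b) = f b * (f a - g a) + g a * (f b - g b).
Proof. by rewrite !rmorphM; ring. Qed.

End AbstractDerivations.

Section Ideals.
Variable A : comNzRingType.
Variable S : set A.

Lemma ideal_gen_mem x : S x -> ideal_gen S x.
Proof.
move=> Sx; exists [:: (1, x)]; split=> [p|]; first by rewrite inE => /eqP ->.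
by rewrite big_seq1 mul1r.
Qed.

Lemma ideal_gen0 : ideal_gen S 0.
Proof. by exists [::]; split=> //; rewrite big_nil. Qed.

Lemma ideal_genD x y : ideal_gen S x -> ideal_gen S y -> ideal_gen S (x + y).
Proof.
move=> [s [hs ->]] [s' [hs' ->]]; exists (s ++ s'); split; last by rewrite big_cat.
by move=> p; rewrite mem_cat => /orP[/hs|/hs'].
Qed.

Lemma ideal_genM a x : ideal_gen S x -> ideal_gen S (a * x).
Proof.
move=> [s [hs ->]]; exists [seq (a * p.1, p.2) | p <- s]; split.
  by move=> _ /mapP[p /hs Sp ->].
by rewrite big_map mulr_sumr; apply: eq_bigr => p _; rewrite mulrA.
Qed.

Lemma ideal_gen_ind (P : A -> Prop) : P 0 -> (forall x y, P x -> P y -> P (x + y)) ->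
  (forall a x, S x -> P (a * x)) -> forall x, ideal_gen S x -> P x.
Proof.
move=> P0 PD PM x [s [hs ->]]; rewrite big_seq; apply: big_ind => // p ps.
by apply: PM; apply: hs.
Qed.

End Ideals.

(** Only finitely many coefficients matter at each precision n, so a finite combination of
    generators suffices; the closure in the definition of the ideal takes care of all n together. *)
Lemma mod_eps_sub_epslin (T : comNzRingType) (S : set (epseries T))
    (f : epseries T -> epseries T) n F :
  epslin f -> (forall s, ideal_gen S (psC s - f (psC s))) ->
  mod_eps (ideal_gen S) n (F - f F).
Proof.
move=> [fD fE] psC_in; elim: n F => [|n IHn] F.
  exists 0, (F - f F); split; first exact: ideal_gen0.
  by rewrite expr0 mul1r add0r.
have [y [z [Sy yz]]] := IHn (epsdiv F).
exists (psC (F 0%N) - f (psC (F 0%N)) + eps * y), z.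
split; first by apply: ideal_genD => //; apply: ideal_genM.
have -> : eps ^+ n.+1 * z = eps * (epsdiv F - f (epsdiv F)) - eps * y.
  by rewrite yz exprS; ring.
by rewrite {1 2}(psC_eps_decomp F) fD fE; ring.
Qed.

(** * Substitutions and evolutionary derivations *)

Section DifferentialPolynomials.
Variable R : realType.
Local Notation C := R[i].
Local Notation DR := (pol C dvar).
Local Notation DE := (epseries DR).
Implicit Types (s : DR) (F G V W : DE).

Lemma dpol_ind (P : DR -> Prop) :
  (forall c : C, P c%:A) -> (forall x, P (pvar C x)) ->
  (forall s t, P s -> P t -> P (s + t)) ->
  (forall s t, P s -> P t -> P (s * t)) -> forall s, P s.
Proof. exact: pol_ind. Qed.

Let id_rm : {rmorphism DR -> DR} := idfun.

Lemma dRD s t : dR (s + t) = dR s + dR t :> DR.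
Proof. exact: (pderivationD id_rm). Qed.

Lemma dR_scalar (c : C) : dR (c%:A : DR) = 0.
Proof. exact: (pderivation_scalar id_rm). Qed.

Lemma dRM s t : dR (s * t) = dR s * t + s * dR t.
Proof. exact: (pderivationM id_rm). Qed.

Lemma dR_var x : dR (pvar C x : DR) = pvar C (dsucc x).
Proof. exact: (pderivation_var id_rm). Qed.

Lemma iter_dR_var x j :
  iter j (@dR R) (pvar C (x : dvar)) = pvar C (iter j dsucc x).
Proof.
elim: j => [|j IHj]; first by [].
by rewrite !iterS IHj; exact: dR_var.
Qed.

Lemma iter_dsucc j : (iter j dsucc (inl 0%N) = inl j) * (iter j dsucc (inr 0%N) = inr j).
Proof. by split; elim: j => //= j ->. Qed.

Fact dR_linear : linear (@dR R).
Proof.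
move=> c s t; rewrite dRD; congr (_ + _).
exact: (leibniz_scale (phi := id_rm) (fun=> erefl) dR_scalar dRM).
Qed.
HB.instance Definition _ := GRing.isLinear.Build C DR DR _ (@dR R) dR_linear.

(* Fixing the structures keeps unification from unfolding those of [R[i]]. *)
Definition cfield : numFieldType := C.
Definition diffpol : comAlgType cfield := pol C dvar.
Definition dlin : {linear diffpol -> diffpol} := @dR R.

Lemma dlinM (a b : diffpol) : dlin (a * b) = dlin a * b + a * dlin b.
Proof. exact: dRM. Qed.

Lemma dE_psC s : dE (psC s) = psC (dR s). Proof. exact: dser_psC. Qed.

Lemma shiftE_sh j F : shiftE j F = sh dlin (j%:~R) F. Proof. by []. Qed.

Definition dvalue V W (x : dvar) : DE :=
  match x with inl k => iter k (@dE R) V | inr k => iter k (@dE R) W end.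

Definition dsubst V W : DE -> DE := psextend (peval (dvalue V W)).
HB.instance Definition _ V W := GRing.RMorphism.copy (dsubst V W)
  (psextend (peval (dvalue V W))).

Lemma dsubst_epslin V W : epslin (dsubst V W).
Proof. exact: psextend_epslin. Qed.

Lemma dsubst_psC V W s : dsubst V W (psC s) = peval (dvalue V W) s.
Proof. exact: psextend_psC. Qed.

Lemma dsubst_v0 V W : dsubst V W (v0 R) = V.
Proof. by rewrite /v0 dsubst_psC peval_var. Qed.

Lemma dsubst_w0 V W : dsubst V W (w0 R) = W.
Proof. by rewrite /w0 dsubst_psC peval_var. Qed.

Lemma peval_dR V W s : peval (dvalue V W) (dR s) = dE (peval (dvalue V W) s).
Proof.
elim/dpol_ind: s => [c|i|s t hs ht|s t hs ht].
- have -> : dR (c%:A : DR) = 0 := dR_scalar c.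
  rewrite peval_scalar rmorph0; have -> : (c%:A : DE) = psC c%:A by rewrite psCZ.
  by rewrite dE_psC dR_scalar raddf0.
- rewrite dR_var [LHS]peval_var [in RHS]peval_var; case: i => j; exact: iterS.
- apply: (der_commute_add _ dRD _ hs ht); first exact: rmorphD.
  by have [dD _] := dser_epslin dlin.
- apply: (morphism_der_mul dRM _ hs ht) => F G.
  exact: (dserM dlinM).
Qed.

Lemma dsubst_dE V W F : dsubst V W (dE F) = dE (dsubst V W F).
Proof.
have ld : epslin (@dE R) := dser_epslin dlin.
apply: (epslin_ext (epslin_comp ld (dsubst_epslin V W))
  (epslin_comp (dsubst_epslin V W) ld)) => s /=.
by rewrite dE_psC !dsubst_psC peval_dR.
Qed.

Lemma psextend_scale (phi : {additive DR -> DE}) (c : C) F :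
  (forall s, phi (c *: s) = c *: phi s) ->
  psextend phi (c *: F) = c *: psextend phi F.
Proof.
move=> h; apply: epseriesP => n; rewrite zscaleE /= scaler_sumr.
by apply: eq_bigr => k _; rewrite h.
Qed.

Lemma dsubstZ V W (c : C) F : dsubst V W (c *: F) = c *: dsubst V W F.
Proof. by apply: psextend_scale => s; apply: pevalZ. Qed.

Lemma dsubst_sh V W c F : dsubst V W (sh dlin c F) = sh dlin c (dsubst V W F).
Proof.
apply: sh_commute; first exact: dsubst_epslin; first exact: dsubstZ.
exact: dsubst_dE.
Qed.

Lemma dsubst_peval V W (I : choiceType) (g : I -> DE) (P : pol C I) :
  dsubst V W (peval g P) = peval (fun x => dsubst V W (g x)) P.
Proof.
pose f : {rmorphism pol C I -> DE} := dsubst V W \o peval g.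
apply: (@pol_rmorphism_ext _ _ _ f (peval (fun x => dsubst V W (g x)))).
  move=> c; rewrite [LHS]/= !peval_scalar dsubstZ.
  have -> : dsubst V W 1 = 1 := rmorph1 (dsubst V W).
  by rewrite [RHS]peval_scalar.
by move=> i; rewrite [LHS]/= peval_var [RHS]peval_var.
Qed.

Lemma Phi_dsubst F : Phi F =
  dsubst (- 2%:R + eps ^+ 2 * v0 R) (1 + eps ^+ 2 * w0 R) F.
Proof. by []. Qed.

Section EvolutionaryDerivation.
Variables P Q : DE.
Let h (x : dvar) : DE := dvalue P Q x.
Let psC_rm : {rmorphism DR -> DE} := @psC DR.

Definition evder : DE -> DE := psextend (pderivation (@psC DR) h).

Fact pderivation_psC_additive : additive (pderivation (@psC DR) h).
Proof.
have D := pderivationD psC_rm h.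
move=> s t; apply/eqP; rewrite eq_sym subr_eq; apply/eqP.
by rewrite -D subrK.
Qed.
HB.instance Definition _ := GRing.isAdditive.Build DR DE
  (pderivation (@psC DR) h) pderivation_psC_additive.

Lemma evder_epslin : epslin evder.
Proof. exact: psextend_epslin. Qed.

Lemma evder_psC s : evder (psC s) = pderivation (@psC DR) h s.
Proof. exact: psextend_psC. Qed.

Lemma evderM F G : evder (F * G) = evder F * G + F * evder G.
Proof.
apply: (epslin_leibniz (p := id) (q := id) evder_epslin) => // s t.
rewrite -(rmorphM (@psC DR)) !evder_psC; exact: (pderivationM psC_rm).
Qed.

Lemma evderZ (c : C) F : evder (c *: F) = c *: evder F.
Proof.
apply: psextend_scale => s.
apply: (leibniz_scale (phi := psC_rm)).
- by move=> e; rewrite /= psCZ.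
- exact: (pderivation_scalar psC_rm).
- exact: (pderivationM psC_rm).
Qed.

Lemma evder_dE F : evder (dE F) = dE (evder F).
Proof.
have ld : epslin (@dE R) := dser_epslin dlin.
apply: (epslin_ext (epslin_comp ld evder_epslin)
  (epslin_comp evder_epslin ld)) => s /=.
rewrite dE_psC !evder_psC; elim/dpol_ind: s => [c|i|s t hs ht|s t hs ht].
- rewrite dR_scalar (pderivation_scalar psC_rm) raddf0.
  by rewrite (epslin0 ld).
- rewrite dR_var [LHS](pderivation_var psC_rm) [in RHS](pderivation_var psC_rm).
  by case: i => j; exact: iterS.
- apply: (der_commute_add (pderivationD psC_rm h) dRD _ hs ht).
  by have [dD _] := ld.
- apply: (der_commute_mul (pderivationM psC_rm h) (pderivationD psC_rm h) dRM
    _ _ _ hs ht).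
  + exact: (dserM dlinM).
  + by have [dD _] := ld.
  + by move=> a; rewrite dE_psC.
Qed.

Lemma evder_v0 : evder (v0 R) = P.
Proof. by rewrite /v0 evder_psC (pderivation_var psC_rm). Qed.

Lemma evder_w0 : evder (w0 R) = Q.
Proof. by rewrite /w0 evder_psC (pderivation_var psC_rm). Qed.

End EvolutionaryDerivation.

Lemma toda_der_evder k F : toda_der k F =
  evder (epsdiv (epsdiv (Phi (toda_p R k)))) (epsdiv (epsdiv (Phi (toda_q R k)))) F.
Proof. by []. Qed.

(** Consequently an element killed by the substitution v = Q lies in the ideal, which reduces
    membership to an equation. *)
Lemma sub_dsubst_ideal Q F : diff_ideal Q (F - dsubst Q (w0 R) F).
Proof.
set S := range (fun j => iter j (@dE R) (v0 R - Q)).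
have psC_in s : ideal_gen S (psC s - dsubst Q (w0 R) (psC s)).
  elim/dpol_ind: s => [c|i|s t hs ht|s t hs ht].
  - rewrite dsubst_psC peval_scalar psCZ subrr; exact: ideal_gen0.
  - rewrite dsubst_psC peval_var.
    have dB j : iter j (@dE R) (v0 R - Q) = iter j (@dE R) (v0 R) - iter j (@dE R) Q.
      elim: j => //= j ->; exact: (epslinB _ _ (dser_epslin dlin)).
    have iter_psC j s : iter j (@dE R) (psC s) = psC (iter j (@dR R) s).
      elim: j => //= j ->; exact: dser_psC.
    case: i => j /=.
      apply: ideal_gen_mem; exists j => //.
      by rewrite dB iter_psC (iter_dR_var (inl 0%N)) iter_dsucc.
    rewrite /w0 iter_psC (iter_dR_var (inr 0%N)) iter_dsucc subrr.
    exact: ideal_gen0.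
  - have := ideal_genD hs ht; rewrite addrACA -opprD.
    have [fD _] := dsubst_epslin Q (w0 R); rewrite -fD.
    by rewrite -(raddfD (@psC DR)).
  - have := rmorph_sub_mul (idfun : {rmorphism DE -> DE}) (dsubst Q (w0 R))
      (psC s) (psC t).
    rewrite -(rmorphM (@psC DR)) /= => ->.
    exact: ideal_genD (ideal_genM _ hs) (ideal_genM _ ht).
move=> n _; exact: mod_eps_sub_epslin (dsubst_epslin _ _) psC_in.
Qed.

End DifferentialPolynomials.

Section RootStepMorphism.
Variables (K : numFieldType) (A : comAlgType K) (d : {linear A -> A}).
Variables (f : epseries A -> epseries A).
Hypotheses (fl : epslin f) (fZ : forall (e : K) F, f (e *: F) = e *: f F).
Hypothesis fd : forall F, f (dser d F) = dser d (f F).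
Hypothesis fM : forall F G, f (F * G) = f F * f G.

Lemma root_step_morph w U : f (root_step d w U) = root_step d (f w) (f U).
Proof.
have fsh c F : f (sh d c F) = sh d c (f F) by apply: sh_commute.
by rewrite /root_step fZ !(epslinB _ _ fl) fsh epslinX // fM fsh.
Qed.

(** A morphism commuting with [d] sends the root for [w] to the root for [f w], and the root is
    unique. Applied to substitutions for v and to [keep_wE], this shows that U does not involve
    v. *)
Lemma root_fixed w U : f w = w -> root_step d w U = U -> f U = U.
Proof.
by move=> fw hU; apply: (root_unique _ hU); rewrite -[in LHS]fw -root_step_morph hU.
Qed.

End RootStepMorphism.

Lemma eqlt_toda_power (R : realType) (A : comAlgType R[i])
    (g g' : zvar -> epseries A) n k i l :
  (forall x, eqlt n (g x) (g' x)) ->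
  eqlt n (toda_power g k i l) (toda_power g' k i l).
Proof.
move=> gg'; elim: k i l => [|k IHk] i l /=; first exact: eqlt_refl.
by apply: eqltD; [apply: eqltD|]; rewrite -?/(toda_power _ _); do ?apply: eqltM.
Qed.

Lemma map_epslin (S T : comNzRingType) (f : {additive S -> T}) :
  epslin (fun F : epseries S => PSeries (fun n => f (F n))).
Proof.
split=> [F G|F]; apply: epseriesP => n; first exact: (raddfD f).
change (f ((eps * F) n) = (eps * PSeries (fun n => f (F n))) n).
by case: n => [|n]; rewrite ?epsMcoef0 ?raddf0 // !epsMcoefS.
Qed.

(** * Elimination of the variables v^(k) *)

Section NoV.
Variable R : realType.
Local Notation C := R[i].
Local Notation DR := (pol C dvar).
Local Notation DE := (epseries DR).

Definition no_v (m : cmonom dvar) : bool := `[< forall k, m (inl k) = 0%N >].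

Lemma no_v1 : no_v mone.
Proof. by apply/asboolP => k; rewrite cm1. Qed.

Lemma no_vM m1 m2 : no_v (mulcm m1 m2) = no_v m1 && no_v m2.
Proof.
apply/asboolP/andP => [h|[/asboolP h1 /asboolP h2] k]; last first.
  by rewrite mulcmE h1 h2.
by split; apply/asboolP => k; move: (h k); rewrite mulcmE => /eqP;
  rewrite addn_eq0 => /andP[/eqP ? /eqP ?].
Qed.

(** The substitution v^(k) = 0, encoded as a selection of monomials, so that the support of a fixed
    point shows that it belongs to R_0. *)
Definition keep_w : DR -> DR := pkeep no_v.
HB.instance Definition _ := GRing.Linear.on keep_w.

Lemma keep_wM s t : keep_w (s * t) = keep_w s * keep_w t.
Proof. exact: (pkeepM _ _ no_v1 no_vM). Qed.

Lemma keep_w1 : keep_w 1 = 1.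
Proof.
apply/malgP => m; rewrite mcoeff_pkeep mcoeff1.
by case: eqP => [->|_]; rewrite ?no_v1 ?mul0rn.
Qed.
HB.instance Definition _ := GRing.isMultiplicative.Build DR DR keep_w
  (conj keep_wM keep_w1).

Lemma keep_w_var x : keep_w (pvar C x) = if x is inr _ then pvar C x else 0.
Proof.
apply/malgP => m; rewrite mcoeff_pkeep /pvar.
case: x => k; rewrite [in LHS]mcoeffU; last first.
  rewrite [in RHS]mcoeffU; case: eqP => [<-|_]; last by rewrite mul0rn.
  by rewrite (_ : no_v _) //; apply/asboolP => j; rewrite ucmE.
rewrite mcoeff0; case: eqP => [<-|_]; last by rewrite mul0rn.
rewrite (_ : no_v _ = false) //; apply/asboolP => /(_ k).
by rewrite ucmE eqxx.
Qed.

Lemma keep_w_dR s : keep_w (dR s) = dR (keep_w s).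
Proof.
elim/dpol_ind: s => [c|x|s t hs ht|s t hs ht].
- rewrite (dR_scalar c) linearZ /= keep_w1 (dR_scalar c); exact: raddf0.
- rewrite dR_var [LHS]keep_w_var [in RHS]keep_w_var.
  case: x => k; [by rewrite linear0|by rewrite dR_var].
- apply: (der_commute_add _ (@dRD R) (@dRD R) hs ht); exact: raddfD.
- exact: (morphism_der_mul (f := keep_w) (@dRM R) (@dRM R) hs ht).
Qed.

Definition keep_wE (F : DE) : DE := PSeries (fun n => keep_w (F n)).

Lemma keep_wE_epslin : epslin keep_wE.
Proof.
exact: (map_epslin keep_w).
Qed.

Lemma keep_wE_psC s : keep_wE (psC s) = psC (keep_w s).
Proof. by apply: epseriesP => n; exact: raddfMn. Qed.

Lemma keep_wEM F G : keep_wE (F * G) = keep_wE F * keep_wE G.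
Proof.
apply: (epslin_mul keep_wE_epslin) => s t.
rewrite -(rmorphM (@psC DR)) !keep_wE_psC keep_wM.
exact: (rmorphM (@psC DR)).
Qed.

Lemma keep_wEZ (e : C) F : keep_wE (e *: F) = e *: keep_wE F.
Proof. apply: epseriesP => n; change (keep_w (e *: F n) = e *: keep_w (F n)).
exact: linearZ. Qed.

Lemma keep_wE_dser F : keep_wE (dser (dlin R) F) = dser (dlin R) (keep_wE F).
Proof. by apply: epseriesP => n; exact: keep_w_dR. Qed.

Lemma keep_wE_sh c F : keep_wE (sh (dlin R) c F) = sh (dlin R) c (keep_wE F).
Proof. exact: (sh_commute c F keep_wE_epslin keep_wEZ keep_wE_dser). Qed.

Lemma in_R0_keep_w F : keep_wE F = F -> in_R0 F.
Proof.
move=> h n m; rewrite -h -mcoeff_neq0 mcoeff_pkeep.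
by rewrite /no_v; case: asboolP => // _; rewrite mulr0n eqxx.
Qed.

End NoV.

Lemma iter_commute (S : Type) (f D : S -> S) : (forall x, f (D x) = D (f x)) ->
  forall j x, f (iter j D x) = iter j D (f x).
Proof. by move=> fD; elim=> // j IHj x; rewrite !iterS fD IHj. Qed.

Lemma mul0_sum (S : comNzRingType) (a b u t : S) : u = 0 -> t = 0 ->
  a * u + b * t = 0.
Proof. by move=> -> ->; rewrite !mulr0 addr0. Qed.

(** * Invariance of the ideal of v - Q *)

Section TodaInvariance.
Variable R : realType.
Local Notation C := R[i].
Local Notation DR := (pol C dvar).
Local Notation DE := (epseries DR).
Local Notation d := (dlin R).

Variable U : DE.
Hypothesis rootU : root_step d (w0 R) U = U.

Let Q := reduction d U.
Let rho := dsubst Q (w0 R).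
Let c := vfield d U.

Lemma dsubst_root V : dsubst V (w0 R) U = U.
Proof.
apply: (root_fixed (dsubst_epslin V _) _ _ _ (dsubst_w0 _ _) rootU).
- exact: dsubstZ.
- exact: dsubst_dE.
- exact: (rmorphM (dsubst V (w0 R))).
Qed.

Lemma rho_vfield j : rho (c j) = c j.
Proof.
have rl := dsubst_epslin Q (w0 R); have [rD _] := rl.
rewrite /rho /c /vfield dsubst_sh rD (epslinX _ _ rl) dsubst_root.
by have -> : dsubst Q (w0 R) 1 = 1 := rmorph1 (dsubst Q (w0 R)).
Qed.

Lemma keep_w_root : keep_wE U = U.
Proof.
apply: (root_fixed (@keep_wE_epslin R) _ _ (@keep_wEM R) _ rootU).
- exact: keep_wEZ.
- exact: keep_wE_dser.
- by rewrite /w0 keep_wE_psC keep_w_var.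
Qed.

Lemma keep_w_reduction : keep_wE Q = Q.
Proof.
have kl := @keep_wE_epslin R; have [kD _] := kl.
rewrite /Q /reduction kD keep_w_root; congr (_ + _).
by rewrite keep_wE_sh keep_w_root.
Qed.

Variable k : nat.

Let g (x : zvar) : DE := Phi (toda_subst R x).

Lemma Phi_toda_p : Phi (toda_p R k) = toda_power g k (-1) 0 - toda_power g k 0 1.
Proof. by rewrite Phi_dsubst /toda_p dsubst_peval peval_toda_comm00. Qed.

Lemma Phi_toda_q : Phi (toda_q R k) = toda_power g k (-1) 1 - toda_power g k 0 2
  + (g (inl 0) - g (inl 1)) * toda_power g k 0 1.
Proof. by rewrite Phi_dsubst /toda_q dsubst_peval peval_toda_comm01. Qed.

Lemma sh_const_eps j (n : DE) F : sh d j n = n ->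
  sh d j (n + eps ^+ 2 * F) = n + eps ^+ 2 * sh d j F.
Proof.
move=> hn; have sl := sh_epslin d j; have [sD _] := sl.
by rewrite sD hn (epslinX _ _ sl).
Qed.

Lemma sh_two j : sh d j (- 2%:R) = - 2%:R.
Proof.
have sl := sh_epslin d j; have [sD _] := sl.
by rewrite (epslinN _ sl) -[2%:R]/(1 + 1) sD (sh1 (@dlinM R)).
Qed.

Lemma g_inl j : g (inl j) = - 2%:R + eps ^+ 2 * sh d j%:~R (v0 R).
Proof.
rewrite /g /toda_subst shiftE_sh Phi_dsubst dsubst_sh dsubst_v0.
by rewrite sh_const_eps // sh_two.
Qed.

Lemma g_inr j : g (inr j) = 1 + eps ^+ 2 * sh d j%:~R (w0 R).
Proof.
rewrite /g /toda_subst shiftE_sh Phi_dsubst dsubst_sh dsubst_w0.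
by rewrite sh_const_eps // (sh1 (@dlinM R)).
Qed.

Let g0 (x : zvar) : DE := if x is inl _ then - 2%:R else 1.

Lemma g_const x : eqlt 2 (g x) (g0 x).
Proof. by case: x => j; rewrite ?g_inl ?g_inr; apply: eqlt_eps. Qed.

Lemma eps2_divides (F : DE) : eqlt 2 F 0 -> eps ^+ 2 * epsdiv (epsdiv F) = F.
Proof.
move=> h; rewrite expr2 -mulrA (epsdivK (F := epsdiv F)) ?epsdivK ?h //.
exact: (h 1%N).
Qed.

Lemma toda_power_g0 i l : toda_power g0 k (i + 1) (l + 1) = toda_power g0 k i l.
Proof. exact: (toda_power_const (x := - 2%:R) (y := 1)). Qed.

(** Modulo eps^2 the Lax matrix is Toeplitz, with -2 on the diagonal and 1 above it, so the two
    subtracted entries of its power coincide. *)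
Lemma Phi_toda_p_eps2 : eqlt 2 (Phi (toda_p R k)) 0.
Proof.
rewrite Phi_toda_p -(subrr (toda_power g0 k (-1) 0)).
rewrite -[X in eqlt _ _ (_ - X)]toda_power_g0.
by apply: eqltD; [|apply: eqltN]; apply: eqlt_toda_power => x; apply: g_const.
Qed.

Lemma Phi_toda_q_eps2 : eqlt 2 (Phi (toda_q R k)) 0.
Proof.
have -> : 0 = toda_power g0 k (-1) 1 - toda_power g0 k (-1 + 1) (1 + 1)
    + (g0 (inl 0) - g0 (inl 1)) * toda_power g0 k 0 1.
  by rewrite toda_power_g0 !subrr mul0r addr0.
rewrite Phi_toda_q; apply: eqltD; last first.
  apply: eqltM; last by apply: eqlt_toda_power => x; apply: g_const.
  by apply: eqltD; [|apply: eqltN]; apply: g_const.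
by apply: eqltD; [|apply: eqltN]; apply: eqlt_toda_power => x; apply: g_const.
Qed.

Let N := volterra_square c k.

Lemma rho_g_inl j : rho (g (inl j)) = c (2 * j - 1) + c (2 * j) - 4%:R.
Proof.
have rl := dsubst_epslin Q (w0 R); have [rD _] := rl.
rewrite g_inl /rho rD (epslinX _ _ rl) (epslinN _ rl) dsubst_sh dsubst_v0.
have -> : dsubst Q (w0 R) 2%:R = 2%:R := rmorph_nat (dsubst Q (w0 R)) 2.
rewrite -(sh_const_eps _ (sh_two _)).
exact: (sh_reduction_lattice (@dlinM R)).
Qed.

Lemma rho_g_inr j : rho (g (inr j)) = c (2 * j) * c (2 * j + 1).
Proof.
have rl := dsubst_epslin Q (w0 R); have [rD _] := rl.
have r1 : dsubst Q (w0 R) 1 = 1 := rmorph1 (dsubst Q (w0 R)).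
rewrite g_inr /rho rD (epslinX _ _ rl) r1 dsubst_sh dsubst_w0.
rewrite -(sh_const_eps _ (sh1 (@dlinM R) _)).
exact: (sh_product_lattice (@dlinM R) rootU).
Qed.

Lemma rho_toda_power i l : rho (toda_power g k i l) = N (2 * i) (2 * l).
Proof.
rewrite -peval_toda_exp /rho dsubst_peval peval_toda_exp.
apply: toda_power_volterra; [exact: rho_g_inl|exact: rho_g_inr].
Qed.

Let T (F : DE) : DE := rho (toda_der k F).

Lemma toda_der_leibniz (F G : DE) : T (F * G) = T F * rho G + rho F * T G.
Proof.
pose f : {rmorphism DE -> DE} := dsubst Q (w0 R).
have EM := @evderM R (epsdiv (epsdiv (Phi (toda_p R k))))
  (epsdiv (epsdiv (Phi (toda_q R k)))).
have := comp_leibniz f EM F G.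
exact.
Qed.

Lemma toda_der_kills_reduction : T (v0 R - Q) = 0.
Proof.
have rl := dsubst_epslin Q (w0 R); have [rD _] := rl.
have rM (F G : DE) : rho (F * G) = rho F * rho G := rmorphM (dsubst Q (w0 R)) F G.
have rA (F G : DE) : rho (F + G) = rho F + rho G := rD F G.
have rB (F G : DE) : rho (F - G) = rho F - rho G := epslinB F G rl.
have Tl : epslin T by apply: (epslin_comp (evder_epslin _ _) rl).
have eps2T X : eps ^+ 2 * rho X = rho (eps ^+ 2 * X) by rewrite /rho (epslinX _ _ rl).
apply: (@flow_derivation_reduction _ _ d (@dlinM R) (w0 R) U rootU rho T (v0 R) k).
- exact: Tl.
- by move=> e F; rewrite /T toda_der_evder evderZ /rho dsubstZ.
- by move=> F; rewrite /T toda_der_evder evder_dE /rho dsubst_dE.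
- exact: toda_der_leibniz.
- exact: rho_vfield.
- exact: (rmorph1 (dsubst Q (w0 R))).
- rewrite /T toda_der_evder evder_v0 eps2T eps2_divides; last exact: Phi_toda_p_eps2.
  by rewrite Phi_toda_p rB !rho_toda_power.
- rewrite /T toda_der_evder evder_w0 eps2T eps2_divides; last exact: Phi_toda_q_eps2.
  have rE (a b x y z : DE) : rho (a - b + (x - y) * z) =
      rho a - rho b + (rho x - rho y) * rho z by rewrite rA rB rM rB.
  rewrite Phi_toda_q; apply: etrans (rE _ _ _ _ _) _.
  have key (a b x y z n1 n2 n3 a1 a2 a3 a4 : DE) : a = n1 -> b = n2 -> z = n3 ->
      x = a1 + a2 - 4%:R -> y = a3 + a4 - 4%:R ->
      a - b + (x - y) * z = n1 - n2 + (a1 + a2 - a3 - a4) * n3.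
    by move=> -> -> -> -> ->; ring.
  exact: key (rho_toda_power _ _) (rho_toda_power _ _) (rho_toda_power _ _)
    (rho_g_inl 0) (rho_g_inl 1).
Qed.

Lemma rho_reduction : rho Q = Q.
Proof.
have [rD _] := dsubst_epslin Q (w0 R).
by rewrite {2}/Q /reduction /rho rD dsubst_sh dsubst_root.
Qed.

(** Both [rho] and [T] vanish on the generators; by the Leibniz rule along [rho], [T] vanishes on
    the ideal. So [rho] kills the Toda derivative of F, and [sub_dsubst_ideal] concludes. *)
Lemma toda_der_diff_ideal F : diff_ideal Q F -> diff_ideal Q (toda_der k F).
Proof.
have rl := dsubst_epslin Q (w0 R); have [rD _] := rl.
have Tl : epslin T by apply: (epslin_comp (evder_epslin _ _) rl).
have [TD _] := Tl.
have dE0 : dE (0 : DE) = 0 := epslin0 (dser_epslin d).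
have iter0 j : iter j (@dE R) 0 = 0 by elim: j => [|j IHj]; [|rewrite iterS IHj; exact: dE0].
have ry j : rho (iter j (@dE R) (v0 R - Q)) = 0.
  have -> : rho (iter j (@dE R) (v0 R - Q)) = iter j (@dE R) (rho (v0 R - Q)).
    exact: iter_commute (dsubst_dE _ _) _ _.
  have -> : rho (v0 R - Q) = 0; last exact: iter0.
  rewrite /rho (epslinB _ _ rl) dsubst_v0 -[dsubst _ _ Q]/(rho Q) rho_reduction.
  exact: subrr.
have Ty j : T (iter j (@dE R) (v0 R - Q)) = 0.
  have -> : T (iter j (@dE R) (v0 R - Q)) = iter j (@dE R) (T (v0 R - Q)).
    apply: iter_commute => G; rewrite /T !toda_der_evder evder_dE; exact: dsubst_dE.
  rewrite toda_der_kills_reduction; exact: iter0.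
move=> dF; suff TF : T F = 0.
  have := sub_dsubst_ideal Q (toda_der k F).
  by rewrite -[dsubst _ _ _]/(T F) TF subr0.
(* Membership modulo eps^(n+1) controls the coefficient of eps^n. *)
apply: epseriesP => n; have [y [z [Sy ->]]] := dF n.+1 Logic.I.
have -> : T y = 0 -> T (y + eps ^+ n.+1 * z) = eps ^+ n.+1 * T z.
  by rewrite TD (epslinX _ _ Tl) => ->; rewrite add0r.
  by rewrite epsXMcoef ltnSn.
apply: (@ideal_gen_ind _ _ (fun F => T F = 0) _ _ _ y Sy) => [|a b Ta Tb|a _ [j _ <-]].
- exact: epslin0.
- by rewrite TD Ta Tb addr0.
- rewrite toda_der_leibniz; apply: mul0_sum (ry j) (Ty j).
Qed.

End TodaInvariance.

(** * Summable families in F[[epsilon]] *)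

Section FiniteSums.
Variable V : zmodType.

Definition fsumto (T : choiceType) (u : T -> V) (h : V) : Prop :=
  exists A : {fset T}, (forall x, x \notin A -> u x = 0) /\ \sum_(x <- A) u x = h.

Lemma sum_fset_sub (T : choiceType) (u : T -> V) (A B : {fset T}) :
  (A `<=` B)%fset -> (forall x, x \notin A -> u x = 0) ->
  \sum_(x <- B) u x = \sum_(x <- A) u x.
Proof. by move=> AB u0; rewrite (big_fset_incl _ AB) // => x _ /u0. Qed.

Lemma fsumto_sup (T : choiceType) (u : T -> V) h : fsumto u h ->
  exists A : {fset T}, forall B, (A `<=` B)%fset ->
    (forall x, x \notin B -> u x = 0) /\ \sum_(x <- B) u x = h.
Proof.
move=> [A [u0 <-]]; exists A => B AB; split; last exact: sum_fset_sub.
by move=> x xB; apply: u0; apply: contra xB; apply/fsubsetP.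
Qed.

Lemma fsumto_uniq (T : choiceType) (u : T -> V) h h' :
  fsumto u h -> fsumto u h' -> h = h'.
Proof.
move=> /fsumto_sup[A hA] /fsumto_sup[A' hA'].
have [_ <-] := hA _ (fsubsetUl A A').
by have [_ <-] := hA' _ (fsubsetUr A A').
Qed.

Lemma fsumto_ext (T : choiceType) (u v : T -> V) h : u =1 v -> fsumto u h -> fsumto v h.
Proof. by move=> /funext <-. Qed.

Lemma fsumto_lin (T : choiceType) (u v : T -> V) h h' :
  fsumto u h -> fsumto v h' -> fsumto (fun x => u x - v x) (h - h').
Proof.
move=> /fsumto_sup[A hA] /fsumto_sup[A' hA']; exists (A `|` A')%fset.
have [u0 us] := hA _ (fsubsetUl A A'); have [v0 vs] := hA' _ (fsubsetUr A A').
split=> [x xA|]; first by rewrite u0 // v0 // subrr.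
by rewrite sumrB us vs.
Qed.

Lemma fsumto0 (T : choiceType) : fsumto (fun _ : T => 0) 0.
Proof. by exists fset0; split=> //; rewrite big1. Qed.

Lemma fsumto_sum (T : choiceType) (n : nat) (u : 'I_n -> T -> V) (h : 'I_n -> V) :
  (forall i, fsumto (u i) (h i)) ->
  fsumto (fun x => \sum_(i < n) u i x) (\sum_(i < n) h i).
Proof.
elim: n u h => [|n IHn] u h uh.
  rewrite big_ord0; apply: fsumto_ext (fsumto0 T) => x; by rewrite big_ord0.
rewrite big_ord_recl.
have := fsumto_lin (fsumto0 T) (IHn _ _ (fun i => uh (lift ord0 i))).
move=> /(fsumto_lin (uh ord0)); rewrite sub0r opprK; apply: fsumto_ext => x.
by rewrite big_ord_recl sub0r opprK.
Qed.

Lemma fsumto_single (T : choiceType) (u : T -> V) x0 :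
  (forall x, x != x0 -> u x = 0) -> fsumto u (u x0).
Proof.
move=> u0; exists [fset x0]%fset; rewrite big_seq_fset1; split=> // x.
by rewrite in_fset1 => /u0.
Qed.

Lemma fsumto_reindex (T T' : choiceType) (g : T' -> T) (g' : T -> T') u h :
  cancel g g' -> cancel g' g -> fsumto u h -> fsumto (u \o g) h.
Proof.
move=> gK g'K [A [u0 <-]]; exists [fset g' x | x in A]%fset; split=> [y yA|].
  apply: u0; apply: contra yA => gyA; apply/imfsetP; exists (g y).
    exact: gyA.
  by rewrite gK.
rewrite big_imfset /=; first by apply: eq_bigr => x _; rewrite /= g'K.
by move=> x y _ _ /(can_inj g'K).
Qed.

Lemma fsumto_fubini (T T' : choiceType) (u : T * T' -> V) (v : T -> V) h :
  fsumto u h -> (forall x, fsumto (fun y => u (x, y)) (v x)) -> fsumto v h.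
Proof.
move=> [A [u0 uh]] uv.
pose A1 := [fset p.1 | p in A]%fset; pose A2 := [fset p.2 | p in A]%fset.
have u02 x y : (x \notin A1) || (y \notin A2) -> u (x, y) = 0.
  move=> h2; apply: u0; apply: contraL h2 => xyA; rewrite negb_or !negbK.
  by apply/andP; split; apply/imfsetP; exists (x, y).
have vE x : v x = \sum_(y <- A2) u (x, y).
  apply: (fsumto_uniq (uv x)); exists A2; split=> // y yA2.
  by apply: u02; rewrite yA2 orbT.
exists A1; split=> [x xA1|].
  by rewrite vE big1 // => y _; apply: u02; rewrite xA1.
rewrite -uh (eq_bigr _ (fun x _ => vE x)).
pose r := [seq (x, y) | x <- A1, y <- A2].
have -> : \sum_(x <- A1) \sum_(y <- A2) u (x, y) = \sum_(p <- r) u p.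
  by rewrite big_allpairs.
have rE : perm_eq r [fset p in r]%fset.
  apply: uniq_perm; last by move=> p; rewrite !inE.
    by apply: allpairs_uniq; rewrite ?fset_uniq // => -[x y] [x' y'] _ _ [-> ->].
  exact: fset_uniq.
rewrite (perm_big _ rE) /=; apply: sum_fset_sub => //.
apply/fsubsetP => -[x y] xyA; rewrite !inE /=; apply/allpairsP; exists (x, y).
by split=> //; apply/imfsetP; exists (x, y).
Qed.

End FiniteSums.

(** * Truncation levels and convergence *)

Section Levels.
Variable K : comNzRingType.
Local Notation FR := (fourier_ring K).
Local Notation FE := (epseries FR).
Implicit Types F G H : FE.

(** The coefficient of eps^k modulo M_N, an honest polynomial. These values determine a series and
    describe the topology. *)
Definition ev (N k : nat) F : pol K zvar := fseq (F k) N.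

Fact ev_additive N k : additive (ev N k). Proof. by []. Qed.
HB.instance Definition _ N k := GRing.isAdditive.Build FE (pol K zvar) (ev N k)
  (@ev_additive N k).

Lemma fseq_sum N (J : Type) (r : seq J) (F : J -> FR) :
  fseq (\sum_(j <- r) F j) N = \sum_(j <- r) fseq (F j) N.
Proof. exact: (big_morph (fun x : FR => fseq x N) (fun _ _ => erefl) erefl). Qed.

Lemma evM N k F G : ev N k (F * G) = \sum_(i < k.+1) ev N i F * ev N (k - i) G.
Proof. exact: fseq_sum. Qed.

Lemma ev_ext F G : (forall N k, ev N k F = ev N k G) -> F = G.
Proof. by move=> h; apply: epseriesP => k; apply: fseq_inj => N; exact: h. Qed.

Lemma ev_epsX N k n F : ev N k (eps ^+ n * F) = if (k < n)%N then 0 else ev N (k - n) F.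
Proof. by rewrite /ev epsXMcoef; case: ifP. Qed.

Lemma ev_trunc N M k F : (N <= M)%N -> ftrunc N (ev M k F) = ev N k F.
Proof. by have /fourier_seqP[h _] := fseqP (F k); exact: h. Qed.

(** Unconditional summation: at every level (N, k) the sum is finite. As no ordering is involved,
    reindexing and exchange of summations become statements about finite sums. *)
Definition hassum (T : choiceType) (u : T -> FE) H : Prop :=
  forall N k, fsumto (fun x => ev N k (u x)) (ev N k H).

Definition null (T : choiceType) (u : T -> FE) : Prop :=
  forall N k, exists A : {fset T}, forall x, x \notin A -> ev N k (u x) = 0.

Lemma hassum_uniq (T : choiceType) (u : T -> FE) H H' :
  hassum u H -> hassum u H' -> H = H'.
Proof. by move=> h h'; apply: ev_ext => N k; apply: fsumto_uniq (h N k) (h' N k). Qed.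

Lemma hassum_ext (T : choiceType) (u v : T -> FE) H :
  u =1 v -> hassum u H -> hassum v H.
Proof. by move=> /funext <-. Qed.

Lemma hassumB (T : choiceType) (u v : T -> FE) H H' :
  hassum u H -> hassum v H' -> hassum (fun x => u x - v x) (H - H').
Proof. by move=> h h' N k; apply: fsumto_lin (h N k) (h' N k). Qed.

Lemma hassum0 (T : choiceType) : hassum (fun _ : T => 0) 0.
Proof. by move=> N k; apply: fsumto0. Qed.

Lemma hassumN (T : choiceType) (u : T -> FE) H :
  hassum u H -> hassum (fun x => - u x) (- H).
Proof.
move=> h; rewrite -(sub0r H); apply: hassum_ext (hassumB (hassum0 T) h) => x.
by rewrite sub0r.
Qed.

Lemma hassumD (T : choiceType) (u v : T -> FE) H H' :
  hassum u H -> hassum v H' -> hassum (fun x => u x + v x) (H + H').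
Proof.
move=> h h'; rewrite -(opprK H'); apply: hassum_ext (hassumB h (hassumN h')) => x.
by rewrite opprK.
Qed.

Lemma hassumM (T : choiceType) (u : T -> FE) G H :
  hassum u H -> hassum (fun x => G * u x) (G * H).
Proof.
move=> h N k; rewrite evM; apply: fsumto_ext (fun x => esym (evM N k G (u x))) _.
apply: fsumto_sum => i; have [A [u0 <-]] := h N (k - i)%N; exists A; split.
  by move=> x /u0 ->; rewrite mulr0.
by rewrite mulr_sumr.
Qed.

Lemma hassum_single (T : choiceType) (u : T -> FE) x0 :
  (forall x, x != x0 -> u x = 0) -> hassum u (u x0).
Proof.
move=> u0 N k; apply: (fsumto_single (u := fun x => ev N k (u x))) => x /u0 ->.
exact: raddf0.
Qed.

Lemma hassum_fubini (T T' : choiceType) (u : T * T' -> FE) (v : T -> FE) H :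
  hassum u H -> (forall x, hassum (fun y => u (x, y)) (v x)) -> hassum v H.
Proof. by move=> h h' N k; apply: fsumto_fubini (h N k) _ => x; exact: h'. Qed.

Lemma hassum_reindex (T T' : choiceType) (g : T' -> T) (g' : T -> T') u H :
  cancel g g' -> cancel g' g -> hassum u H -> hassum (u \o g) H.
Proof.
by move=> gK g'K h N k; apply: (fsumto_reindex (u := fun x => ev N k (u x)) gK g'K).
Qed.

Lemma hassum_coef_single (T : choiceType) (u : T -> FE) H k x0 :
  hassum u H -> (forall x, x != x0 -> u x k = 0) -> H k = u x0 k.
Proof.
move=> h u0; apply: fseq_inj => N; apply: (fsumto_uniq (h N k)).
apply: (fsumto_single (u := fun x => ev N k (u x))) => x /u0.
by rewrite /ev => ->.
Qed.

Lemma hassum_coef0 (T : choiceType) (u : T -> FE) H k :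
  hassum u H -> (forall x, u x k = 0) -> H k = 0.
Proof.
move=> h u0; apply: fseq_inj => N; apply: (fsumto_uniq (h N k)).
by apply: fsumto_ext (fsumto0 _ T) => x; rewrite /ev u0.
Qed.

Lemma hassum_epsX (T : choiceType) (u : T -> FE) n H :
  hassum (fun x => eps ^+ n * u x) H -> exists2 H', H = eps ^+ n * H' & hassum u H'.
Proof.
move=> h; exists (epsdrop n H).
  apply: epsdropK => k kn; apply: (hassum_coef0 h) => x.
  by rewrite epsXMcoef kn.
move=> N k; have := h N (n + k)%N; apply: fsumto_ext => x.
by rewrite ev_epsX ltnNge leq_addr addKn.
Qed.

(** M_N + (eps^n) is an ideal, so one factor tending to 0 is enough. *)
Lemma nullM (T : choiceType) (u v : T -> FE) : null u -> null (fun x => u x * v x).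
Proof.
move=> u0 N k.
have [A hA] : exists A : {fset T}, forall x, x \notin A ->
    forall i, (i <= k)%N -> ev N i (u x) = 0.
  elim: k => [|k [A hA]].
    by have [A hA] := u0 N 0%N; exists A => x xA i; rewrite leqn0 => /eqP ->; apply: hA.
  have [B hB] := u0 N k.+1; exists (A `|` B)%fset => x.
  rewrite in_fsetU negb_or => /andP[xA xB] i; rewrite leq_eqVlt.
  by case/orP => [/eqP ->|]; [apply: hB|apply: hA].
exists A => x xA; rewrite evM big1 // => i _.
by rewrite hA ?mul0r // -ltnS.
Qed.

Definition within (P : nat -> cmonom zvar -> Prop) F : Prop :=
  forall N k m, m \in msupp (ev N k F) -> P k m.

Lemma withinW (P Q : nat -> cmonom zvar -> Prop) F :
  within P F -> (forall k m, P k m -> Q k m) -> within Q F.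
Proof. by move=> h PQ N k m /h /PQ. Qed.

Lemma mem_msuppD (s t : pol K zvar) m :
  m \in msupp (s + t) -> m \in msupp s \/ m \in msupp t.
Proof.
by move=> /(fsubsetP (msuppD_le _ _)); rewrite in_fsetU => /orP.
Qed.

Lemma mem_msupp_sum (J : Type) (r : seq J) (F : J -> pol K zvar) m :
  m \in msupp (\sum_(j <- r) F j) -> exists j, m \in msupp (F j).
Proof.
elim: r => [|j r IHr]; first by rewrite big_nil msupp0.
by rewrite big_cons => /mem_msuppD[?|/IHr]; [exists j|].
Qed.

Lemma withinD P F G : within P F -> within P G -> within P (F + G).
Proof. by move=> hF hG N k m /mem_msuppD[/hF|/hG]. Qed.

Lemma withinN P F : within P F -> within P (- F).
Proof. by move=> hF N k m; rewrite [ev _ _ _]raddfN msuppN => /hF. Qed.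

Lemma withinZ P (c : K) F : within P F -> within P (c *: F).
Proof. by move=> hF N k m /(fsubsetP (msuppZ_le _ _)) => /hF. Qed.

Lemma within0 P : within P 0.
Proof. by move=> N k m; rewrite msupp0. Qed.

Lemma withinM P Q S F G : within P F -> within Q G ->
  (forall i j m1 m2, P i m1 -> Q j m2 -> S (i + j)%N (mulcm m1 m2)) ->
  within S (F * G).
Proof.
move=> hF hG PQS N k m; rewrite evM => /mem_msupp_sum[i /msuppM_le[m1 [m2 [h1 h2 ->]]]].
by rewrite -(@subnKC i k) -1?ltnS //; apply: PQS; [apply: hF h1|apply: hG h2].
Qed.

Lemma within_epsX P Q n F : within P F -> (forall k m, P k m -> Q (n + k)%N m) ->
  within Q (eps ^+ n * F).
Proof.
move=> hF PQ N k m; rewrite ev_epsX; case: ltnP => [|nk]; first by rewrite msupp0.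
by move=> /hF /PQ; rewrite subnKC.
Qed.

Lemma within_epsdrop P Q n F : within P F -> (forall k m, P (n + k)%N m -> Q k m) ->
  within Q (epsdrop n F).
Proof. by move=> hF PQ N k m mF; apply: PQ; apply: hF mF. Qed.

Lemma within_hassum P (T : choiceType) (u : T -> FE) H :
  hassum u H -> (forall x, within P (u x)) -> within P H.
Proof.
by move=> uH uP N k m; have [A [_ <-]] := uH N k; move=> /mem_msupp_sum[x /uP].
Qed.

(** Convergence at every level is not sufficient: a coefficient in the Fourier ring has only
    finitely many weights. Hence the bound [B k], uniform in the family and in the level. *)
Lemma hassum_exists (T : choiceType) (u : T -> FE) (B : nat -> nat) :
  null u -> (forall x, within (fun k m => `|weight m| <= B k)%N (u x)) ->
  exists H, hassum u H.
Proof.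
move=> u0 uB.
have [A hA] := choice (fun p : nat * nat => u0 p.1 p.2).
pose h k N := \sum_(x <- A (N, k)) ev N k (u x).
have hE k N (B' : {fset T}) : (A (N, k) `<=` B')%fset -> h k N = \sum_(x <- B') ev N k (u x).
  by move=> AB; rewrite /h -(sum_fset_sub AB) // => x xA; apply: (hA (N, k)).
have hp k : h k \in @fourier_seq K.
  apply/fourier_seqP; split=> [N M NM|].
    rewrite (hE k N _ (fsubsetUl _ (A (M, k)))) (hE k M _ (fsubsetUr (A (N, k)) _)).
    by rewrite raddf_sum; apply: eq_bigr => x _ /=; apply: ev_trunc.
  by exists (B k) => N m /mem_msupp_sum[x /uB].
exists (PSeries (fun k => FourierRing (hp k))) => N k.
by exists (A (N, k)); split=> // x xA; apply: (hA (N, k)).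
Qed.

End Levels.

Fact rmorph_leibniz (P A : comNzRingType) (f : {rmorphism P -> A}) a b c d :
  f (a * b + c * d) = f a * f b + f c * f d.
Proof. by rewrite rmorphD !rmorphM. Qed.

Lemma seq_bounded (T : eqType) (r : seq T) (f : T -> nat) :
  exists M, forall x, x \in r -> (f x <= M)%N.
Proof.
elim: r => [|y r [M hM]]; first by exists 0%N.
exists (maxn (f y) M) => x; rewrite inE => /orP[/eqP ->|/hM fM].
  exact: leq_maxl.
by rewrite (leq_trans fM) ?leq_maxr.
Qed.

(** * Homogeneous series, partial derivatives and limits *)

Section HomogeneousSeries.
Variable K : comNzRingType.
Local Notation FR := (fourier_ring K).
Local Notation FE := (epseries FR).
Implicit Types F G H : FE.

Let inl_inj : injective (@inl int int). Proof. by move=> i j []. Qed.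
Let inr_inj : injective (@inr int int). Proof. by move=> i j []. Qed.

Lemma mem_vrange N x : (x \in vrange N) = (`|idx x| < N)%N.
Proof.
rewrite /vrange mem_cat; case: x => j /=.
  rewrite (mem_map inl_inj) mem_zrange.
  suff -> : (inl j \in [seq inr i | i <- zrange N]) = false by rewrite orbF.
  by apply/mapP => -[].
rewrite (mem_map inr_inj) mem_zrange.
suff -> : (inr j \in [seq inl i | i <- zrange N]) = false by [].
by apply/mapP => -[].
Qed.

Lemma uniq_vrange N : uniq (vrange N).
Proof.
rewrite /vrange cat_uniq (map_inj_uniq inl_inj) (map_inj_uniq inr_inj).
rewrite uniq_zrange /= andbT.
by apply/hasPn => _ /mapP[j _ ->]; apply/mapP => -[].
Qed.

Lemma ev_psC0 N (x : FR) : ev N 0 (psC x) = fseq x N. Proof. by []. Qed.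
Lemma ev_psCS N k (x : FR) : ev N k.+1 (psC x) = 0. Proof. by []. Qed.
Lemma evD N k F G : ev N k (F + G) = ev N k F + ev N k G. Proof. by []. Qed.

Lemma scalar_coef (e : K) k : exists e' : K, (e%:A : FE) k = e'%:A.
Proof.
case: k => [|k]; first by exists e.
by exists 0; rewrite scale0r; exact: scaler0.
Qed.

Lemma abs_weight N m : below N m -> (`|weight m| <= mdeg m * N)%N.
Proof.
move=> /belowP mN; rewrite mdegE /weight big_distrl /=.
apply: (big_ind2 (fun (a : int) (b : nat) => `|a| <= b)%N) => //.
  by move=> a a' b b'; lia.
move=> x _; have [->|mx] := eqVneq (m x) 0%N; first by rewrite mulr0n.
have := mN _ mx; rewrite -mulr_natr abszM; nia.
Qed.

(* Below level N a monomial of degree at most D has weight at most D N, so that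
   the linear bound on the degree makes a family of [nice] series summable as
   soon as its weights tend to infinity. *)
Variant nice (D : nat) (c : int) F : Prop :=
  Nice of within (fun k m => weight m = c /\ (mdeg m <= k + D)%N) F.

Lemma nice_within D c F : nice D c F ->
  within (fun k m => weight m = c /\ (mdeg m <= k + D)%N) F.
Proof. by case. Qed.

Lemma niceW D E c F : (D <= E)%N -> nice D c F -> nice E c F.
Proof. by move=> DE [hF]; split; apply: withinW hF _ => k m [-> h]; split=> //; lia. Qed.

Lemma niceM D E c e F G : nice D c F -> nice E e G -> nice (D + E) (c + e) (F * G).
Proof.
move=> [hF] [hG]; split; apply: withinM hF hG _ => i j m1 m2 [<- h1] [<- h2].
by split; [exact: weightM|rewrite [mdeg _]mdegM; lia].
Qed.

Lemma niceD D c F G : nice D c F -> nice D c G -> nice D c (F + G).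
Proof. by move=> [hF] [hG]; split; apply: withinD. Qed.

Lemma niceN D c F : nice D c F -> nice D c (- F).
Proof. by move=> [hF]; split; apply: withinN. Qed.

Lemma niceB D c F G : nice D c F -> nice D c G -> nice D c (F - G).
Proof. by move=> hF hG; apply: niceD hF (niceN hG). Qed.

Lemma niceZ D c (e : K) F : nice D c F -> nice D c (e *: F).
Proof. by move=> [hF]; split; apply: withinZ. Qed.

Lemma nice0 D c : nice D c 0.
Proof. by split; apply: within0. Qed.

Lemma nice_epsX n D c F : nice (D + n) c F -> nice D c (eps ^+ n * F).
Proof. by move=> [hF]; split; apply: within_epsX hF _ => k m [-> h]; split=> //; lia. Qed.

Lemma nice_epsXr n D c F : nice D c F -> nice D c (eps ^+ n * F).
Proof. by move=> hF; apply: nice_epsX; apply: niceW hF; rewrite leq_addr. Qed.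

Lemma nice_epsdrop n D c F : nice D c F -> nice (D + n) c (epsdrop n F).
Proof.
by move=> [hF]; split; apply: within_epsdrop hF _ => k m [-> h]; split=> //; lia.
Qed.

Lemma nice_gen x : nice 1 (idx x) (psC (fgen K x)).
Proof.
split=> N [|k] m; last by rewrite ev_psCS msupp0.
rewrite ev_psC0 /=; case: ifP => _; last by rewrite msupp0.
by rewrite msuppU oner_eq0 in_fset1 => /eqP ->; rewrite weightU mdegU.
Qed.

Lemma nice_const F : (forall k, exists e : K, F k = e%:A) -> nice 0 0 F.
Proof.
move=> hF; split=> N k m; rewrite /ev; have [e ->] := hF k.
rewrite [fseq _ _]/(e *: (1 : pol K zvar)) => /(fsubsetP (msuppZ_le _ _)).
rewrite -mcoeff_neq0 mcoeff1.
by case: (m =P mone) => [->|]; rewrite ?eqxx // weight1 mdeg1.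
Qed.

Lemma nice_scalar (e : K) : nice 0 0 (e%:A : FE).
Proof.
exact: nice_const (scalar_coef e).
Qed.

Lemma nice_hassum (T : choiceType) (u : T -> FE) D c H :
  hassum u H -> (forall x, nice D c (u x)) -> nice D c H.
Proof. by move=> uH hu; split; apply: within_hassum uH _ => x; apply: nice_within. Qed.

Lemma nice_ev0 D c F N k : nice D c F -> ((k + D) * N < `|c|)%N -> ev N k F = 0.
Proof.
move=> [hF] kc; apply/malgP => m; rewrite mcoeff0.
have [mF|/mcoeff_outdom //] := boolP (m \in msupp (ev N k F)).
have [wm dm] := hF _ _ _ mF.
have bm : below N m.
  move: mF; rewrite -(ev_trunc _ _ (leqnn N)) -mcoeff_neq0 mcoeff_pkeep.
  by case: (below N m) => //; rewrite mulr0n eqxx.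
by have := abs_weight bm; rewrite wm; nia.
Qed.

Lemma null_nice (T : choiceType) (u : T -> FE) D (c : T -> int) :
  (forall B, exists A : {fset T}, forall x, x \notin A -> (B < `|c x|)%N) ->
  (forall x, nice D (c x) (u x)) -> null u.
Proof.
move=> cB hu N k; have [A hA] := cB ((k + D) * N)%N.
by exists A => x xA; apply: nice_ev0 (hu x) _; apply: hA.
Qed.

Lemma proper_zrange n s B : `|s|%N = 1%N ->
  exists A : {fset int}, forall j, j \notin A -> (B < `|(n + s * j)%R|)%N.
Proof.
move=> s1; exists [fset j in zrange (B + `|n|).+1]%fset => j.
move=> jA; have {jA} : j \notin zrange (B + `|n|).+1 by apply: contra jA => jz; apply/imfsetP; exists j.
rewrite mem_zrange; have [->|->] : s = 1 \/ s = -1 by lia.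
  by lia.
by lia.
Qed.

(** [fder] reads its argument at one particular level; any level at which [x] survives gives the
    same answer. This freedom brings several series to a common level. *)
Lemma ev_fderE N M k x F : (N <= M)%N -> (`|idx x| < M)%N ->
  ev N k (fderE x F) = ftrunc N (pder x (ev M k F)).
Proof.
move=> NM xM; rewrite /ev /=; have /fourier_seqP[Fc _] := fseqP (F k).
set M' := (N + `|idx x|.+1)%N.
have [xM' NM'] : (`|idx x| < M')%N /\ (N <= M')%N by rewrite /M'; split; lia.
rewrite -(Fc M' (maxn M M')) ?leq_maxr // -(Fc M (maxn M M')) ?leq_maxl //.
by rewrite -!ftrunc_pder // !ftrunc_ftrunc.
Qed.

Lemma fderED x F G : fderE x (F + G) = fderE x F + fderE x G.
Proof.
apply: ev_ext => N k; set M := (N + `|idx x|.+1)%N.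
have [xM NM] : (`|idx x| < M)%N /\ (N <= M)%N by rewrite /M; split; lia.
by rewrite evD !(ev_fderE _ _ NM xM) evD pderD raddfD.
Qed.

Lemma fderEM x F G : fderE x (F * G) = fderE x F * G + F * fderE x G.
Proof.
apply: ev_ext => N k; set M := (N + `|idx x|.+1)%N.
have [xM NM] : (`|idx x| < M)%N /\ (N <= M)%N by rewrite /M; split; lia.
rewrite (ev_fderE _ _ NM xM) !evM evD !evM pder_sum raddf_sum -big_split /=.
apply: eq_bigr => i _; rewrite pderM !(ev_fderE _ _ NM xM).
rewrite -[ev N i F](ev_trunc _ _ NM) -[ev N (k - i) G](ev_trunc _ _ NM).
exact: (rmorph_leibniz (ftrunc N)).
Qed.

Lemma fderE_gen x y : fderE x (psC (fgen K y)) = (x == y)%:R.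
Proof.
apply: ev_ext => N k; set M := (N + `|idx x|.+1 + `|idx y|.+1)%N.
have [xM NM] : (`|idx x| < M)%N /\ (N <= M)%N by rewrite /M; split; lia.
rewrite (ev_fderE _ _ NM xM); case: k => [|k].
  have -> : ev M 0 (psC (fgen K y)) = pvar K y.
    rewrite ev_psC0 /=; case: ifP => //; rewrite /M; lia.
  rewrite pder_var; case: eqP => _; last by rewrite raddf0.
  by rewrite rmorph1.
by rewrite ev_psCS pder0 raddf0; case: eqP.
Qed.

Lemma fderE_const x F : (forall k, exists e : K, F k = e%:A) -> fderE x F = 0.
Proof.
move=> hF; apply: ev_ext => N k.
set M := (N + `|idx x|.+1)%N.
have [xM NM] : (`|idx x| < M)%N /\ (N <= M)%N by rewrite /M; split; lia.
rewrite (ev_fderE _ _ NM xM) /ev; have [e ->] := hF k.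
by rewrite [X in pder _ X]/(e%:A) pder_scalar raddf0.
Qed.

Lemma fderE_epslin x : epslin (fderE x : FE -> FE).
Proof.
split=> [F G|F]; first exact: fderED.
rewrite fderEM fderE_const ?mul0r ?add0r // => k.
by exists (k == 1%N)%:R; rewrite scaler_nat.
Qed.

Lemma fderEZ x (c : K) F : fderE x (c *: F) = c *: fderE x F.
Proof.
rewrite -mulr_algl fderEM fderE_const ?mul0r ?add0r ?mulr_algl //.
exact: scalar_coef.
Qed.

Lemma within_fder (P Q : nat -> cmonom zvar -> Prop) x F : within P F ->
  (forall k m, P k (mulcm m (ucm x)) -> Q k m) -> within Q (fderE x F).
Proof.
move=> hF PQ N k m; set M := (N + `|idx x|.+1)%N.
have [xM NM] : (`|idx x| < M)%N /\ (N <= M)%N by rewrite /M; split; lia.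
rewrite (ev_fderE _ _ NM xM) -mcoeff_neq0 mcoeff_pkeep mcoeff_pder => h.
apply: PQ; apply: (hF M); rewrite -mcoeff_neq0.
by apply: contraNneq h => ->; rewrite !mul0rn.
Qed.

Lemma nice_fder x D c F : nice D c F -> nice D.-1 (c - idx x) (fderE x F).
Proof.
move=> [hF]; split; apply: within_fder hF _ => k m [].
rewrite weightM weightU [mdeg _]mdegM mdegU => <- h; split; first by rewrite addrK.
by lia.
Qed.

(** Convertible to [tame] over R[i]; the theory of the bracket runs over any coefficient ring. *)
Definition tame_series F : Prop := forall N n, exists M : nat,
  forall x : zvar, (M <= `|idx x|)%N -> fnbhd N n (fderE x F).

Lemma nice_tame D c F : nice D c F -> tame_series F.
Proof.
move=> hF N n; exists (`|c| + (n + D) * N).+1 => x xM k kn.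
change (ev N k (fderE x F) = 0); apply: (nice_ev0 (nice_fder x hF)).
by apply: (@leq_ltn_trans ((n + D) * N)); [rewrite leq_mul2r; lia|lia].
Qed.

(** Partial sums of the individual bounds make the bound monotone in the order, as products
    require. *)
Lemma weight_bound F : exists2 b : nat -> nat, {homo b : i j / (i <= j)%N} &
  within (fun k m => `|weight m| <= b k)%N F.
Proof.
have h k : exists B : nat, forall N m, m \in msupp (ev N k F) -> (`|weight m| <= B)%N.
  by have /fourier_seqP[_ [B hB]] := fseqP (F k); exists B.
have [B hB] := choice h.
exists (fun k => \sum_(i < k.+1) B i)%N.
  move=> i j ij; rewrite (big_ord_widen j.+1 (fun i => B i)) ?ltnS //.
  by rewrite big_mkcond leq_sum // => l _; case: ifP.
by move=> N k m /hB h'; apply: leq_trans h' _; rewrite big_ord_recr leq_addl.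
Qed.

Lemma fnbhdE N n F G : fnbhd N n (F - G) <-> forall k, (k < n)%N -> ev N k F = ev N k G.
Proof.
split=> h k kn; last first.
  by change (ev N k (F - G) = 0); rewrite raddfB /= h // subrr.
by apply/eqP; rewrite -subr_eq0 -raddfB; apply/eqP; apply: h.
Qed.

Lemma FE_hausdorff : hausdorff_space FE.
Proof.
move=> F G clFG; apply: ev_ext => N k.
have nF : nbhs F [set H | fnbhd N k.+1 (H - F)] by exists N, k.+1.
have nG : nbhs G [set H | fnbhd N k.+1 (H - G)] by exists N, k.+1.
have [H [/fnbhdE hF /fnbhdE hG]] := clFG _ _ nF nG.
by rewrite -hF // hG.
Qed.

Lemma FE_lim (s : nat -> FE) F :
  (forall N n, exists M, forall i, (M <= i)%N -> fnbhd N n (s i - F)) ->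
  lim (s @ \oo) = F.
Proof.
move=> h; apply: cvg_lim; first exact: FE_hausdorff.
move=> A [N [n hA]]; have [M hM] := h N n.
by exists M => // i /= Mi; apply: hA; apply: hM.
Qed.

Lemma hassum_fnbhd (T : choiceType) (u : T -> FE) H N n : hassum u H ->
  exists A : {fset T}, (forall x, x \notin A -> fnbhd N n (u x)) /\
    forall B, (A `<=` B)%fset -> fnbhd N n (\sum_(x <- B) u x - H).
Proof.
move=> uH; suff [A hA] : exists A : {fset T}, forall k, (k < n)%N -> forall B,
    (A `<=` B)%fset -> (forall x, x \notin B -> ev N k (u x) = 0) /\
      \sum_(x <- B) ev N k (u x) = ev N k H.
  exists A; split=> [x xA k kn|B AB]; first by apply: (hA k kn A (fsubset_refl _)).1.
  apply/fnbhdE => k kn; rewrite raddf_sum /=.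
  by have [_ ->] := hA k kn B AB.
elim: n => [|n [A hA]]; first by exists fset0.
have [A' hA'] := fsumto_sup (uH N n); exists (A `|` A')%fset => k.
rewrite ltnS leq_eqVlt => /orP[/eqP ->|kn] B AB.
  by apply: hA'; apply: fsubset_trans AB; apply: fsubsetUr.
by apply: hA => //; apply: fsubset_trans AB; apply: fsubsetUl.
Qed.

Lemma zsum_hassum (u : int -> FE) H : hassum u H -> zsum u = H.
Proof.
move=> uH; apply: FE_lim => N n; have [A [_ hA]] := hassum_fnbhd N n uH.
have [M hM] := seq_bounded A (fun j : int => `|j|.+1); exists M => i Mi.
have -> : \sum_(j <- zrange i) u j = \sum_(j <- [fset j in zrange i]%fset) u j.
  apply: perm_big; apply: uniq_perm; rewrite ?uniq_zrange ?fset_uniq // => j.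
  by rewrite inE.
apply: hA; apply/fsubsetP => j jA; rewrite inE /= mem_zrange.
exact: leq_trans (hM _ jA) Mi.
Qed.

Lemma vsum2_hassum (u : zvar -> zvar -> FE) H :
  hassum (fun p : zvar * zvar => u p.1 p.2) H -> vsum2 u = H.
Proof.
move=> uH; apply: FE_lim => N n; have [A [_ hA]] := hassum_fnbhd N n uH.
have [M hM] := seq_bounded A (fun p : zvar * zvar => (`|idx p.1| + `|idx p.2|).+1).
exists M => i Mi.
have -> : \sum_(x <- vrange i) \sum_(y <- vrange i) u x y =
    \sum_(p <- [fset p in [seq (x, y) | x <- vrange i, y <- vrange i]]%fset) u p.1 p.2.
  transitivity (\sum_(p <- [seq (x, y) | x <- vrange i, y <- vrange i]) u p.1 p.2).
    by rewrite big_allpairs.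
  apply: perm_big; apply: uniq_perm; last by move=> j; rewrite !inE.
    by apply: allpairs_uniq; rewrite ?uniq_vrange // => -[x y] [x' y'] _ _ [-> ->].
  exact: fset_uniq.
apply: hA; apply/fsubsetP => -[x y] pA; rewrite inE /=.
have /= xy := leq_trans (hM _ pA) Mi.
by apply/allpairsP; exists (x, y); split=> //=; rewrite mem_vrange; lia.
Qed.

End HomogeneousSeries.

(** * Poisson brackets as biderivations *)

Section BracketTheory.
Variable K : comNzRingType.
Local Notation FR := (fourier_ring K).
Local Notation FE := (epseries FR).
Implicit Types F G H : FE.

Variable br : zvar -> zvar -> FE.
Hypothesis br_anti : forall x y, br y x = - br x y.
Hypothesis br_nice : forall x y, nice 0 (idx x + idx y) (br x y).

Definition pb F G : FE := vsum2 (fun x y => fderE x F * fderE y G * br x y).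

Local Notation gen := (fun x => psC (fgen K x) : FE).

(** For [x] far out, dF/dx vanishes at the given level by tameness. The other [x] have bounded
    index, so that for [y] far out the bracket of [x] and [y] has a weight too large to be visible
    at that level. The weights stay bounded because the shifts caused by the two derivatives are
    compensated by the weight of the bracket. *)
Lemma pb_hassum F G : tame_series F ->
  hassum (fun p : zvar * zvar => fderE p.1 F * fderE p.2 G * br p.1 p.2) (pb F G).
Proof.
move=> tF; set u := fun p : zvar * zvar => _.
have [H uH] : exists H, hassum u H.
  have [bF bFm hF] := weight_bound F; have [bG bGm hG] := weight_bound G.
  apply: (hassum_exists (B := fun k => bF k + bG k)%N); last first.
    move=> [x y]; rewrite /u /=.
    have hFx : within (fun k m => `|(weight m + idx x)%R| <= bF k)%N (fderE x F).
      by apply: within_fder hF _ => k m; rewrite weightM weightU.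
    have hGy : within (fun k m => `|(weight m + idx y)%R| <= bG k)%N (fderE y G).
      by apply: within_fder hG _ => k m; rewrite weightM weightU.
    have hFG : within (fun k m => `|(weight m + idx x + idx y)%R| <= bF k + bG k)%N
        (fderE x F * fderE y G).
      apply: withinM hFx hGy _ => i j m1 m2 h1 h2; rewrite [weight _]weightM.
      have := bFm _ _ (leq_addr j i); have := bGm _ _ (leq_addl i j); lia.
    apply: withinM hFG (nice_within (br_nice x y)) _ => i j m1 m2 h1 [h2 _].
    rewrite [weight _]weightM h2.
    have := bFm _ _ (leq_addr j i); have := bGm _ _ (leq_addr j i); lia.
  move=> N k; have [M hM] := tF N k.+1.
  exists [fset p in [seq (x, y) | x <- vrange (M + k * N).+1, y <- vrange (M + k * N).+1]]%fset.
  move=> [x y] xyA; rewrite /u /= evM big1 // => i _.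
  have [xM|xM] := leqP M `|idx x|.
    rewrite evM big1 ?mul0r // => j _.
    rewrite [ev N j (fderE x F)](hM x xM j) ?mul0r //.
    by rewrite (leq_trans (ltn_ord j)) // ltnW // ltn_ord.
  rewrite (nice_ev0 (br_nice x y)) ?mulr0 //.
  have ym : (M + k * N < `|idx y|)%N.
    rewrite ltnNge; apply: contra xyA => yM; apply/imfsetP; exists (x, y) => //.
    by apply/allpairsP; exists (x, y); split=> //=; rewrite mem_vrange; lia.
  have ik : ((k - i + 0) * N <= k * N)%N by rewrite leq_mul2r; lia.
  by apply: (leq_ltn_trans ik); lia.
by rewrite [pb F G](vsum2_hassum (u := fun x y => fderE x F * fderE y G * br x y) uH).
Qed.

Lemma pb_hassum_r F G : tame_series G ->
  hassum (fun p : zvar * zvar => fderE p.1 F * fderE p.2 G * br p.1 p.2) (- pb G F).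
Proof.
move=> tG; have := hassumN (pb_hassum F tG).
move=> /(hassum_reindex (g := fun p : zvar * zvar => (p.2, p.1))
  (g' := fun p : zvar * zvar => (p.2, p.1))).
move=> /(_ (fun p => esym (surjective_pairing p)) (fun p => esym (surjective_pairing p))).
apply: hassum_ext => -[x y] /=.
by rewrite br_anti mulrN opprK [fderE y G * _]mulrC.
Qed.

Lemma pb_antisym F G : tame_series F -> pb G F = - pb F G.
Proof.
move=> tF; apply: (vsum2_hassum (u := fun x y => fderE x G * fderE y F * br x y)).
exact: pb_hassum_r.
Qed.

Lemma pbD F G H : tame_series F -> pb F (G + H) = pb F G + pb F H.
Proof.
move=> tF; apply: hassum_uniq (pb_hassum _ tF) _.
apply: hassum_ext (hassumD (pb_hassum G tF) (pb_hassum H tF)) => p.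
by rewrite fderED mulrDr mulrDl.
Qed.

Lemma pbM F G H : tame_series F -> pb F (G * H) = pb F G * H + G * pb F H.
Proof.
move=> tF; apply: hassum_uniq (pb_hassum _ tF) _.
rewrite [pb F G * H]mulrC.
apply: hassum_ext (hassumD (hassumM H (pb_hassum G tF)) (hassumM G (pb_hassum H tF))) => p.
by rewrite fderEM; ring.
Qed.

Lemma pb_const F G : tame_series F -> (forall k, exists e : K, G k = e%:A) -> pb F G = 0.
Proof.
move=> tF cG; apply: hassum_uniq (pb_hassum _ tF) _.
by apply: hassum_ext (hassum0 _ _) => p; rewrite (fderE_const _ cG) mulr0 mul0r.
Qed.

Lemma pbMconst F G H : tame_series F -> (forall k, exists e : K, G k = e%:A) ->
  pb F (G * H) = G * pb F H.
Proof. by move=> tF cG; rewrite pbM // pb_const // mul0r add0r. Qed.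

Lemma eps_const k : exists e : K, (eps : FE) k = e%:A.
Proof. by exists (k == 1%N)%:R; rewrite scaler_nat. Qed.

Lemma pb_epslin F : tame_series F -> epslin (pb F).
Proof.
move=> tF; split=> [G H|G]; first exact: pbD.
by rewrite pbMconst //; exact: eps_const.
Qed.

Lemma pbZ F (c : K) G : tame_series F -> pb F (c *: G) = c *: pb F G.
Proof.
move=> tF; rewrite -mulr_algl pbMconst ?mulr_algl //; exact: scalar_coef.
Qed.

Lemma pb_gen F y : tame_series F ->
  hassum (fun x => fderE x F * br x y) (pb F (gen y)).
Proof.
move=> tF; apply: hassum_fubini (pb_hassum _ tF) _ => x /=.
have := hassum_single (u := fun y' => fderE x F * fderE y' (gen y) * br x y') (x0 := y).
rewrite fderE_gen eqxx mulr1; apply => y' yy'.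
by rewrite fderE_gen (negbTE yy') mulr0 mul0r.
Qed.

Lemma pb_gen_gen x y : pb (gen x) (gen y) = br x y.
Proof.
apply: (hassum_uniq (pb_gen y (nice_tame (@nice_gen K x)))).
have := hassum_single (u := fun x' => fderE x' (gen x) * br x' y) (x0 := x).
rewrite fderE_gen eqxx mul1r; apply => x' xx'.
by rewrite fderE_gen (negbTE xx') mul0r.
Qed.

Lemma ev_fderE0 N n N' x F : (N <= N')%N -> (`|idx x| < N')%N -> fnbhd N' n F ->
  forall k, (k < n)%N -> ev N k (fderE x F) = 0.
Proof.
move=> NN' xN' hF k kn; rewrite (ev_fderE _ _ NN' xN').
by rewrite [ev N' k F]hF // pder0 raddf0.
Qed.

Lemma pb_continuous F N n : tame_series F -> exists2 N', (N <= N')%N &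
  forall G, fnbhd N' n G -> fnbhd N n (pb F G).
Proof.
(* Variables [y] below this level are controlled by the smallness of G there. Beyond it, with the
   index of [x] below [M], the weight of the bracket of [x] and [y] exceeds n * N and the term is
   invisible. *)
move=> tF; have [M hM] := tF N n; exists (N + (M + n * N).+1)%N; first exact: leq_addr.
move=> G hG k kn; apply: (fsumto_uniq (pb_hassum G tF N k)).
apply: fsumto_ext (fsumto0 _ _) => -[x y] /=; apply: esym.
rewrite evM big1 // => i _.
have ik : (i <= k)%N by rewrite -ltnS.
have [xM|xM] := leqP M `|idx x|.
  rewrite evM big1 ?mul0r // => j _.
  rewrite [ev N j (fderE x F)](hM x xM j) ?mul0r //.
  by apply: leq_ltn_trans kn; apply: leq_trans ik; rewrite -ltnS.
have [yM|yM] := ltnP `|idx y| (N + (M + n * N).+1).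
  rewrite evM big1 ?mul0r // => j _.
  rewrite [ev N (i - j) (fderE y G)](ev_fderE0 _ yM hG) ?mulr0 ?leq_addr //.
  by apply: leq_ltn_trans kn; apply: leq_trans ik; rewrite leq_subr.
rewrite (nice_ev0 (br_nice x y)) ?mulr0 //.
have ik' : ((k - i + 0) * N <= n * N)%N by rewrite leq_mul2r; lia.
by apply: (leq_ltn_trans ik'); lia.
Qed.

Lemma pb_sum F (T : Type) (r : seq T) (u : T -> FE) : tame_series F ->
  pb F (\sum_(x <- r) u x) = \sum_(x <- r) pb F (u x).
Proof.
move=> tF; have lF := pb_epslin tF; have [pD _] := lF.
exact: (big_morph (pb F) pD (epslin0 lF)).
Qed.

Lemma pb_hassum_cont F (T : choiceType) (u : T -> FE) H : tame_series F ->
  hassum u H -> hassum (fun x => pb F (u x)) (pb F H).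
Proof.
move=> tF uH N k; have [N' NN' hN'] := pb_continuous N k.+1 tF.
have [A [u0 hA]] := hassum_fnbhd N' k.+1 uH.
exists A; split=> [x xA|]; first exact: (hN' _ (u0 x xA) k (ltnSn k)).
have := hN' _ (hA A (fsubset_refl _)) k (ltnSn k).
rewrite (epslinB _ _ (pb_epslin tF)) pb_sum // => h.
apply/eqP; rewrite -subr_eq0; apply/eqP; rewrite -[RHS]h.
rewrite -/(ev N k _) raddfB raddf_sum /=; exact: erefl.
Qed.

Lemma nice_pb D E c e F G : nice D c F -> nice E e G ->
  nice (D.-1 + E.-1) (c + e) (pb F G).
Proof.
move=> hF hG; apply: nice_hassum (pb_hassum G (nice_tame hF)) _ => -[x y] /=.
have -> : c + e = (c - idx x) + (e - idx y) + (idx x + idx y) by lia.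
rewrite -[(D.-1 + E.-1)%N]addn0.
by apply: niceM; [apply: niceM; apply: nice_fder|].
Qed.

End BracketTheory.

(** * The second bracket modulo epsilon^3 *)

Section ModuleIdentities.
Variables (K : numFieldType) (V : lmodType K).
Implicit Types u v w : V.

Lemma comb3D (d al be d' al' be' : K) u v w :
  d *: u + (al *: v + be *: w) + (d' *: u + (al' *: v + be' *: w)) =
  (d + d') *: u + ((al + al') *: v + (be + be') *: w).
Proof. by rewrite !scalerDl [LHS]addrACA; congr (_ + _); exact: addrACA. Qed.

Lemma comb3Z (x d al be : K) u v w :
  x *: (d *: u + (al *: v + be *: w)) = (x * d) *: u + ((x * al) *: v + (x * be) *: w).
Proof. by rewrite !scalerDr !scalerA. Qed.

Lemma comb2_sub (x y : K) u v : x *: (u - v) + y *: v = x *: u + (y - x) *: v.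
Proof. by rewrite scalerBr scalerBl -addrA [- _ + _]addrC. Qed.

Lemma virasoro_comb (y e rho : K) u v w :
  y *: (2^-1 *: u + 2^-1 *: v) + (e *: w + rho *: (u - v)) =
  e *: w + ((y / 2 + rho) *: u + (y / 2 - rho) *: v).
Proof.
rewrite scalerDr !scalerA [rho *: _]scalerBr !scalerDl scaleNr addrCA; congr (_ + _).
exact: addrACA.
Qed.

Lemma self_opp0 u : u = - u -> u = 0.
Proof.
move=> h; have : (2 : K) *: u = 0 by rewrite scaler_nat mulr2n {2}h subrr.
by move=> /(congr1 ( *:%R 2^-1)); rewrite scalerA mulVf ?pnatr_eq0 // scale1r scaler0.
Qed.

Lemma two_half_sum u v : 2 *: (2^-1 *: u + 2^-1 *: v) - v = u :> V.
Proof. by rewrite scalerDr !scalerA mulfV ?pnatr_eq0 // !scale1r addrK. Qed.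

Lemma half_sum_diff u v : 2^-1 *: u + 2^-1 *: v - (- 2^-1) *: (u - v) = u.
Proof.
rewrite scaleNr opprK scalerBr addrACA subrr addr0 -scalerDl.
by rewrite -[RHS]scale1r; congr (_ *: _); field.
Qed.

Lemma half_diff_diff u v : 2^-1 *: u + 2^-1 *: v - 2^-1 *: (u - v) = v.
Proof.
rewrite scalerBr opprB [X in X + _ = _]addrC addrACA subrr addr0.
by rewrite -scalerDl -[RHS]scale1r; congr (_ *: _); field.
Qed.

End ModuleIdentities.

Section GroupIdentities.
Variable V : zmodType.
Implicit Types u v w : V.

Lemma subD_congr u v w u' v' w' : u = u' -> v = v' -> w = w' ->
  u - (v + w) = u' - (v' + w').
Proof. by move=> -> -> ->. Qed.

Lemma subrK_eq u v w : w = u - v -> u = v + w.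
Proof. by move=> ->; rewrite addrC subrK. Qed.

End GroupIdentities.

(** The terms in which at least one factor is a Kronecker delta are removed: each sits at a single
    index, so their sum is explicit. The product of the two remaining factors is of order e^4. *)
Fact convolution_split (K : numFieldType) (T : comAlgType K) (x y : K) (p q : bool)
    (e al be g : T) :
  (x%:A *+ p + e ^+ 2 * al) * (y%:A *+ q + e ^+ 2 * be) * g -
    ((if p then (x * y * q%:R) *: g + x *: (e ^+ 2 * (be * g)) else 0) +
     (if q then y *: (e ^+ 2 * (al * g)) else 0)) =
  e ^+ 4 * (al * be * g).
Proof.
have sc (z : K) (u : T) : z *: u = z%:A * u by rewrite mulr_algl.
have -> : (x * y * q%:R) *: g = x%:A * y%:A * q%:R * g.
  case: q; last by rewrite mulr0 mulr0 mul0r scale0r.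
  by rewrite !mulr1 mulr_algl scalerA mulr_algl.
rewrite (sc x (_ * _)) (sc y (_ * _)); move: (x%:A) (y%:A) => X Y.
by case: p; case: q; rewrite ?mulr1n ?mulr0n; ring.
Qed.

Section Approximation.
Variable K : numFieldType.
Local Notation FR := (fourier_ring K).
Local Notation FE := (epseries FR).
Implicit Types (F G H : FE) (s : int).

Definition av (r : int) : FE := psC (fgen K (inl r)).
Definition bv (r : int) : FE := psC (fgen K (inr r)).

Lemma nice_av r : nice 1 r (av r). Proof. exact: (@nice_gen K (inl r)). Qed.
Lemma nice_bv r : nice 1 r (bv r). Proof. exact: (@nice_gen K (inr r)). Qed.

Lemma proper_id B : exists A : {fset int}, forall j, j \notin A -> (B < `|j|)%N.
Proof.
have [A hA] := proper_zrange 0 B (erefl 1%N : `|1%R|%N = 1%N).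
by exists A => j /hA; rewrite add0r mul1r.
Qed.

Lemma null_int (u : int -> FE) D : (forall r, nice D r (u r)) -> null u.
Proof. exact: null_nice proper_id. Qed.

Lemma null_int_sub (u : int -> FE) n D : (forall r, nice D (n - r) (u r)) -> null u.
Proof.
move=> hu; apply: (null_nice (c := fun r => n - r) (D := D)) => // B.
have [A hA] := proper_zrange n B (erefl 1%N : `|-1%R|%N = 1%N).
by exists A => j /hA; rewrite mulN1r.
Qed.

Lemma nice_hassum_exists (T : choiceType) (u : T -> FE) D n : null u ->
  (forall x, nice D n (u x)) -> exists H, hassum u H.
Proof.
move=> u0 hu; apply: (hassum_exists (B := fun=> `|n|%N)) => // x.
by apply: withinW (nice_within (hu x)) _ => k m [-> _].
Qed.

(** The common shape modulo eps^3 of the brackets in the tables: scalars, which there carry a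
    Kronecker delta, and at order eps^2 one combination of a_s and b_s. *)
Definition co3 F s (d0 d1 d2 al be : K) : Prop :=
  [/\ F 0%N = d0%:A, F 1%N = d1%:A
    & F 2%N = d2%:A + (al *: fgen K (inl s) + be *: fgen K (inr s))].

Lemma co3D F G s d0 d1 d2 al be d0' d1' d2' al' be' :
  co3 F s d0 d1 d2 al be -> co3 G s d0' d1' d2' al' be' ->
  co3 (F + G) s (d0 + d0') (d1 + d1') (d2 + d2') (al + al') (be + be').
Proof.
move=> [f0 f1 f2] [g0 g1 g2]; split.
- by rewrite scalerDl -f0 -g0.
- by rewrite scalerDl -f1 -g1.
- exact: etrans (congr2 +%R f2 g2) (comb3D _ _ _ _ _ _ _ _ _).
Qed.

Lemma co3Z F s d0 d1 d2 al be (x : K) :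
  co3 F s d0 d1 d2 al be -> co3 (x *: F) s (x * d0) (x * d1) (x * d2) (x * al) (x * be).
Proof.
move=> [f0 f1 f2]; split.
- by rewrite -scalerA -f0.
- by rewrite -scalerA -f1.
- exact: etrans (congr1 ( *:%R x) f2) (comb3Z _ _ _ _ _ _ _).
Qed.

Lemma co3_eq F s d0 d1 d2 al be d0' d1' d2' al' be' :
  co3 F s d0 d1 d2 al be -> d0 = d0' -> d1 = d1' -> d2 = d2' -> al = al' -> be = be' ->
  co3 F s d0' d1' d2' al' be'.
Proof. by move=> h <- <- <- <- <-. Qed.

Lemma co3N F s d0 d1 d2 al be :
  co3 F s d0 d1 d2 al be -> co3 (- F) s (- d0) (- d1) (- d2) (- al) (- be).
Proof.
by move=> /(co3Z (-1)); rewrite scaleN1r => /co3_eq; apply; rewrite mulN1r.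
Qed.

Lemma co3_eps F s d0 d1 d2 al be :
  co3 F s d0 d1 d2 al be -> co3 (eps * F) s 0 d0 d1 0 0.
Proof.
by move=> [f0 f1 _]; split; rewrite ?epsMcoef0 ?epsMcoefS ?scale0r ?addr0.
Qed.

Lemma co3_eps2 F s d al be :
  F 0%N = d%:A + (al *: fgen K (inl s) + be *: fgen K (inr s)) ->
  co3 (eps ^+ 2 * F) s 0 0 d al be.
Proof. by move=> f0; split; rewrite epsXMcoef ?scale0r. Qed.

Lemma co3_eps3 F s : co3 (eps ^+ 3 * F) s 0 0 0 0 0.
Proof. by split; rewrite epsXMcoef ?scale0r ?addr0. Qed.

Lemma co3_uniq F G s d0 d1 d2 al be : co3 F s d0 d1 d2 al be ->
  co3 G s d0 d1 d2 al be -> F = G + eps ^+ 3 * epsdrop 3 (F - G).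
Proof.
move=> [f0 f1 f2] [g0 g1 g2]; apply: subrK_eq; apply: esym; apply: epsdropK.
move=> k k3; change (F k - G k = 0); apply/eqP; rewrite subr_eq0; apply/eqP.
by case: k k3 => [|[|[|]]] // _; rewrite ?f0 ?g0 ?f1 ?g1 ?f2 ?g2.
Qed.

(** The two contributions may sit at the same index, which is why the terms are given as a sum of
    two indicator families. *)
Lemma hassum_coef2 (T : choiceType) (u : T -> FE) H k x1 x2 (v1 v2 : FR) :
  hassum u H -> (forall x, u x k = v1 *+ (x == x1) + v2 *+ (x == x2)) ->
  H k = v1 + v2.
Proof.
move=> uH uE; apply: fseq_inj => N; apply: (fsumto_uniq (uH N k)).
have e (v : FR) (y : T) : fsumto (fun x : T => fseq (v *+ (x == y)) N) (fseq v N).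
  have := fsumto_single (u := fun x => fseq (v *+ (x == y)) N) (x0 := y).
  by rewrite eqxx mulr1n; apply => x /negbTE ->.
have h2 := fsumto_lin (fsumto0 _ T) (e v2 x2).
have := fsumto_lin (e v1 x1) h2; rewrite sub0r opprK; apply: fsumto_ext => x.
by rewrite sub0r opprK /ev uE.
Qed.

Lemma dmul_eq (n m : int) (f g : K) : (m%:~R = - n%:~R :> K -> f = g) ->
  (n + m == 0)%:R * f = (n + m == 0)%:R * g.
Proof.
move=> fg; case: eqP => [h|_]; last by rewrite !mul0r.
rewrite fg //; have -> : m = - n by lia.
exact: rmorphN.
Qed.

Lemma deltaP (n m : int) : (n + m == 0)%:R = 0 :> K \/
  (n + m == 0)%:R = 1 :> K /\ m%:~R = - n%:~R :> K.
Proof.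
case: eqP => [h|_]; [right|by left]; split=> //.
by apply/eqP; rewrite -addr_eq0 -intrD addrC h.
Qed.

End Approximation.

Section Convolution.
Variable K : numFieldType.
Local Notation FR := (fourier_ring K).
Local Notation FE := (epseries FR).
Variables (x0 y0 : K) (al be : int -> FR) (g : int -> FE) (ga : int -> nat -> K).
Hypothesis gE : forall r k, g r k = (ga r k)%:A.
Hypothesis al_nice : forall r, nice 1 r (psC (al r)).
Hypothesis be_nice : forall r, nice 1 r (psC (be r)).

Let A (r : int) : FE := x0%:A *+ (r == 0) + eps ^+ 2 * psC (al r).
Let B (r : int) : FE := y0%:A *+ (r == 0) + eps ^+ 2 * psC (be r).

Lemma nice_delta D z (f : int -> FR) r : nice D.+2 r (psC (f r)) ->
  nice D r (z%:A *+ (r == 0) + eps ^+ 2 * psC (f r) : FE).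
Proof.
move=> hf; apply: niceD; last by apply: nice_epsX; rewrite addn2.
case: eqP => [->|_]; last exact: nice0.
by apply: (niceW _ (nice_scalar z)).
Qed.

Lemma nice_convA r : nice 0 r (A r).
Proof. by apply: nice_delta; apply: (niceW _ (al_nice r)). Qed.
Lemma nice_convB r : nice 0 r (B r).
Proof. by apply: nice_delta; apply: (niceW _ (be_nice r)). Qed.
Lemma nice_convg r : nice 0 0 (g r).
Proof. by apply: nice_const => k; exists (ga r k). Qed.

Lemma nice_conv_term N r : nice 0 N (A r * B (N - r) * g r).
Proof.
have := niceM (niceM (@nice_convA r) (@nice_convB (N - r))) (@nice_convg r).
by rewrite addr0 addrC subrK.
Qed.

Lemma conv_exists N : exists H, hassum (fun r => A r * B (N - r) * g r) H.
Proof.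
apply: (nice_hassum_exists _ (@nice_conv_term N)).
have u0 := nullM (fun r => B (N - r) * g r) (null_int nice_convA).
by move=> M k; have [S hS] := u0 M k; exists S => r /hS; rewrite mulrA.
Qed.

(** Below eps^4 only r = 0 and r = N contribute, where the first or the second factor has its
    Kronecker delta. *)
Lemma conv_co3 N H : hassum (fun r => A r * B (N - r) * g r) H ->
  exists H', H = (x0 * y0 * (N == 0)%:R) *: g 0 +
    (x0 *: (eps ^+ 2 * (psC (be N) * g 0)) + y0 *: (eps ^+ 2 * (psC (al N) * g N)))
    + eps ^+ 4 * H'.
Proof.
move=> hH.
have h1 := hassum_single (u := fun r : int => if r == 0 then
  (x0 * y0 * (N == 0)%:R) *: g 0 + x0 *: (eps ^+ 2 * (psC (be N) * g 0)) else 0) (x0 := 0).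
have h2 := hassum_single (u := fun r : int => if r == N then
  y0 *: (eps ^+ 2 * (psC (al N) * g N)) else 0) (x0 := N).
rewrite eqxx in h1; rewrite eqxx in h2.
have {}h1 := h1 (fun x => ifN_eq _ _); have {}h2 := h2 (fun x => ifN_eq _ _).
have := hassumB hH (hassumD h1 h2).
have key r : A r * B (N - r) * g r - ((if r == 0 then
    (x0 * y0 * (N == 0)%:R) *: g 0 + x0 *: (eps ^+ 2 * (psC (be N) * g 0)) else 0) +
    (if r == N then y0 *: (eps ^+ 2 * (psC (al N) * g N)) else 0)) =
    eps ^+ 4 * (psC (al r) * psC (be (N - r)) * g r).
  apply: etrans (convolution_split x0 y0 (r == 0) (N - r == 0) eps (psC (al r))
    (psC (be (N - r))) (g r)).
  apply: (subD_congr (erefl _)); first by case: (r =P 0) => [->|_]; [rewrite subr0; exact: erefl|exact: erefl].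
  have -> : (r == N) = (N - r == 0) by lia.
  case: eqP => [Nr|_]; last exact: erefl.
  by have -> : N = r by lia.
move=> /(hassum_ext key) /hassum_epsX[H' hH' _]; exists H'.
by rewrite -hH'; apply: subrK_eq; congr (_ - _); rewrite addrA.
Qed.

Lemma conv_coefs N H : hassum (fun r => A r * B (N - r) * g r) H ->
  [/\ H 0%N = ((N == 0)%:R * (x0 * y0 * ga 0 0))%:A,
      H 1%N = ((N == 0)%:R * (x0 * y0 * ga 0 1))%:A
    & H 2%N = ((N == 0)%:R * (x0 * y0 * ga 0 2))%:A +
       (x0 * ga 0 0 *: be N + y0 * ga N 0%N *: al N)].
Proof.
move=> /conv_co3[H' ->].
have e0 (F : FE) : (eps ^+ 2 * F) 0%N = 0 by rewrite epsXMcoef.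
have e1 (F : FE) : (eps ^+ 2 * F) 1%N = 0 by rewrite epsXMcoef.
have e2 (F : FE) : (eps ^+ 2 * F) 2%N = F 0%N by rewrite epsXMcoef.
have e4 k : (k < 4)%N -> (eps ^+ 4 * H') k = 0 by move=> k4; rewrite epsXMcoef k4.
have wE k : (N == 0)%:R * (x0 * y0 * ga 0 k) = x0 * y0 * (N == 0)%:R * ga 0 k.
  by rewrite [RHS]mulrAC [RHS]mulrC.
rewrite !wE; set w := x0 * y0 * _.
split.
- change (w *: g 0 0%N + (x0 *: (eps ^+ 2 * (psC (be N) * g 0)) 0%N +
    y0 *: (eps ^+ 2 * (psC (al N) * g N)) 0%N) + (eps ^+ 4 * H') 0%N = (w * ga 0 0)%:A).
  by rewrite e4 // !e0 !scaler0 !addr0 gE scalerA.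
- change (w *: g 0 1%N + (x0 *: (eps ^+ 2 * (psC (be N) * g 0)) 1%N +
    y0 *: (eps ^+ 2 * (psC (al N) * g N)) 1%N) + (eps ^+ 4 * H') 1%N = (w * ga 0 1)%:A).
  by rewrite e4 // !e1 !scaler0 !addr0 gE scalerA.
- change (w *: g 0 2%N + (x0 *: (eps ^+ 2 * (psC (be N) * g 0)) 2%N +
    y0 *: (eps ^+ 2 * (psC (al N) * g N)) 2%N) + (eps ^+ 4 * H') 2%N = (w * ga 0 2)%:A +
    (x0 * ga 0 0 *: be N + y0 * ga N 0%N *: al N)).
  rewrite e4 // !e2 addr0 gE scalerA; congr (_ + _).
  by rewrite !psCMcoef !gE -!scalerAr !mulr1 !scalerA.
Qed.

End Convolution.

(** * Expansion of the brackets of the generators *)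

Section SecondBracket.
Variables (K : numFieldType) (c : K).
Local Notation FR := (fourier_ring K).
Local Notation FE := (epseries FR).
Local Notation av := (@av K).
Local Notation bv := (@bv K).

(** These are copies of the data of the bracket over an abstract field, with [c] in the place of 2
    pi i. They are convertible to the originals at R[i], while the arithmetic is done by [field] in
    [K]. *)
Definition at_ (r : int) : FE := - 2%:R *+ (r == 0) + eps ^+ 2 * av r.
Definition bt_ (r : int) : FE := 1 *+ (r == 0) + eps ^+ 2 * bv r.
Definition zexp (n : int) : FE :=
  PSeries (fun k => ((c * n%:~R) ^+ k / k`!%:R)%:A).

Definition br_ba (n m : int) : FE :=
  epsdiv (zsum (fun r => let s := n + m - r in
    bt_ r * at_ s * (zexp (s - m) - 1))).

Definition br (x y : zvar) : FE :=
  match x, y with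
  | inr n, inr m => epsdiv (zsum (fun r => let s := n + m - r in
      bt_ r * bt_ s * (zexp (s - m) - zexp (s - n))))
  | inr n, inl m => br_ba n m
  | inl n, inr m => - br_ba m n
  | inl n, inl m => epsdiv (bt_ (n + m) * (zexp (- m) - zexp (- n)))
  end.

Definition zcoef (n : int) (k : nat) : K := (c * n%:~R) ^+ k / k`!%:R.
Definition zdiff (i j : int) (k : nat) : K := zcoef i k.+1 - zcoef j k.+1.
Definition zquot (i j : int) : FE := epsdiv (zexp i - zexp j).

Lemma zexp0 : zexp 0 = 1.
Proof.
apply: epseriesP => -[|k]; first by change (((c * 0%:~R) ^+ 0 / 0`!%:R)%:A = 1 :> FR);
  rewrite expr0 fact0 divr1 scale1r.
by change (((c * 0%:~R) ^+ k.+1 / k.+1`!%:R)%:A = 0 :> FR); rewrite mulr0 exprS !mul0r scale0r.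
Qed.

Lemma zquotE i j k : zquot i j k = (zdiff i j k)%:A.
Proof. by change ((zcoef i k.+1)%:A - (zcoef j k.+1)%:A = (zdiff i j k)%:A :> FR); rewrite -scalerBl. Qed.

Lemma zquotK i j : eps * zquot i j = zexp i - zexp j.
Proof.
apply: epsdivK; change ((zcoef i 0)%:A - (zcoef j 0)%:A = 0 :> FR).
by rewrite /zcoef !expr0 subrr.
Qed.

Lemma zquot_anti i j : zquot j i = - zquot i j.
Proof.
apply: epseriesP => k; change (zquot j i k = - (zquot i j k)).
by rewrite !zquotE -scaleNr /zdiff opprB.
Qed.

Lemma zquot_const i j k : exists e : K, zquot i j k = e%:A.
Proof. by exists (zdiff i j k); exact: zquotE. Qed.

Lemma nice_zquot i j : nice 0 0 (zquot i j).
Proof. exact: nice_const (zquot_const i j). Qed.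

Lemma zdiff0 i j : zdiff i j 0 = c * (i%:~R - j%:~R).
Proof. by rewrite /zdiff /zcoef !expr1 !divr1 mulrBr. Qed.
Lemma zdiff1 i j : zdiff i j 1 = c ^+ 2 * (i%:~R ^+ 2 - j%:~R ^+ 2) / 2.
Proof. by rewrite /zdiff /zcoef !exprMn -mulrBl -mulrBr. Qed.
Lemma zdiff2 i j : zdiff i j 2 = c ^+ 3 * (i%:~R ^+ 3 - j%:~R ^+ 3) / 6.
Proof. by rewrite /zdiff /zcoef !exprMn -mulrBl -mulrBr. Qed.

Let btE r : bt_ r = 1%:A *+ (r == 0) + eps ^+ 2 * psC (fgen K (inr r)).
Proof. by rewrite /bt_ [1%:A](scale1r (1 : FE)). Qed.

Let atE r : at_ r = (- 2)%:A *+ (r == 0) + eps ^+ 2 * psC (fgen K (inl r)).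
Proof.
by rewrite /at_ scaleNr scaler_nat.
Qed.

Lemma nice_bt r : nice 0 r (bt_ r).
Proof. by rewrite btE; apply: (@nice_delta K 0 1 (fun r => fgen K (inr r))); apply: (niceW _ (nice_bv K r)). Qed.

Lemma nice_at r : nice 0 r (at_ r).
Proof. by rewrite atE; apply: (@nice_delta K 0 (- 2) (fun r => fgen K (inl r))); apply: (niceW _ (nice_av K r)). Qed.

Lemma epsdiv_zsum (A B : int -> FE) (g h : int -> FE) N H :
  (forall r, eps * g r = h r) -> hassum (fun r => A r * B (N - r) * g r) H ->
  epsdiv (zsum (fun r => A r * B (N - r) * h r)) = H.
Proof.
move=> gh hH; have -> : zsum (fun r => A r * B (N - r) * h r) = eps * H.
  apply: zsum_hassum; apply: hassum_ext (hassumM eps hH) => r.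
  by rewrite -gh mulrCA.
exact: epsMK.
Qed.

Lemma br_bb_hassum n m : hassum (fun r =>
  bt_ r * bt_ (n + m - r) * zquot (n + m - r - m) (n + m - r - n)) (br (inr n) (inr m)).
Proof.
have [H hH] := conv_exists 1 1 (fun r => zquotE (n + m - r - m) (n + m - r - n))
  (nice_bv K) (nice_bv K) (n + m).
have {}hH : hassum (fun r => bt_ r * bt_ (n + m - r) *
    zquot (n + m - r - m) (n + m - r - n)) H.
  by apply: hassum_ext hH => r; rewrite !btE.
suff -> : br (inr n) (inr m) = H by [].
exact: (epsdiv_zsum (fun r => zquotK (n + m - r - m) (n + m - r - n)) hH).
Qed.

Lemma br_ba_hassum n m : hassum (fun r =>
  bt_ r * at_ (n + m - r) * zquot (n + m - r - m) 0) (br_ba n m).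
Proof.
have [H hH] := conv_exists 1 (- 2) (fun r => zquotE (n + m - r - m) 0)
  (nice_bv K) (nice_av K) (n + m).
have {}hH : hassum (fun r => bt_ r * at_ (n + m - r) * zquot (n + m - r - m) 0) H.
  by apply: hassum_ext hH => r; rewrite btE atE.
suff -> : br_ba n m = H by [].
have z1 r : eps * zquot (n + m - r - m) 0 = zexp (n + m - r - m) - 1 by rewrite zquotK zexp0.
exact: (epsdiv_zsum z1 hH).
Qed.

Lemma br_aaE n m : br (inl n) (inl m) = bt_ (n + m) * zquot (- m) (- n).
Proof.
have -> : br (inl n) (inl m) = epsdiv (eps * (bt_ (n + m) * zquot (- m) (- n))).
  by rewrite mulrCA zquotK.
exact: epsMK.
Qed.

Lemma nice_br_ba n m : nice 0 (n + m) (br_ba n m).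
Proof.
apply: nice_hassum (br_ba_hassum n m) _ => r.
have := niceM (niceM (nice_bt r) (nice_at (n + m - r))) (nice_zquot (n + m - r - m) 0).
by rewrite addr0 addrC subrK.
Qed.

Lemma br_nice x y : nice 0 (idx x + idx y) (br x y).
Proof.
case: x => n; case: y => m.
- rewrite br_aaE; have := niceM (nice_bt (n + m)) (nice_zquot (- m) (- n)).
  by rewrite addr0.
- by apply: niceN; rewrite [idx _ + _]addrC; exact: nice_br_ba.
- exact: nice_br_ba.
- apply: nice_hassum (br_bb_hassum n m) _ => r.
  have := niceM (niceM (nice_bt r) (nice_bt (n + m - r)))
    (nice_zquot (n + m - r - m) (n + m - r - n)).
  by rewrite addr0 addrC subrK.
Qed.

Lemma br_anti x y : br y x = - br x y.
Proof.
case: x => n; case: y => m; rewrite ?opprK //.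
- by rewrite !br_aaE [m + n]addrC zquot_anti mulrN.
- apply: hassum_uniq (br_bb_hassum m n) _.
  apply: hassum_ext (hassumN (br_bb_hassum n m)) => r.
  by rewrite -mulrN -zquot_anti [m + n]addrC.
Qed.

Local Notation t := (c / 2).
Local Notation d n m := ((n + m == 0)%:R : K).

(** Both at r = 0 and at r = n + m the kernel (Z(s-m) - Z(s-n)) / eps is c (n - m) to lowest order,
    and c = 2 t. The scalars occur only for m = - n, which is substituted in them under the factor
    delta. *)
Lemma co3_bb (n m : int) : co3 (br (inr n) (inr m)) (n + m)
  (d n m * (4 * t * n%:~R)) 0 (d n m * (8 / 3 * t ^+ 3 * n%:~R ^+ 3))
  0 (4 * t * (n%:~R - m%:~R)).
Proof.
have h : hassum (fun r => (1%:A *+ (r == 0) + eps ^+ 2 * psC (fgen K (inr r))) *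
    (1%:A *+ (n + m - r == 0) + eps ^+ 2 * psC (fgen K (inr (n + m - r)))) *
    zquot (n + m - r - m) (n + m - r - n)) (br (inr n) (inr m)).
  by apply: hassum_ext (br_bb_hassum n m) => r; rewrite !btE.
move: (br _ _) h => H h.
have := conv_coefs (al := fun r => fgen K (inr r)) (be := fun r => fgen K (inr r))
  (fun r => zquotE (n + m - r - m) (n + m - r - n)) h.
rewrite !zdiff0 zdiff1 zdiff2 !subr0 subrr !sub0r addrK [n + m - n]addrC addKr !mulrNz.
move=> [h0 h1 h2]; split.
- by rewrite h0; apply: (congr1 (fun z : K => z *: (1 : FR))); apply: dmul_eq => ->; field.
- rewrite h1 -[in RHS](mulr0 (d n m)); apply: (congr1 (fun z : K => z *: (1 : FR))).
  by apply: dmul_eq => ->; field.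
- rewrite h2 scale0r add0r -scalerDl.
  apply: (congr2 (fun z z' : K => z *: (1 : FR) + z' *: fgen K (inr (n + m)))); last by field.
  by apply: dmul_eq => ->; field.
Qed.

Lemma co3_ba (n m : int) : co3 (br (inr n) (inl m)) (n + m)
  (d n m * (- (4 * t * n%:~R))) (d n m * (- (4 * t ^+ 2 * n%:~R ^+ 2)))
  (d n m * (- (8 / 3 * t ^+ 3 * n%:~R ^+ 3)))
  (2 * t * n%:~R) (4 * t * m%:~R).
Proof.
have h : hassum (fun r => (1%:A *+ (r == 0) + eps ^+ 2 * psC (fgen K (inr r))) *
    ((- 2)%:A *+ (n + m - r == 0) + eps ^+ 2 * psC (fgen K (inl (n + m - r)))) *
    zquot (n + m - r - m) 0) (br (inr n) (inl m)).
  by apply: hassum_ext (br_ba_hassum n m) => r; rewrite btE atE.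
move: (br _ _) h => H h.
have := conv_coefs (al := fun r => fgen K (inr r)) (be := fun r => fgen K (inl r))
  (fun r => zquotE (n + m - r - m) 0) h.
rewrite !zdiff0 zdiff1 zdiff2 !subr0 subrr !sub0r addrK !mulrNz.
move=> [h0 h1 h2]; split.
- by rewrite h0; apply: (congr1 (fun z : K => z *: (1 : FR))); apply: dmul_eq => _; rewrite ?mulr0z; field.
- by rewrite h1; apply: (congr1 (fun z : K => z *: (1 : FR))); apply: dmul_eq => _; rewrite ?mulr0z; field.
- rewrite h2; apply: (f_equal3 (fun z z' z'' : K => z *: (1 : FR) + (z' *: fgen K (inl (n + m)) +
    z'' *: fgen K (inr (n + m))))); [|by field|by field].
  by apply: dmul_eq => _; rewrite ?mulr0z; field.
Qed.

Lemma co3_aa (n m : int) : co3 (br (inl n) (inl m)) (n + m)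
  (d n m * (4 * t * n%:~R)) 0 (d n m * (8 / 3 * t ^+ 3 * n%:~R ^+ 3))
  0 (2 * t * (n%:~R - m%:~R)).
Proof.
rewrite br_aaE /bt_ mulrDl -mulrA.
have h1 : co3 (1 *+ (n + m == 0) * zquot (- m) (- n)) (n + m) (d n m * zdiff (- m) (- n) 0)
    (d n m * zdiff (- m) (- n) 1) (d n m * zdiff (- m) (- n) 2) 0 0.
  have h0 : co3 (zquot (- m) (- n)) (n + m) (zdiff (- m) (- n) 0)
      (zdiff (- m) (- n) 1) (zdiff (- m) (- n) 2) 0 0.
    by split; rewrite zquotE // !scale0r !addr0.
  have := co3Z (d n m) h0; rewrite !mulr0 => {}h0.
  by rewrite [X in co3 X]mulr_natl -scaler_nat.
have h2 := co3_eps2 (F := bv (n + m) * zquot (- m) (- n)) (s := n + m)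
  (d := 0) (al := 0) (be := zdiff (- m) (- n) 0).
have {}h2 := co3D h1 (h2 _).
apply: co3_eq (h2 _) _ _ _ _ _.
- by rewrite psCMcoef zquotE -scalerAr mulr1 !scale0r !add0r.
- by rewrite addr0 zdiff0 !mulrNz; apply: dmul_eq => ->; field.
- by rewrite addr0 zdiff1 !mulrNz -[RHS](mulr0 (d n m)); apply: dmul_eq => ->; field.
- by rewrite addr0 zdiff2 !mulrNz; apply: dmul_eq => ->; field.
- by rewrite addr0.
- by rewrite add0r zdiff0 !mulrNz; field.
Qed.

End SecondBracket.

Fact series3M (K : numFieldType) (T : comAlgType K) (x y z : K) (e l : T) :
  (x%:A + y *: e + z *: e ^+ 2) * l = x *: l + (y *: (e * l) + z *: (e ^+ 2 * l)).
Proof. by rewrite !mulrDl mulr_algl -!scalerAl addrA. Qed.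

(** * Brackets with the Fourier coefficients of v - Q *)

Section VirasoroTable.
Variables (K : numFieldType) (c : K).
Local Notation FR := (fourier_ring K).
Local Notation FE := (epseries FR).
Local Notation av := (@av K).
Local Notation bv := (@bv K).
Local Notation pb := (pb (br c)).
Local Notation t := (c / 2).
Local Notation d n m := ((n + m == 0)%:R : K).
Local Notation fa s := (fgen K (inl s)).
Local Notation fb s := (fgen K (inr s)).

Variables (L : int -> FE) (sq : int -> FR).
Hypothesis L_nice : forall m, nice 1 m (L m).
Hypothesis L0 : forall m, L m 0%N = fa m - fb m.
Hypothesis L1 : forall m, L m 1%N = (t * m%:~R) *: fb m.
Hypothesis L2 : forall m, L m 2%N = (- (t ^+ 2 * m%:~R ^+ 2 / 2)) *: fb m + 4^-1 *: sq m.
Hypothesis sq_sum : forall m, hassum (fun r => bv r * bv (m - r)) (psC (sq m)).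

Let br_a := @br_anti K c.
Let br_n := @br_nice K c.

Lemma tame_av n : tame_series (av n). Proof. exact: nice_tame (nice_av K n). Qed.
Lemma tame_bv n : tame_series (bv n). Proof. exact: nice_tame (nice_bv K n). Qed.
Lemma tame_L n : tame_series (L n). Proof. exact: nice_tame (L_nice n). Qed.

Lemma series_decomp3 (F : FE) : F = psC (F 0%N) + (eps * psC (F 1%N) +
  (eps ^+ 2 * psC (F 2%N) + eps ^+ 3 * epsdrop 3 F)).
Proof.
rewrite {1}(psC_eps_decomp F) {1}(psC_eps_decomp (epsdiv F)).
rewrite {1}(psC_eps_decomp (epsdiv (epsdiv F))).
have -> : epsdiv (epsdiv (epsdiv F)) = epsdrop 3 F by apply: epseriesP.
by rewrite !mulrDr !mulrA -!expr2 -exprSr.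
Qed.

Lemma pb_decomp3 x (F : FE) : tame_series x -> pb x F = pb x (psC (F 0%N)) +
  (eps * pb x (psC (F 1%N)) + (eps ^+ 2 * pb x (psC (F 2%N)) + eps ^+ 3 * pb x (epsdrop 3 F))).
Proof.
move=> tx; have lx := pb_epslin br_n tx; have [xD xe] := lx.
rewrite {1}(series_decomp3 F) !xD (epslinX 2 _ lx) (epslinX 3 _ lx).
by rewrite (xe (psC (F 1%N))).
Qed.

Lemma co3_eps2_scalar (F : FE) s d0 d1 d2 al be : co3 F s d0 d1 d2 al be ->
  co3 (eps ^+ 2 * F) s 0 0 d0 0 0.
Proof. by move=> [f0 _ _]; apply: co3_eps2; rewrite f0 !scale0r !addr0. Qed.

(** Expands L_m = a_m - b_m + eps t m b_m + eps^2 (- t^2 m^2 / 2 b_m + 1/4 sum_r b_r b_(m-r)) +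
    O(eps^3). The quadratic term enters only through its bracket at order 0, given by [sg]. *)
Lemma co3_pb_L x m s a0 a1 a2 aa ab b0 b1 b2 ba bb sg : tame_series x ->
  co3 (pb x (av m)) s a0 a1 a2 aa ab -> co3 (pb x (bv m)) s b0 b1 b2 ba bb ->
  pb x (psC (sq m)) 0%N = sg *: fb s ->
  co3 (pb x (L m)) s (a0 - b0) (a1 - b1 + t * m%:~R * b0)
    (a2 - b2 + t * m%:~R * b1 - t ^+ 2 * m%:~R ^+ 2 / 2 * b0)
    (aa - ba) (ab - bb + 4^-1 * sg).
Proof.
move=> tx ha hb hs; have lx := pb_epslin br_n tx; have [xD xe] := lx.
rewrite (pb_decomp3 _ tx) L0 L1 L2.
have e0 : pb x (psC (fa m - fb m)) = pb x (av m) - pb x (bv m).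
  by rewrite (rmorphB (@psC FR)) (epslinB _ _ lx).
have e1 : pb x (psC ((t * m%:~R) *: fb m)) = (t * m%:~R) *: pb x (bv m).
  by rewrite (psCZ (t * m%:~R) (fb m)) (pbZ br_n).
set z := - (t ^+ 2 * m%:~R ^+ 2 / 2).
have e2 : pb x (psC (z *: fb m + 4^-1 *: sq m)) = z *: pb x (bv m) + 4^-1 *: pb x (psC (sq m)).
  have -> : psC (z *: fb m + 4^-1 *: sq m) = z *: bv m + 4^-1 *: psC (sq m).
    rewrite -(psCZ z (fb m)) -(psCZ 4^-1 (sq m)); exact: (rmorphD (@psC FR)).
  by rewrite xD !(pbZ br_n).
rewrite e0 e1 e2 mulrDr.
have hq : co3 (eps ^+ 2 * (4^-1 *: pb x (psC (sq m)))) s 0 0 0 0 (4^-1 * sg).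
  apply: co3_eps2; rewrite !scale0r !add0r -scalerA -hs; exact: erefl.
have := co3D (co3D ha (co3N hb)) (co3D (co3_eps (co3Z (t * m%:~R) hb))
  (co3D (co3D (co3_eps2_scalar (co3Z z hb)) hq) (co3_eps3 (pb x (epsdrop 3 (L m))) s))).
by move/co3_eq; apply; rewrite ?/z; ring.
Qed.

Lemma mulr_algr_coef (e : K) (x y : FR) : x = e%:A -> (x * y = e *: y) * (y * x = e *: y).
Proof. by move=> ->; rewrite [y * _]mulrC mulr_algl. Qed.

Lemma delta_scale (x y : int) (e : K) (v w : FR) : (x = y -> v = w) ->
  ((x == y)%:R * e) *: v = (e *: w) *+ (x == y).
Proof.
move=> h; case: eqP => [/h ->|_]; first by rewrite mul1r mulr1n.
by rewrite mul0r scale0r mulr0n.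
Qed.

(** At order 0 the bracket of [x] with b_r is a scalar supported at r = - j, so b_r b_(m-r)
    contributes at r = - j and at r = j + m, equally. *)
Lemma pb_square0 x j e m : tame_series x ->
  (forall r, pb x (bv r) 0%N = (d j r * e)%:A) ->
  pb x (psC (sq m)) 0%N = (2 * e) *: fb (j + m).
Proof.
move=> tx hx.
have h := pb_hassum_cont br_n tx (sq_sum m).
have -> : 2 * e = e + e by ring.
rewrite scalerDl; apply: (hassum_coef2 (x1 := - j) (x2 := j + m) h) => r.
rewrite (pbM br_n _ _ tx).
have e1 : (pb x (bv r) * bv (m - r)) 0%N = (e *: fb (j + m)) *+ (r == - j).
  rewrite psMcoef0 (mulr_algr_coef _ (hx r)).
  have -> : (j + r == 0) = (r == - j) by lia.
  by apply: delta_scale => ->; congr (fb _); lia.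
have e2 : (bv r * pb x (bv (m - r))) 0%N = (e *: fb (j + m)) *+ (r == j + m).
  rewrite psMcoef0 (mulr_algr_coef _ (hx (m - r))).
  have -> : (j + (m - r) == 0) = (r == j + m) by lia.
  by apply: delta_scale => ->.
by rewrite -e1 -e2.
Qed.

Lemma co3_pb_bb n m : co3 (pb (bv n) (bv m)) (n + m)
  (d n m * (4 * t * n%:~R)) 0 (d n m * (8 / 3 * t ^+ 3 * n%:~R ^+ 3))
  0 (4 * t * (n%:~R - m%:~R)).
Proof.
have -> : pb (bv n) (bv m) = br c (inr n) (inr m) := pb_gen_gen br_n (inr n) (inr m).
exact: co3_bb.
Qed.

Lemma co3_pb_ba n m : co3 (pb (bv n) (av m)) (n + m)
  (d n m * (- (4 * t * n%:~R))) (d n m * (- (4 * t ^+ 2 * n%:~R ^+ 2)))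
  (d n m * (- (8 / 3 * t ^+ 3 * n%:~R ^+ 3))) (2 * t * n%:~R) (4 * t * m%:~R).
Proof.
have -> : pb (bv n) (av m) = br c (inr n) (inl m) := pb_gen_gen br_n (inr n) (inl m).
exact: co3_ba.
Qed.

Lemma co3_pb_aa n m : co3 (pb (av n) (av m)) (n + m)
  (d n m * (4 * t * n%:~R)) 0 (d n m * (8 / 3 * t ^+ 3 * n%:~R ^+ 3))
  0 (2 * t * (n%:~R - m%:~R)).
Proof.
have -> : pb (av n) (av m) = br c (inl n) (inl m) := pb_gen_gen br_n (inl n) (inl m).
exact: co3_aa.
Qed.

Lemma co3_pb_ab n m : co3 (pb (av n) (bv m)) (n + m)
  (d n m * (- (4 * t * n%:~R))) (d n m * (4 * t ^+ 2 * n%:~R ^+ 2))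
  (d n m * (- (8 / 3 * t ^+ 3 * n%:~R ^+ 3))) (- (2 * t * m%:~R)) (- (4 * t * n%:~R)).
Proof.
rewrite (pb_antisym br_a br_n _ (@tame_bv m)).
have := co3N (co3_pb_ba m n); rewrite (addrC m n) => /co3_eq; apply.
- by case: (deltaP K n m) => [->|[-> h]]; rewrite ?h; field.
- by case: (deltaP K n m) => [->|[-> h]]; rewrite ?h; field.
- by case: (deltaP K n m) => [->|[-> h]]; rewrite ?h; field.
- by [].
- by [].
Qed.

Lemma co3_bL n m : co3 (pb (bv n) (L m)) (n + m)
  (d n m * (- (8 * t * n%:~R))) (d n m * (- (8 * t ^+ 2 * n%:~R ^+ 2)))
  (d n m * (- (22 / 3 * t ^+ 3 * n%:~R ^+ 3)))
  (2 * t * n%:~R) (8 * t * m%:~R - 2 * t * n%:~R).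
Proof.
have h0 r : pb (bv n) (bv r) 0%N = (d n r * (4 * t * n%:~R))%:A.
  by have [] := co3_pb_bb n r.
have := co3_pb_L (@tame_bv n) (co3_pb_ba n m) (co3_pb_bb n m) (pb_square0 m (@tame_bv n) h0).
move=> /co3_eq; apply.
- by case: (deltaP K n m) => [->|[-> h]]; rewrite ?h; field.
- by case: (deltaP K n m) => [->|[-> h]]; rewrite ?h; field.
- by case: (deltaP K n m) => [->|[-> h]]; rewrite ?h; field.
- by field.
- by field.
Qed.

Lemma co3_aL n m : co3 (pb (av n) (L m)) (n + m)
  (d n m * (8 * t * n%:~R)) 0 (d n m * (10 / 3 * t ^+ 3 * n%:~R ^+ 3))
  (2 * t * m%:~R) (4 * t * n%:~R - 2 * t * m%:~R).
Proof.
have h0 r : pb (av n) (bv r) 0%N = (d n r * (- (4 * t * n%:~R)))%:A.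
  by have [] := co3_pb_ab n r.
have := co3_pb_L (@tame_av n) (co3_pb_aa n m) (co3_pb_ab n m) (pb_square0 m (@tame_av n) h0).
move=> /co3_eq; apply.
- by case: (deltaP K n m) => [->|[-> h]]; rewrite ?h; field.
- by case: (deltaP K n m) => [->|[-> h]]; rewrite ?h; field.
- by case: (deltaP K n m) => [->|[-> h]]; rewrite ?h; field.
- by field.
- by field.
Qed.

Lemma co3_Lb n m : co3 (pb (L n) (bv m)) (n + m)
  (d n m * (- (8 * t * n%:~R))) (d n m * (8 * t ^+ 2 * n%:~R ^+ 2))
  (d n m * (- (22 / 3 * t ^+ 3 * n%:~R ^+ 3)))
  (- (2 * t * m%:~R)) (2 * t * m%:~R - 8 * t * n%:~R).
Proof.
rewrite (pb_antisym br_a br_n _ (@tame_bv m)).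
have := co3N (co3_bL m n); rewrite (addrC m n) => /co3_eq; apply.
- by case: (deltaP K n m) => [->|[-> h]]; rewrite ?h; field.
- by case: (deltaP K n m) => [->|[-> h]]; rewrite ?h; field.
- by case: (deltaP K n m) => [->|[-> h]]; rewrite ?h; field.
- by [].
- by ring.
Qed.

Lemma co3_La n m : co3 (pb (L n) (av m)) (n + m)
  (d n m * (8 * t * n%:~R)) 0 (d n m * (10 / 3 * t ^+ 3 * n%:~R ^+ 3))
  (- (2 * t * n%:~R)) (2 * t * n%:~R - 4 * t * m%:~R).
Proof.
rewrite (pb_antisym br_a br_n _ (@tame_av m)).
have := co3N (co3_aL m n); rewrite (addrC m n) => /co3_eq; apply.
- by case: (deltaP K n m) => [->|[-> h]]; rewrite ?h; field.
- by rewrite oppr0.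
- by case: (deltaP K n m) => [->|[-> h]]; rewrite ?h; field.
- by [].
- by ring.
Qed.

(** The correction built later divides by the leading scalar, which is nonzero at m = - n for n <>
    0, and gains a factor eps^2 from the absence of a term of order eps. *)
Lemma co3_LL n m : co3 (pb (L n) (L m)) (n + m)
  (d n m * (16 * t * n%:~R)) 0 (d n m * (20 / 3 * t ^+ 3 * n%:~R ^+ 3))
  (- (2 * t * (n%:~R - m%:~R))) (6 * t * (n%:~R - m%:~R)).
Proof.
have h0 r : pb (L n) (bv r) 0%N = (d n r * (- (8 * t * n%:~R)))%:A.
  by have [] := co3_Lb n r.
have := co3_pb_L (@tame_L n) (co3_La n m) (co3_Lb n m) (pb_square0 m (@tame_L n) h0).
move=> /co3_eq; apply.
- by case: (deltaP K n m) => [->|[-> h]]; rewrite ?h; field.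
- by case: (deltaP K n m) => [->|[-> h]]; rewrite ?h; field.
- by case: (deltaP K n m) => [->|[-> h]]; rewrite ?h; field.
- by field.
- by field.
Qed.

End VirasoroTable.

(** * The elements beta_n and the Virasoro relations modulo epsilon^3 *)

Section BetaElements.
Variables (K : numFieldType) (c : K).
Local Notation FR := (fourier_ring K).
Local Notation FE := (epseries FR).
Local Notation av := (@av K).
Local Notation bv := (@bv K).
Local Notation pb := (pb (br c)).
Local Notation t := (c / 2).
Local Notation d n m := ((n + m == 0)%:R : K).
Local Notation fa s := (fgen K (inl s)).
Local Notation fb s := (fgen K (inr s)).

Variables (L : int -> FE) (sq : int -> FR).
Hypothesis L_nice : forall m, nice 1 m (L m).
Hypothesis L0 : forall m, L m 0%N = fa m - fb m.
Hypothesis L1 : forall m, L m 1%N = (t * m%:~R) *: fb m.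
Hypothesis L2 : forall m, L m 2%N = (- (t ^+ 2 * m%:~R ^+ 2 / 2)) *: fb m + 4^-1 *: sq m.
Hypothesis sq_sum : forall m, hassum (fun r => bv r * bv (m - r)) (psC (sq m)).

Let br_a := @br_anti K c.
Let br_n := @br_nice K c.

(** The value 1/4 at n = 0 is forced. For m <> 0 the coefficients of a_m and b_m at order eps^2 in
    the bracket of L_m with [beta 0] are - t m - Y and - 3 t m + 16 t m * coefk 0 (- m) + Y, with Y
    = 8 t m * coefk 0 m. They are opposite exactly when coefk 0 (- m) = 1/4. *)
Definition coefk (n k : int) : K :=
  if n == 0 then 4^-1 else (- (n%:~R / 8) + 3 * k%:~R / 8) / k%:~R.

Definition tail_term (n k : int) : FE :=
  if k == 0 then 0 else coefk n k *: (bv (n - k) * L k).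

Definition tail (n : int) : FE := zsum (tail_term n).

(* For n = 0 this differs from betahat_0 by an element of the ideal, and its
   brackets with the L_m are small. *)
Definition beta (n : int) : FE :=
  (if n == 0 then 2^-1 *: (av 0 + bv 0) else
   bv n + (2^-1%:A + (t * n%:~R / 2) *: eps + (t ^+ 2 * n%:~R ^+ 2 / 4) *: eps ^+ 2) * L n)
  + eps ^+ 2 * tail n.

Lemma nice_tail_term n k : nice 2 n (tail_term n k).
Proof.
rewrite /tail_term; case: eqP => _; first exact: nice0.
by apply: niceZ; have := niceM (nice_bv K (n - k)) (L_nice k); rewrite subrK.
Qed.

Lemma null_conv (u : int -> FE) (v : int -> FE) n D : (forall k, nice D (n - k) (u k)) ->
  null (fun k => u k * v k).
Proof. by move=> hu; apply: nullM; apply: null_int_sub hu. Qed.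

Lemma tail_hassum n : hassum (tail_term n) (tail n).
Proof.
have [H hH] : exists H, hassum (tail_term n) H.
  apply: (nice_hassum_exists _ (nice_tail_term n)).
  have h0 := null_conv (fun k => if k == 0 then 0 else coefk n k *: L k)
    (fun k => nice_bv K (n - k)).
  move=> N k; have [A hA] := h0 N k; exists A => x /hA <-.
  rewrite /tail_term; case: (x == 0); first by rewrite mulr0.
  by rewrite scalerAr.
by rewrite /tail (zsum_hassum hH).
Qed.

Lemma nice_tail n : nice 2 n (tail n).
Proof. exact: nice_hassum (tail_hassum n) (nice_tail_term n). Qed.

Lemma nice_beta n : nice 1 n (beta n).
Proof.
apply: niceD; last first.
  by apply: nice_epsX; apply: (niceW _ (nice_tail n)).
case: eqP => [->|_].
  by apply: niceZ; apply: niceD; [exact: nice_av|exact: nice_bv].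
apply: niceD; first exact: nice_bv.
rewrite series3M; apply: niceD; first exact: niceZ (L_nice n).
apply: niceD; apply: niceZ; last exact: nice_epsXr (L_nice n).
by have := nice_epsXr 1 (L_nice n); rewrite expr1.
Qed.

Lemma tame_beta n : tame_series (beta n).
Proof. exact: nice_tame (nice_beta n). Qed.

Lemma beta_coef0 n : beta n 0%N = 2^-1 *: fa n + 2^-1 *: fb n.
Proof.
have e0 : (eps ^+ 2 * tail n) 0%N = 0 by rewrite epsXMcoef.
change ((if n == 0 then 2^-1 *: (av 0 + bv 0) else
   bv n + (2^-1%:A + (t * n%:~R / 2) *: eps + (t ^+ 2 * n%:~R ^+ 2 / 4) *: eps ^+ 2) * L n) 0%N
  + (eps ^+ 2 * tail n) 0%N = 2^-1 *: fa n + 2^-1 *: fb n).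
rewrite e0 addr0; case: eqP => [->|_]; first exact: scalerDr.
rewrite series3M; set y := t * _ / 2; set z := t ^+ 2 * _ / 4.
change (fb n + (2^-1 *: L n 0%N + (y *: (eps * L n) 0%N + z *: (eps ^+ 2 * L n) 0%N)) =
  2^-1 *: fa n + 2^-1 *: fb n).
rewrite epsMcoef0 epsXMcoef !scaler0 !addr0 L0 scalerBr addrCA; congr (_ + _).
rewrite -[X in X - _]scale1r -scalerBl.
by apply: (congr1 (fun z : K => z *: fb n)); field.
Qed.

(** Among the terms b_(n-k) L_k, to lowest order [x] meets b_(n-k) only at k = j + n and L_k only at
    k = - j. The boolean factors in [X] and [Y] account for the missing index k = 0. *)
Lemma pb_tail0 x j e f n : tame_series x ->
  (forall r, pb x (bv r) 0%N = (d j r * e)%:A) ->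
  (forall r, r != 0 -> pb x (L r) 0%N = (d j r * f)%:A) ->
  let X := (j + n != 0)%:R * coefk n (j + n) * e in
  let Y := (j != 0)%:R * coefk n (- j) * f in
  pb x (tail n) 0%N = X *: fa (j + n) + (Y - X) *: fb (j + n).
Proof.
move=> tx hb hL X Y; have lx := pb_epslin br_n tx.
have -> : X *: fa (j + n) + (Y - X) *: fb (j + n) =
    X *: (fa (j + n) - fb (j + n)) + Y *: fb (j + n).
  exact: esym (comb2_sub _ _ _ _).
have h := pb_hassum_cont br_n tx (tail_hassum n).
apply: (hassum_coef2 (x1 := j + n) (x2 := - j) h) => k.
have [->|k0] := eqVneq k 0.
  rewrite /tail_term eqxx (epslin0 lx) /X /Y [0 == j + n]eq_sym [0 == - j]eq_sym oppr_eq0.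
  case: eqP => _; case: eqP => _; by rewrite ?mul0r ?scale0r ?mulr0n ?addr0.
rewrite /tail_term (negbTE k0) (pbZ br_n _ _ tx) (pbM br_n _ _ tx) scalerDr.
have e1 : (coefk n k *: (pb x (bv (n - k)) * L k)) 0%N =
    (X *: (fa (j + n) - fb (j + n))) *+ (k == j + n).
  change (coefk n k *: (pb x (bv (n - k)) * L k) 0%N =
    (X *: (fa (j + n) - fb (j + n))) *+ (k == j + n)).
  rewrite psMcoef0 (mulr_algr_coef _ (hb (n - k))) L0 scalerA.
  have -> : (j + (n - k) == 0) = (k == j + n) by lia.
  rewrite mulrCA; case: (k =P j + n) => [E|_]; last by rewrite mul0r scale0r mulr0n.
  by rewrite /X -E k0 !mul1r mulr1n.
have e2 : (coefk n k *: (bv (n - k) * pb x (L k))) 0%N = (Y *: fb (j + n)) *+ (k == - j).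
  change (coefk n k *: (bv (n - k) * pb x (L k)) 0%N = (Y *: fb (j + n)) *+ (k == - j)).
  rewrite psMcoef0 (mulr_algr_coef _ (hL k k0)) scalerA.
  have -> : (j + k == 0) = (k == - j) by lia.
  rewrite mulrCA; case: (k =P - j) => [E|_]; last by rewrite mul0r scale0r mulr0n.
  have j0 : j != 0 by move: k0; rewrite E; lia.
  rewrite /Y -E j0 !mul1r mulr1n; have -> : n - k = j + n by rewrite E; lia.
  exact: erefl.
by rewrite -e1 -e2.
Qed.

Lemma co3_pb_beta x n s b0 b1 b2 ba bb l0 l1 l2 la lb ta tb : n != 0 -> tame_series x ->
  co3 (pb x (bv n)) s b0 b1 b2 ba bb -> co3 (pb x (L n)) s l0 l1 l2 la lb ->
  pb x (tail n) 0%N = ta *: fa s + tb *: fb s ->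
  co3 (pb x (beta n)) s (b0 + l0 / 2) (b1 + l1 / 2 + t * n%:~R / 2 * l0)
    (b2 + l2 / 2 + t * n%:~R / 2 * l1 + t ^+ 2 * n%:~R ^+ 2 / 4 * l0)
    (ba + la / 2 + ta) (bb + lb / 2 + tb).
Proof.
move=> n0 tx hb hl ht; have lx := pb_epslin br_n tx; have [xD xe] := lx.
rewrite /beta (negbTE n0) series3M.
set y := t * _ / 2; set z := t ^+ 2 * _ / 4.
have -> : pb x (bv n + (2^-1 *: L n + (y *: (eps * L n) + z *: (eps ^+ 2 * L n))) +
    eps ^+ 2 * tail n) = pb x (bv n) + (2^-1 *: pb x (L n) + (y *: (eps * pb x (L n)) +
    z *: (eps ^+ 2 * pb x (L n)))) + eps ^+ 2 * pb x (tail n).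
  by rewrite !xD !(pbZ br_n _ _ tx) xe !(epslinX 2 _ lx).
have ht' : co3 (eps ^+ 2 * pb x (tail n)) s 0 0 0 ta tb.
  by apply: co3_eps2; rewrite scale0r add0r.
have := co3D (co3D hb (co3D (co3Z 2^-1 hl) (co3D (co3Z y (co3_eps hl))
  (co3Z z (co3_eps2_scalar hl))))) ht'.
by move=> /co3_eq; apply; rewrite ?mulr0; ring.
Qed.

Lemma co3_pb_beta0 x s a0 a1 a2 aa ab b0 b1 b2 ba bb ta tb : tame_series x ->
  co3 (pb x (av 0)) s a0 a1 a2 aa ab -> co3 (pb x (bv 0)) s b0 b1 b2 ba bb ->
  pb x (tail 0) 0%N = ta *: fa s + tb *: fb s ->
  co3 (pb x (beta 0)) s ((a0 + b0) / 2) ((a1 + b1) / 2) ((a2 + b2) / 2)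
    ((aa + ba) / 2 + ta) ((ab + bb) / 2 + tb).
Proof.
move=> tx ha hb ht; have lx := pb_epslin br_n tx; have [xD xe] := lx.
rewrite /beta eqxx xD (pbZ br_n _ _ tx) xD (epslinX 2 _ lx).
have ht' : co3 (eps ^+ 2 * pb x (tail 0)) s 0 0 0 ta tb.
  by apply: co3_eps2; rewrite scale0r add0r.
have := co3D (co3Z 2^-1 (co3D ha hb)) ht'.
by move=> /co3_eq; apply; ring.
Qed.

Let bL := co3_bL L0 L1 L2 sq_sum.
Let LL := co3_LL L_nice L0 L1 L2 sq_sum.
Let Lb := co3_Lb L0 L1 L2 sq_sum.
Let La := co3_La L0 L1 L2 sq_sum.

Lemma tail_L m n : m != 0 -> let X := (m + n != 0)%:R * coefk n (m + n) in
  pb (L m) (tail n) 0%N = (- (8 * t * m%:~R) * X) *: fa (m + n) +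
    (16 * t * m%:~R * coefk n (- m) + 8 * t * m%:~R * X) *: fb (m + n).
Proof.
move=> m0 X.
have h1 r : pb (L m) (bv r) 0%N = (d m r * (- (8 * t * m%:~R)))%:A by have [] := Lb m r.
have h2 r : r != 0 -> pb (L m) (L r) 0%N = (d m r * (16 * t * m%:~R))%:A.
  by have [] := LL m r.
rewrite (pb_tail0 n (tame_L L_nice m) h1 h2) m0 mul1r.
apply: (congr2 (fun z z' : K => z *: fa (m + n) + z' *: fb (m + n))).
  by rewrite mulrC.
by rewrite -/X; ring.
Qed.

Lemma tail_b m n : m != 0 -> let X := (m + n != 0)%:R * coefk n (m + n) in
  pb (bv m) (tail n) 0%N = (4 * t * m%:~R * X) *: fa (m + n) +
    (- (8 * t * m%:~R) * coefk n (- m) - 4 * t * m%:~R * X) *: fb (m + n).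
Proof.
move=> m0 X.
have h1 r : pb (bv m) (bv r) 0%N = (d m r * (4 * t * m%:~R))%:A by have [] := co3_pb_bb c m r.
have h2 r : r != 0 -> pb (bv m) (L r) 0%N = (d m r * (- (8 * t * m%:~R)))%:A.
  by have [] := bL m r.
rewrite (pb_tail0 n (@tame_bv K m) h1 h2) m0 mul1r.
apply: (congr2 (fun z z' : K => z *: fa (m + n) + z' *: fb (m + n))).
  by rewrite mulrC.
by rewrite -/X; ring.
Qed.

Lemma coefk_opp n m : n != 0 -> m != 0 ->
  coefk n (- m) = (n%:~R + 3 * m%:~R) / (8 * m%:~R).
Proof.
move=> n0 m0; rewrite /coefk (negbTE n0) mulrNz; field.
by rewrite intr_eq0.
Qed.

(** The scalars vanish by the choice of the factors of L_n in [beta], and [coefk] makes the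
    coefficients of a_(m+n) and b_(m+n) opposite, so that they form a multiple of the leading term
    of L_(m+n). The multiple must be zero for m + n = 0, as L_0 is not a generator of the ideal. *)
Lemma co3_L_beta m n : m != 0 -> exists2 ka, (m + n = 0 -> ka = 0) &
  co3 (pb (L m) (beta n)) (m + n) 0 0 0 ka (- ka).
Proof.
move=> m0; have mK : m%:~R != 0 :> K by rewrite intr_eq0.
set X := (m + n != 0)%:R * coefk n (m + n).
exists (- (t * (m%:~R + n%:~R)) - 8 * t * m%:~R * X).
  by move=> mn; rewrite -intrD /X mn eqxx mulr0z mulr0n mul0r !mulr0 oppr0 addr0.
have ht := tail_L n m0; rewrite -/X /= in ht.
have [n0|n0] := eqVneq n 0.
  have dE : d m n = 0 by rewrite n0 addr0 (negbTE m0).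
  have XE : X = 4^-1 by rewrite /X n0 addr0 m0 mul1r.
  have cE : coefk n (- m) = 4^-1 by rewrite /coefk n0 eqxx.
  have ha := La m n; have hb := Lb m n; rewrite cE XE in ht; rewrite XE.
  rewrite n0 in ht ha hb dE *.
  have := co3_pb_beta0 (tame_L L_nice m) ha hb ht.
  by move/co3_eq; apply; rewrite ?dE ?mulr0z; field.
have := co3_pb_beta n0 (tame_L L_nice m) (Lb m n) (LL m n) ht.
rewrite (coefk_opp n0 m0).
move/co3_eq; apply.
- by case: (deltaP K m n) => [->|[-> h]]; rewrite ?h; field.
- by case: (deltaP K m n) => [->|[-> h]]; rewrite ?h; field.
- by case: (deltaP K m n) => [->|[-> h]]; rewrite ?h; field.
- by field.
- by field.
Qed.

(** The scalar t^3 m^3 that survives at order eps^2 is the origin of the central term in the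
    Virasoro relations. *)
Lemma co3_b_beta m n : m != 0 -> exists2 la, (m + n = 0 -> la = 0) &
  co3 (pb (bv m) (beta n)) (m + n) 0 0 (d m n * (t ^+ 3 * m%:~R ^+ 3))
    (t * m%:~R + la) (- (t * n%:~R) - la).
Proof.
move=> m0; have mK : m%:~R != 0 :> K by rewrite intr_eq0.
set X := (m + n != 0)%:R * coefk n (m + n).
exists (4 * t * m%:~R * X).
  by move=> mn; rewrite /X mn eqxx mulr0n mul0r mulr0.
have ht := tail_b n m0; rewrite -/X /= in ht.
have [n0|n0] := eqVneq n 0.
  have dE : d m n = 0 by rewrite n0 addr0 (negbTE m0).
  have XE : X = 4^-1 by rewrite /X n0 addr0 m0 mul1r.
  have cE : coefk n (- m) = 4^-1 by rewrite /coefk n0 eqxx.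
  have ha := co3_pb_ba c m n; have hb := co3_pb_bb c m n; rewrite cE XE in ht; rewrite XE.
  rewrite n0 in ht ha hb dE *.
  have := co3_pb_beta0 (@tame_bv K m) ha hb ht.
  by move/co3_eq; apply; rewrite ?dE ?mulr0z; field.
have := co3_pb_beta n0 (@tame_bv K m) (co3_pb_bb c m n) (bL m n) ht.
rewrite (coefk_opp n0 m0).
move/co3_eq; apply.
- by case: (deltaP K m n) => [->|[-> h]]; rewrite ?h; field.
- by case: (deltaP K m n) => [->|[-> h]]; rewrite ?h; field.
- by case: (deltaP K m n) => [->|[-> h]]; rewrite ?h; field.
- by field.
- by field.
Qed.

(** Includes m = 0, so that [pb_tail0] applies to x = beta n, where all b_r occur. *)
Lemma pb_b_beta0 m n : pb (bv m) (beta n) 0%N = 0.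
Proof.
have [m0|m0] := eqVneq m 0; last first.
  by have [la _ [-> _ _]] := co3_b_beta n m0; rewrite scale0r.
have ht : pb (bv m) (tail n) 0%N = 0.
  have h1 r : pb (bv m) (bv r) 0%N = (d m r * 0)%:A.
    by have [-> _ _] := co3_pb_bb c m r; rewrite m0 mulr0z mulr0.
  have h2 r : r != 0 -> pb (bv m) (L r) 0%N = (d m r * 0)%:A.
    by move=> _; have [-> _ _] := bL m r; rewrite m0 mulr0z mulr0 oppr0.
  rewrite (pb_tail0 n (@tame_bv K m) h1 h2) !mulr0 subrr !scale0r.
  exact: addr0.
have ht' : pb (bv m) (tail n) 0%N = 0 *: fa (m + n) + 0 *: fb (m + n).
  by rewrite ht !scale0r addr0.
have [n0|n0] := eqVneq n 0.
  have ha := co3_pb_ba c m n; have hb := co3_pb_bb c m n.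
  rewrite n0 in ht' ha hb *.
  have [-> _ _] := co3_pb_beta0 (@tame_bv K m) ha hb ht'.
  by rewrite m0 mulr0z !(mulr0, oppr0, addr0, mul0r, scale0r).
have [-> _ _] := co3_pb_beta n0 (@tame_bv K m) (co3_pb_bb c m n) (bL m n) ht'.
by rewrite m0 mulr0z !(mulr0, oppr0, addr0, mul0r, scale0r).
Qed.

Lemma pb_L_beta m n : m != 0 -> exists2 ka, (m + n = 0 -> ka = 0) &
  pb (L m) (beta n) = eps ^+ 2 * (ka *: L (m + n)) +
    eps ^+ 3 * epsdrop 3 (pb (L m) (beta n) - eps ^+ 2 * (ka *: L (m + n))).
Proof.
move=> m0; have [ka ka0 h] := co3_L_beta n m0; exists ka => //.
apply: (co3_uniq h); apply: co3_eps2.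
change (ka *: L (m + n) 0%N = 0%:A + (ka *: fa (m + n) + (- ka) *: fb (m + n))).
rewrite L0 scale0r add0r scaleNr; exact: scalerBr.
Qed.

(* [n + m = 0 -> rho = 0] makes the term in [L (n + m)] an element of the ideal. *)
Definition virasoro_mod (n m : int) : Prop := exists rho z,
  (n + m = 0 -> rho = 0) /\ pb (beta n) (beta m) = eps ^+ 2 *
    ((t * (n%:~R - m%:~R)) *: beta (n + m) + ((d n m * (t ^+ 3 * n%:~R ^+ 3))%:A
      + rho *: L (n + m))) + eps ^+ 3 * z.

(** Expand the second argument. The bracket of beta_n with L_m is already of order eps^2, so the
    factors eps and eps^2 of L_m drop out modulo eps^3, and so does the tail; what is left is {
    beta_n, b_m } + 1/2 { beta_n, L_m }. *)
Lemma virasoro_nonzero n m : m != 0 -> virasoro_mod n m.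
Proof.
move=> m0; have [la la0 hla] := co3_b_beta n m0; have [ka ka0 hka] := co3_L_beta n m0.
have tb := tame_beta n.
have hb : co3 (pb (beta n) (bv m)) (m + n) 0 0 (d m n * - (t ^+ 3 * m%:~R ^+ 3))
    (- (t * m%:~R + la)) (- (- (t * n%:~R) - la)).
  rewrite (pb_antisym br_a br_n _ (@tame_bv K m)).
  by have := co3N hla; rewrite oppr0 mulrN.
have hl : co3 (pb (beta n) (L m)) (m + n) 0 0 0 (- ka) (- - ka).
  rewrite (pb_antisym br_a br_n _ (tame_L L_nice m)).
  by have := co3N hka; rewrite oppr0.
have ht : pb (beta n) (tail m) 0%N = 0 *: fa (m + n) + 0 *: fb (m + n).
  have h1 r : pb (beta n) (bv r) 0%N = (d n r * 0)%:A.
    rewrite (pb_antisym br_a br_n _ (@tame_bv K r)) mulr0 scale0r.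
    by change (- (pb (bv r) (beta n) 0%N) = 0); rewrite pb_b_beta0 oppr0.
  have h2 r : r != 0 -> pb (beta n) (L r) 0%N = (d n r * 0)%:A.
    move=> r0; have [k _ [h _ _]] := co3_L_beta n r0.
    rewrite (pb_antisym br_a br_n _ (tame_L L_nice r)) mulr0 scale0r.
    by change (- (pb (L r) (beta n) 0%N) = 0); rewrite h scale0r oppr0.
  by rewrite (pb_tail0 m tb h1 h2) !mulr0 subrr !scale0r.
have := co3_pb_beta m0 tb hb hl ht.
(* [rho] results from decomposing the part of order eps^2 along (a + b) / 2 and a - b, the leading
   terms of [beta (n + m)] and of L_(n+m). *)
pose Lam := la + ka / 2; pose rho := - (t * (m%:~R + n%:~R) / 2) - Lam.
have rho0 : n + m = 0 -> rho = 0.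
  rewrite addrC => mn; rewrite /rho /Lam la0 // ka0 // -intrD mn mulr0z.
  by rewrite !(mulr0, mul0r, addr0, oppr0).
move=> h; exists rho; eexists; split; first exact: rho0.
apply: (@co3_uniq _ _ _ (m + n) 0 0 (d m n * - (t ^+ 3 * m%:~R ^+ 3))
  (- (t * m%:~R) - Lam) (t * n%:~R + Lam)).
  by apply: co3_eq h _ _ _ _ _; rewrite /Lam; field.
apply: co3_eps2; rewrite (addrC n m); set y := t * (_ - _); set e := d m n * (t ^+ 3 * n%:~R ^+ 3).
change (y *: beta (m + n) 0%N + (e%:A + rho *: L (m + n) 0%N) =
  (d m n * - (t ^+ 3 * m%:~R ^+ 3))%:A + ((- (t * m%:~R) - Lam) *: fa (m + n) +
   (t * n%:~R + Lam) *: fb (m + n))).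
rewrite beta_coef0 L0.
have -> : e = d m n * - (t ^+ 3 * m%:~R ^+ 3).
  by rewrite /e; case: (deltaP K m n) => [->|[-> h']]; rewrite ?h'; field.
have -> : - (t * m%:~R) - Lam = y / 2 + rho by rewrite /y /rho; field.
have -> : t * n%:~R + Lam = y / 2 - rho by rewrite /y /rho; field.
exact: virasoro_comb.
Qed.

(** [beta 0] has a shape of its own, so the expansion of the second argument requires m <> 0.
    Antisymmetry exchanges the arguments when only n <> 0, and settles n = m = 0 directly. *)
Lemma virasoro_beta n m : virasoro_mod n m.
Proof.
have [m0|m0] := eqVneq m 0; last exact: virasoro_nonzero.
have [n0|n0] := eqVneq n 0.
  exists 0, 0; split=> //.
  have -> : pb (beta n) (beta m) = 0.
    rewrite m0 n0; have := pb_antisym br_a br_n (beta 0) (@tame_beta 0).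
    move: (pb _ _) => B hB; apply: epseriesP => k; apply: self_opp0.
    exact: (congr1 (fun F : FE => F k) hB).
  rewrite n0 m0 subrr mulr0 !scale0r mulr0z expr0n !mulr0 scale0r !addr0 !mulr0.
  by [].
have [rho [z [rho0 hz]]] := virasoro_nonzero m n0.
exists (- rho), (- z); split=> [nm|]; first by rewrite rho0 ?oppr0 // addrC.
have -> : pb (beta n) (beta m) = - pb (beta m) (beta n).
  exact: (pb_antisym br_a br_n _ (tame_beta m)).
rewrite hz (addrC m n) opprD -mulrN -mulrN; congr (eps ^+ 2 * _ + _).
have -> : d n m = 0 by rewrite m0 addr0 (negbTE n0).
rewrite !mul0r !scale0r !add0r opprD -!scaleNr -mulrN opprB.
exact: erefl.
Qed.

End BetaElements.

(** * Good extensions *)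

Fact bracket_rearrange (A : comNzRingType) (u e2 e3 a a' b r v w : A) :
  u - (e2 * (a + (b + r)) + e3 * v + e3 * w) + e2 * (r - (a' - a)) =
  u - e2 * (a' + b) - e3 * (v + w).
Proof. by ring. Qed.

Fact neg_rearrange (A : comNzRingType) (x y z w v a b e : A) :
  x = y + e * a -> y = - z -> z = w + e * b -> v = - w -> x = v + e * (a - b).
Proof. by move=> -> -> -> ->; ring. Qed.

Section ClosedIdeals.
Variables (K : comNzRingType) (S : set (epseries (fourier_ring K))).
Local Notation FR := (fourier_ring K).
Local Notation FE := (epseries FR).
Implicit Types F G H : FE.

Lemma fnbhdM N n F G : fnbhd N n F -> fnbhd N n (G * F).
Proof.
move=> hF k kn; change (ev N k (G * F) = 0); rewrite evM big1 // => i _.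
by rewrite [ev N (k - i) F]hF ?mulr0 //; apply: leq_ltn_trans kn; rewrite leq_subr.
Qed.

Lemma fnbhdN N n F : fnbhd N n F -> fnbhd N n (- F).
Proof. by move=> hF k kn; change (- fseq (F k) N = 0); rewrite hF // oppr0. Qed.

Lemma fnbhd_eps N n F : fnbhd N n (eps ^+ n * F).
Proof. by move=> k kn; change (ev N k (eps ^+ n * F) = 0); rewrite ev_epsX kn. Qed.

Lemma closure_fnbhd (A : set FE) F :
  closure A F <-> forall N n, exists2 G, A G & fnbhd N n (F - G).
Proof.
split=> [h N n|h B [N [n hB]]].
  have [] := h [set G | fnbhd N n (G - F)]; first by exists N, n.
  by move=> G [AG hG]; exists G => //; rewrite -opprB; apply: fnbhdN.
have [G AG hG] := h N n; exists G; split=> //; apply: hB.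
by rewrite -opprB; apply: fnbhdN.
Qed.

Definition clideal : set FE := closure (ideal_gen S).

Lemma clideal_mem F : S F -> clideal F.
Proof. by move=> SF; apply: subset_closure; apply: ideal_gen_mem. Qed.

Lemma clideal_closed F :
  (forall N n, exists2 G, clideal G & fnbhd N n (F - G)) -> clideal F.
Proof.
move=> h; apply/closure_fnbhd => N n; have [G /closure_fnbhd/(_ N n)[H SH GH] FG] := h N n.
by exists H => //; have := fnbhdD FG GH; rewrite addrA subrK.
Qed.

Lemma clideal0 : clideal 0.
Proof. by apply: subset_closure; apply: ideal_gen0. Qed.

Lemma clidealD F G : clideal F -> clideal G -> clideal (F + G).
Proof.
move=> /closure_fnbhd hF /closure_fnbhd hG; apply/closure_fnbhd => N n.
have [F' SF FF] := hF N n; have [G' SG GG] := hG N n.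
exists (F' + G'); first exact: ideal_genD.
by have := fnbhdD FF GG; rewrite addrACA -opprD.
Qed.

Lemma clidealM F G : clideal G -> clideal (F * G).
Proof.
move=> /closure_fnbhd hG; apply/closure_fnbhd => N n.
have [G' SG GG] := hG N n; exists (F * G'); first exact: ideal_genM.
by rewrite -mulrBr; apply: fnbhdM.
Qed.

Lemma clidealN F : clideal F -> clideal (- F).
Proof. by move=> hF; rewrite -mulN1r; apply: clidealM. Qed.

Lemma clidealB F G : clideal F -> clideal G -> clideal (F - G).
Proof. by move=> hF /clidealN; apply: clidealD. Qed.

Lemma clidealZ (e : K) F : clideal F -> clideal (e *: F).
Proof. by move=> hF; rewrite -mulr_algl; apply: clidealM. Qed.

Lemma clideal_trans F G H : clideal (F - G) -> clideal (G - H) -> clideal (F - H).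
Proof. by move=> hF /(clidealD hF); rewrite addrA subrK. Qed.

Lemma clideal_subl F G H : clideal (F - H) -> clideal (G - H) -> clideal (F - G).
Proof. by move=> hF hG; have := clidealB hF hG; rewrite opprB addrA subrK. Qed.

Lemma clideal_sum (T : Type) (r : seq T) (u : T -> FE) :
  (forall x, clideal (u x)) -> clideal (\sum_(x <- r) u x).
Proof. by move=> hu; apply: big_ind => //; [exact: clideal0|exact: clidealD]. Qed.

Lemma clideal_hassum (T : choiceType) (u : T -> FE) H :
  hassum u H -> (forall x, clideal (u x)) -> clideal H.
Proof.
move=> uH hu; apply: clideal_closed => N n; have [A [_ hA]] := hassum_fnbhd N n uH.
exists (\sum_(x <- A) u x); first exact: clideal_sum.
by rewrite -opprB; apply: fnbhdN; apply: hA.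
Qed.

(** Good extensions are defined by a condition modulo every eps^n; since the ideal is closed, the
    condition amounts to membership. *)
Lemma clideal_mod_eps F : (forall n, (0 < n)%N -> mod_eps clideal n F) -> clideal F.
Proof.
move=> h; apply: clideal_closed => N n; have [y [z [Iy ->]]] := h n.+1 isT.
exists y => //; rewrite addrAC subrr add0r.
by apply: fnbhdW (fnbhd_eps N (n := n.+1) z).
Qed.

Lemma clideal_stable (f : FE -> FE) : (forall F G, f (F + G) = f F + f G) ->
  (forall N n, exists N', forall G, fnbhd N' n G -> fnbhd N n (f G)) ->
  (forall F G, S G -> clideal (f (F * G))) -> forall F, clideal F -> clideal (f F).
Proof.
move=> fD fc fS F /closure_fnbhd hF; apply: clideal_closed => N n.
have [N' hN'] := fc N n; have [G SG FG] := hF N' n.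
have f0 : f 0 = 0 by apply: (addrI (f 0)); rewrite -fD !addr0.
have fN x : f (- x) = - f x by apply/eqP; rewrite -addr_eq0 -fD addNr f0.
exists (f G); last by rewrite -fN -fD; apply: hN'.
have [s [hs ->]] := SG.
rewrite (big_morph f fD f0) big_seq; apply: big_ind; first exact: clideal0.
  exact: clidealD.
by move=> p ps; apply: fS; apply: hs.
Qed.

End ClosedIdeals.

(** * Correction terms and independence of the extension *)

Section GoodExtensions.
Variables (K : numFieldType) (c : K).
Hypothesis c0 : c != 0.
Local Notation FR := (fourier_ring K).
Local Notation FE := (epseries FR).
Local Notation bv := (@bv K).
Local Notation pb := (pb (br c)).
Local Notation t := (c / 2).
Local Notation d n m := ((n + m == 0)%:R : K).
Local Notation fa s := (fgen K (inl s)).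
Local Notation fb s := (fgen K (inr s)).

Variables (L : int -> FE) (sq : int -> FR).
Hypothesis L_nice : forall m, nice 1 m (L m).
Hypothesis L0 : forall m, L m 0%N = fa m - fb m.
Hypothesis L1 : forall m, L m 1%N = (t * m%:~R) *: fb m.
Hypothesis L2 : forall m, L m 2%N = (- (t ^+ 2 * m%:~R ^+ 2 / 2)) *: fb m + 4^-1 *: sq m.
Hypothesis sq_sum : forall m, hassum (fun r => bv r * bv (m - r)) (psC (sq m)).
Variable X : FE.
Hypothesis casimir : forall F, tame_series F -> pb F X = 0.

Let br_a := @br_anti K c.
Let br_n := @br_nice K c.
Local Notation I := (clideal ([set X] `|` [set L q | q in [set q | q != 0]])).
Local Notation beta := (beta c L).
Let tL := tame_L L_nice.

Lemma clideal_L q : q != 0 -> I (L q).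
Proof. by move=> q0; apply: clideal_mem; right; exists q. Qed.

Section Correction.
Variable n : int.

(** The condition on [q] is kept under the existential so that [choice] yields a function of all
    integers. *)
Let defect_exists q : exists z : FE, q != 0 ->
  nice 3 (q + n) z /\ I (pb (L q) (beta n) - eps ^+ 3 * z).
Proof.
have [->|q0] := eqVneq q 0; first by exists 0.
have [ka ka0 h] := pb_L_beta L_nice L0 L1 L2 sq_sum n q0.
exists (epsdrop 3 (pb (L q) (beta n) - eps ^+ 2 * (ka *: L (q + n)))) => _; split.
  rewrite -[3%N]add0n; apply: nice_epsdrop; apply: niceB.
    exact: (nice_pb br_n (L_nice q) (nice_beta c L_nice n)).
  by apply: nice_epsX; apply: niceZ; apply: (niceW _ (L_nice (q + n))).
rewrite [X in I (X - _)]h addrK; apply: clidealM.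
have [qn|qn] := eqVneq (q + n) 0; first by rewrite ka0 // scale0r; exact: clideal0.
by apply: clidealZ; apply: clideal_L.
Qed.

(** The part of { L_q, L_k } beyond its leading scalar, divided by eps^2. The index k = 0 is
    excluded because the correction must not contain L_0. *)
Let g q k : FE := if k == 0 then 0 else
  epsdrop 2 (pb (L q) (L k) - (d q k * (16 * t * q%:~R))%:A).

Let nice_g q k : nice 2 (q + k) (g q k).
Proof.
rewrite /g; case: eqP => _; first exact: nice0.
rewrite -[2%N]add0n; apply: nice_epsdrop; apply: niceB.
  exact: (nice_pb br_n (L_nice q) (L_nice k)).
case: eqP => [->|_]; first exact: nice_scalar.
by rewrite mul0r scale0r; exact: nice0.
Qed.

Let gK q k : k != 0 -> pb (L q) (L k) = (d q k * (16 * t * q%:~R))%:A + eps ^+ 2 * g q k.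
Proof.
move=> k0; rewrite /g (negbTE k0) -epsdropK ?subrKC //.
have [h0 h1 _] := co3_LL L_nice L0 L1 L2 sq_sum q k.
case=> [|[|//]] _.
  change (pb (L q) (L k) 0%N - (d q k * (16 * t * q%:~R))%:A = 0).
  by rewrite h0 subrr.
change (pb (L q) (L k) 1%N - (d q k * (16 * t * q%:~R)) *: 0 = 0).
by rewrite h1 scale0r scaler0 subrr.
Qed.

Let P (u : int -> FE) := forall j, nice 3 (n - j) (u j).
Let Sg (u : int -> FE) q := zsum (fun k => u k * g q k).

Let nice_Sg_term u q : P u -> forall k, nice 5 (n + q) (u k * g q k).
Proof.
move=> hu k; have := niceM (hu k) (nice_g q k).
by have -> : n - k + (q + k) = n + q by lia.
Qed.

Let Sg_hassum u q : P u -> hassum (fun k => u k * g q k) (Sg u q).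
Proof.
move=> hu; have [H hH] := nice_hassum_exists (null_conv (g q) hu) (nice_Sg_term q hu).
by rewrite /Sg (zsum_hassum hH).
Qed.

(** Look for W = sum_k mu_k L_k. The terms { L_q, mu_k } L_k lie in the ideal, so that it suffices
    to solve 16 t q mu_(-q) + eps^2 sum_k mu_k g_(q,k) = - z_q, where eps^3 z_q is the defect of
    beta_n. *)
Lemma correction_exists : exists W : FE, [/\ I W, nice 4 n W &
  forall q, q != 0 -> I (pb (L q) (beta n + eps ^+ 3 * W))].
Proof.
have [z hz] := choice defect_exists.
(* The equation for q = - j, solved for mu_j; the factor eps^2 makes the right-hand side
   contracting. *)
pose Gop (u : int -> FE) j : FE := if j == 0 then 0 else
  (- (16 * t * (- j)%:~R)^-1) *: (z (- j) + eps ^+ 2 * Sg u (- j)).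
have [mu [Pmu Gmu]] : exists u, P u /\ forall j, Gop u j = u j.
  apply: epseries_fixpoint => [j|u hu j|u v m hu hv uv j k km|s hs j].
  - exact: nice0.
  - rewrite /Gop; case: eqP => [_|/eqP j0]; first exact: nice0.
    have j0' : - j != 0 by rewrite oppr_eq0.
    apply: niceZ; apply: niceD; first by rewrite addrC; exact: (hz _ j0').1.
    (* The sum has degree excess 5 = 3 + 2, and the factor eps^2 brings it back to 3, so that [P] is
       preserved by the iteration. *)
    by apply: nice_epsX; exact: nice_hassum (Sg_hassum _ hu) (nice_Sg_term _ hu).
  - have key (e : K) (A B C : FE) : B k = C k -> (e *: (A + B)) k = (e *: (A + C)) k.
      by move=> BC; change (e *: (A k + B k) = e *: (A k + C k)); rewrite BC.
    rewrite /Gop; case: (j == 0); first exact: erefl.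
    set q := - j; apply: key; rewrite !epsXMcoef; case: ltnP => [_|k2]; first exact: erefl.
    apply: fseq_inj => N; change (ev N (k - 2)%N (Sg u q) = ev N (k - 2)%N (Sg v q)).
    apply: (fsumto_uniq (Sg_hassum q hu N (k - 2)%N)).
    apply: fsumto_ext (Sg_hassum q hv N (k - 2)%N) => x.
    rewrite !evM; apply: eq_bigr => i _; congr (_ * _).
    by rewrite /ev uv //; have := ltn_ord i; lia.
  - by split=> N k m' hm; exact: (nice_within (hs k.+1 j) hm).
pose L' k : FE := if k == 0 then 0 else L k.
have nL' k : nice 1 k (L' k).
  by rewrite /L'; case: eqP => [->|_]; [exact: nice0|exact: L_nice].
have nW k : nice 4 n (mu k * L' k) by have := niceM (Pmu k) (nL' k); rewrite subrK.
have [W hW] := nice_hassum_exists (null_conv L' Pmu) nW.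
have IL' k : I (L' k).
  by rewrite /L'; case: eqP => [_|/eqP k0]; [exact: clideal0|exact: clideal_L].
exists W; split.
- by apply: clideal_hassum hW _ => k; apply: clidealM.
- exact: nice_hassum hW nW.
move=> q q0; have lq := pb_epslin br_n (tL q); have [qD _] := lq.
have [_ hzq] := hz q q0.
have h1 := pb_hassum_cont br_n (tL q) hW.
pose s := 16 * t * q%:~R.
have h2 : hassum (fun k => mu k * pb (L q) (L' k)) (s *: mu (- q) + eps ^+ 2 * Sg mu q).
  have e1 := hassum_single (u := fun k : int => if k == - q then s *: mu (- q) else 0) (x0 := - q).
  rewrite eqxx in e1; have {}e1 := e1 (fun x => ifN_eq _ _).
  apply: hassum_ext (hassumD e1 (hassumM (eps ^+ 2) (Sg_hassum q Pmu))) => k.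
  rewrite /L'; case: (eqVneq k 0) => [->|k0].
    have -> : g q 0 = 0 by rewrite /g; case: eqP.
    rewrite (epslin0 lq) [mu 0 * 0]mulr0 mulr0 addr0 eq_sym oppr_eq0 (negbTE q0).
    exact: erefl.
  rewrite (gK q k0) mulrDr mulrCA -/s; apply: (congr2 +%R) (erefl _).
  have -> : (q + k == 0) = (k == - q) by lia.
  case: (k =P - q) => [->|_]; first by rewrite mul1r mulr_algr.
  by rewrite mul0r scale0r mulr0.
have smu : s *: mu (- q) + eps ^+ 2 * Sg mu q = - z q.
  have := Gmu (- q); rewrite /Gop oppr_eq0 (negbTE q0) opprK -/s => <-.
  rewrite scalerA mulrN mulfV ?scaleN1r ?opprD ?subrK //.
  by rewrite !mulf_neq0 ?intr_eq0 ?invr_eq0 ?pnatr_eq0.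
rewrite smu in h2.
have h3 : I (pb (L q) W - - z q).
  apply: clideal_hassum (hassumB h1 h2) _ => k.
  by rewrite (pbM br_n _ _ (tL q)) addrK; apply: clidealM.
rewrite qD (epslinX 3 _ lq) -[pb (L q) (beta n)](subrK (eps ^+ 3 * z q)) -addrA -mulrDr.
apply: clidealD; first exact: hzq.
by apply: clidealM; rewrite addrC -[z q]opprK.
Qed.

End Correction.

Definition good (x p : FE) : Prop := I (p - x) /\
  forall q, q != 0 -> forall n, (0 < n)%N -> mod_eps I n (pb (L q) p).

Lemma good_L x p q : good x p -> q != 0 -> I (pb (L q) p).
Proof. by move=> [_ h] /h; apply: clideal_mod_eps. Qed.

(* This is where the Casimir property of X is used. *)
Lemma good_stable x p i : good x p -> tame_series p -> I i -> I (pb p i).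
Proof.
move=> gp tp; have [pD _] := pb_epslin br_n tp.
apply: clideal_stable => // [N m|F G].
  by have [N' _ hN'] := pb_continuous br_n N m tp; exists N'.
move=> SG; have IG : I G by apply: clideal_mem.
rewrite (pbM br_n _ _ tp); apply: clidealD; first exact: clidealM.
apply: clidealM; case: SG => [->|[q q0 <-]]; first by rewrite casimir //; exact: clideal0.
rewrite (pb_antisym br_a br_n _ (tL q)); apply: clidealN; exact: good_L gp q0.
Qed.

Variable betah : int -> FE.
Hypothesis betahE : forall n, I (betah n - beta n).

Lemma good_beta n : exists p W, [/\ good (betah n) p, tame_series p & p = beta n + eps ^+ 3 * W].
Proof.
have [W [IW nW hW]] := correction_exists n.
exists (beta n + eps ^+ 3 * W), W; split=> //; last first.
  apply: (nice_tame (D := 4) (c := n)); apply: niceD.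
    by apply: (niceW _ (nice_beta c L_nice n)).
  by apply: nice_epsXr.
split; last by move=> q q0 m _; exists (pb (L q) (beta n + eps ^+ 3 * W)), 0;
  rewrite mulr0 addr0; split=> //; exact: hW.
rewrite addrAC -opprB; apply: clidealD; last exact: clidealM.
by apply: clidealN.
Qed.

(** The arguments are exchanged one at a time, through { p, q' }, because each exchange needs the
    argument that stays to be tame, and [q] need not be. *)
Lemma good_bracket_tame x y p q p' q' : tame_series p -> good x p -> good y q ->
  tame_series p' -> tame_series q' -> good x p' -> good y q' -> I (pb p q - pb p' q').
Proof.
move=> tp gp gq tp' tq' gp' gq'.
have stab u v v' w z : good u w -> tame_series w -> good z v -> good z v' ->
    I (pb w v - pb w v').
  move=> gw tw [gv _] [gv' _]; rewrite -(epslinB _ _ (pb_epslin br_n tw)).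
  by apply: (good_stable gw tw); apply: clideal_subl gv gv'.
apply: (clideal_trans (stab _ _ _ _ _ gp tp gq gq')).
rewrite (pb_antisym br_a br_n _ tq') [pb p' q'](pb_antisym br_a br_n _ tq').
rewrite -opprD; apply: clidealN; exact: stab gq' tq' gp gp'.
Qed.

Lemma pb_add_eps3 F G H : tame_series F ->
  pb F (G + eps ^+ 3 * H) = pb F G + eps ^+ 3 * pb F H.
Proof.
move=> tF; have lF := pb_epslin br_n tF; have [FD _] := lF.
by rewrite FD (epslinX 3 _ lF).
Qed.

Lemma good_bracket n m p q h : good (betah n) p -> good (betah m) q ->
  tame_series p \/ tame_series q -> I (h - pb p q) ->
  mod_eps I 3 (h - eps ^+ 2 * ((t * (n%:~R - m%:~R)) *: betah (n + m)
    + (d n m * (t ^+ 3 * n%:~R ^+ 3))%:A)).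
Proof.
move=> gp gq tpq hh.
have [pn [Wn [gpn tpn pnE]]] := good_beta n; have [pm [Wm [gpm tpm pmE]]] := good_beta m.
have {hh} hh : I (h - pb pn pm).
  apply: (clideal_trans hh); case: tpq => [tp|tq].
    exact: good_bracket_tame gp gq tpn tpm gpn gpm.
  rewrite (pb_antisym br_a br_n _ tq) [pb pn pm](pb_antisym br_a br_n _ tpm) -opprD.
  by apply: clidealN; exact: good_bracket_tame gq gp tpm tpn gpm gpn.
have tbm := tame_beta c L_nice m.
have [y hy] : exists y, pb pn pm = pb (beta n) (beta m) + eps ^+ 3 * y.
  have e1 := pb_add_eps3 (beta m) Wm tpn; rewrite -pmE in e1.
  have e2 := pb_add_eps3 (beta n) Wn tbm; rewrite -pnE in e2.
  exists (pb pn Wm - pb (beta m) Wn).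
  exact: (neg_rearrange e1 (pb_antisym br_a br_n pn tbm) e2
    (pb_antisym br_a br_n (beta n) tbm)).
have [rho [z [rho0 vE]]] := virasoro_beta L_nice L0 L1 L2 sq_sum n m.
rewrite hy vE in hh; move: hh.
set yy := t * _; set e := d n m * _; set s := n + m in rho0 *.
move=> hh; exists (h - eps ^+ 2 * (yy *: betah s + e%:A) - eps ^+ 3 * (z + y)), (z + y).
split; last by rewrite subrK.
have Ir : I (rho *: L s).
  have [s0|s0] := eqVneq s 0; first by rewrite rho0 // scale0r; exact: clideal0.
  by apply: clidealZ; apply: clideal_L.
have Ib : I (eps ^+ 2 * (rho *: L s - yy *: (betah s - beta s))).
  have I1 : I (yy *: (betah s - beta s)) by apply: clidealZ; exact: betahE.
  have I2 := clidealB Ir I1; apply: clidealM; exact: I2.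
have := clidealD hh Ib; move: (h) (z) (y) => u v w.
suff -> : u - (eps ^+ 2 * (yy *: beta s + (e%:A + rho *: L s)) + eps ^+ 3 * v + eps ^+ 3 * w) +
    eps ^+ 2 * (rho *: L s - yy *: (betah s - beta s)) =
    u - eps ^+ 2 * (yy *: betah s + e%:A) - eps ^+ 3 * (v + w) by [].
rewrite scalerBr; exact: bracket_rearrange.
Qed.

End GoodExtensions.

(** * The Casimir *)

Section SummationTools.
Variable K : comNzRingType.
Local Notation FE := (epseries (fourier_ring K)).

Lemma hassum_inj (T T' : choiceType) (g : T' -> T) (u : T -> FE) H : injective g ->
  (forall x, (forall y, x <> g y) -> u x = 0) -> hassum (u \o g) H -> hassum u H.
Proof.
move=> gI u0 h N k; have [A [uA <-]] := h N k.
exists [fset g y | y in A]%fset; split=> [x xA|].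
  have [[y xy]|nx] := pselect (exists y, x = g y).
    rewrite xy; apply: uA; apply: contra xA => yA; apply/imfsetP; exists y => //.
  by rewrite u0 ?raddf0 // => y xy; apply: nx; exists y.
by rewrite big_imfset //= => y y' _ _ /gI.
Qed.

Lemma fder_hassum (T : choiceType) (u : T -> FE) H x :
  hassum u H -> hassum (fun i => fderE x (u i)) (fderE x H).
Proof.
move=> h N k; set M := (N + `|idx x|.+1)%N.
have [xM NM] : (`|idx x| < M)%N /\ (N <= M)%N by rewrite /M; split; lia.
have [A [uA uH]] := h M k; exists A; split=> [i /uA ui|].
  by rewrite (ev_fderE _ _ NM xM) ui pder0 raddf0.
rewrite (ev_fderE _ _ NM xM) -uH pder_sum raddf_sum /=.
by apply: eq_bigr => i _; rewrite (ev_fderE _ _ NM xM).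
Qed.

Lemma null_le (T : choiceType) (u : T -> FE) N k : null u ->
  exists A : {fset T}, forall x, x \notin A -> forall i, (i <= k)%N -> ev N i (u x) = 0.
Proof.
move=> u0; elim: k => [|k [A hA]].
  by have [A hA] := u0 N 0%N; exists A => x xA i; rewrite leqn0 => /eqP ->; apply: hA.
have [B hB] := u0 N k.+1; exists (A `|` B)%fset => x.
rewrite in_fsetU negb_or => /andP[xA xB] i; rewrite leq_eqVlt.
by case/orP => [/eqP ->|]; [apply: hB|apply: hA].
Qed.

Lemma null_pair (T T' : choiceType) (u : T -> FE) (v : T' -> FE) (w : T * T' -> FE) :
  null u -> null v -> null (fun p => u p.1 * v p.2 * w p).
Proof.
move=> u0 v0 N k; have [A hA] := null_le N k u0; have [B hB] := null_le N k v0.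
exists [fset p in [seq (x, y) | x <- A, y <- B]]%fset => -[x y] /= xyAB.
have : (x \notin A) || (y \notin B).
  rewrite -negb_and; apply: contra xyAB => /andP[xA yB]; apply/imfsetP; exists (x, y) => //.
  by apply/allpairsP; exists (x, y).
rewrite evM => xy; rewrite big1 // => i _; rewrite evM big1 ?mul0r // => j _.
have ik : (i <= k)%N by rewrite -ltnS.
have ji : (j <= i)%N by rewrite -ltnS.
case/orP: xy => [/hA|/hB] h; first by rewrite h ?mul0r // (leq_trans ji).
by rewrite h ?mulr0 // (leq_trans _ ik) // leq_subr.
Qed.

Lemma null_eps (u : nat -> FE) : null (fun l => eps ^+ (2 * l) * u l).
Proof.
move=> N k; exists [fset l in iota 0 k.+1]%fset => l lk.
rewrite ev_epsX; case: ltnP => // h; case/negP: lk; apply/imfsetP; exists l => //.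
by rewrite mem_iota; lia.
Qed.

Lemma hassumZ (T : choiceType) (u : T -> FE) (e : K) H :
  hassum u H -> hassum (fun x => e *: u x) (e *: H).
Proof.
rewrite -mulr_algl => /(hassumM e%:A); apply: hassum_ext => x.
exact: mulr_algl.
Qed.

End SummationTools.

Section Casimir.
Variables (K : numFieldType) (c : K).
Local Notation FR := (fourier_ring K).
Local Notation FE := (epseries FR).
Local Notation bv := (@bv K).
Local Notation pb := (pb (br c)).
Local Notation bt_ := (@bt_ K).
Local Notation at_ := (@at_ K).

Variable pw : nat -> int -> FR.
Hypothesis pw0 : forall n, pw 0 n = (n == 0)%:R.
Hypothesis pwS : forall l n, hassum (fun r => bv r * psC (pw l (n - r))) (psC (pw l.+1 n)).
Variable X : FE.
Hypothesis X_sum : hassum (fun l : nat =>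
  ((-1) ^+ l / l.+1%:R) *: (eps ^+ (2 * l) * psC (pw l.+1 0))) X.

Let br_n := @br_nice K c.

Let pw0_const n k : exists e : K, (psC (pw 0 n) : FE) k = e%:A.
Proof.
case: k => [|k]; last by exists 0; rewrite scale0r.
by exists (n == 0)%:R; rewrite [LHS]pw0 scaler_nat.
Qed.

Lemma nice_pw l n : nice l n (psC (pw l n)).
Proof.
elim: l n => [|l IHl] n.
  have [->|n0] := eqVneq n 0; first exact: nice_const (pw0_const 0).
  by rewrite pw0 (negbTE n0) rmorph0; exact: nice0.
apply: nice_hassum (pwS l n) _ => r.
by have := niceM (nice_bv K r) (IHl (n - r)); rewrite add1n addrC subrK.
Qed.

Lemma pw1 n : psC (pw 1 n) = bv n.
Proof.
apply: (hassum_uniq (pwS 0 n)).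
have := hassum_single (u := fun r => bv r * psC (pw 0 (n - r))) (x0 := n).
rewrite pw0 subrr eqxx (rmorph1 (@psC FR)) mulr1; apply => r rn.
rewrite pw0 subr_eq0 eq_sym (negbTE rn) (rmorph0 (@psC FR)); exact: mulr0.
Qed.

Lemma fder_pw_a l n m : fderE (inl m) (psC (pw l n)) = 0 :> FE.
Proof.
elim: l n => [|l IHl] n; first exact: fderE_const (pw0_const n).
apply: (hassum_uniq (fder_hassum (inl m) (pwS l n))).
apply: hassum_ext (hassum0 _ _) => r.
by rewrite fderEM IHl fderE_gen mulr0 mul0r addr0.
Qed.

(** Power rule in Fourier coefficients: [pw l n] stands for f_n(w^l), and differentiating w in b_m
    leaves the mode m, which shifts the index. In X the factor l + 1 cancels the denominators. *)
Lemma fder_pw_b l n m : fderE (inr m) (psC (pw l.+1 n)) = l.+1%:R *: psC (pw l (n - m)) :> FE.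
Proof.
have h1 l' n' : hassum (fun r => fderE (inr m) (bv r) * psC (pw l' (n' - r)))
    (psC (pw l' (n' - m))).
  have := hassum_single (u := fun r => fderE (inr m) (bv r) * psC (pw l' (n' - r))) (x0 := m).
  rewrite fderE_gen eqxx mul1r; apply => r rm; rewrite fderE_gen.
  have -> : (inr m == inr r :> zvar) = (m == r) by [].
  rewrite eq_sym (negbTE rm); exact: mul0r.
elim: l n => [|l IHl] n.
  rewrite scale1r; apply: (hassum_uniq (fder_hassum (inr m) (pwS 0 n))).
  apply: hassum_ext (h1 0%N n) => r.
  by rewrite fderEM (fderE_const _ (pw0_const _)) mulr0 addr0.
apply: (hassum_uniq (fder_hassum (inr m) (pwS l.+1 n))).
have h2 := hassumD (h1 l.+1 n) (hassumZ l.+1%:R (pwS l (n - m))).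
have -> : l.+2%:R *: psC (pw l.+1 (n - m)) = psC (pw l.+1 (n - m)) +
    l.+1%:R *: psC (pw l.+1 (n - m)) :> FE.
  by rewrite -[l.+2]add1n natrD scalerDl scale1r.
apply: hassum_ext h2 => r; rewrite fderEM IHl -scalerAr.
by rewrite (addrAC n (- m)).
Qed.

(* the Fourier coefficients of 1 / (1 + eps^2 w) *)
Let y_exists n : exists y : FE,
  hassum (fun l => (-1) ^+ l *: (eps ^+ (2 * l) * psC (pw l n))) y /\ nice 0 n y.
Proof.
have hn l : nice 0 n ((-1) ^+ l *: (eps ^+ (2 * l) * psC (pw l n))).
  by apply: niceZ; apply: nice_epsX; apply: (niceW _ (nice_pw l n)); lia.
have [y hy] : exists y, hassum (fun l => (-1) ^+ l *: (eps ^+ (2 * l) * psC (pw l n))) y.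
  apply: (nice_hassum_exists _ hn) => N k.
  have [A hA] := null_eps (fun l => (-1) ^+ l *: psC (pw l n)) N k.
  by exists A => l /hA; rewrite -scalerAr.
by exists y; split=> //; apply: nice_hassum hy hn.
Qed.

Section Inverse.
Variable y : int -> FE.
Hypothesis y_sum : forall n, hassum (fun l => (-1) ^+ l *: (eps ^+ (2 * l) * psC (pw l n))) (y n).
Hypothesis y_nice : forall n, nice 0 n (y n).

Lemma fder_casimir_b m : fderE (inr m) X = y (- m).
Proof.
apply: (hassum_uniq (fder_hassum (inr m) X_sum)).
apply: hassum_ext (y_sum (- m)) => l.
rewrite fderEZ (epslinX _ _ (@fderE_epslin K (inr m))) fder_pw_b sub0r -scalerAr scalerA.
by rewrite divfK // pnatr_eq0.
Qed.

Lemma fder_casimir_a m : fderE (inl m) X = 0.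
Proof.
apply: (hassum_uniq (fder_hassum (inl m) X_sum)).
apply: hassum_ext (hassum0 _ _) => l.
rewrite fderEZ (epslinX _ _ (@fderE_epslin K (inl m))) fder_pw_a mulr0; exact: esym (scaler0 _ _).
Qed.

Lemma inverse_sum n : hassum (fun s => bt_ s * y (n - s)) (n == 0)%:R.
Proof.
(* The factor 1 gives the powers of eps the form required by [null_eps]. *)
pose w l s : FE := (eps ^+ (2 * l) * 1) * bv s * ((-1) ^+ l *: psC (pw l (n - s))).
have wE l s : w l s = (-1) ^+ l *: (eps ^+ (2 * l) * (bv s * psC (pw l (n - s)))).
  by rewrite /w mulr1 -scalerAr mulrA.
have w_nice (p : nat * int) : nice 1 n (w p.1 p.2).
  rewrite wE; apply: niceZ; apply: nice_epsX.
  have := niceM (nice_bv K p.2) (nice_pw p.1 (n - p.2)).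
  by rewrite [p.2 + _]addrC subrK; apply: niceW; lia.
(* One double sum evaluated in both orders: summing over [s] first gives the geometric series
   shifted by one, summing over [l] first the convolution of b with y. *)
have [T hT] : exists T, hassum (fun p : nat * int => w p.1 p.2) T.
  apply: (nice_hassum_exists _ w_nice).
  apply: (null_pair (u := fun l => eps ^+ (2 * l) * 1) (v := bv)
    (fun p => (-1) ^+ p.1 *: psC (pw p.1 (n - p.2)))).
    exact: null_eps.
  exact: (null_int (nice_bv K)).
have hl : hassum (fun l => (-1) ^+ l *: (eps ^+ (2 * l) * psC (pw l.+1 n))) T.
  apply: (hassum_fubini hT) => l; apply: hassum_ext (fun s => esym (wE l s)) _.
  by apply: hassumZ; apply: hassumM.
have hs : hassum (fun s => bv s * y (n - s)) T.
  have hT' := hassum_reindex (g := fun p : int * nat => (p.2, p.1))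
    (g' := fun p : nat * int => (p.2, p.1))
    (fun p => esym (surjective_pairing p)) (fun p => esym (surjective_pairing p)) hT.
  apply: (hassum_fubini hT') => s /=.
  apply: hassum_ext (hassumM (bv s) (y_sum (n - s))) => l /=.
  by rewrite wE -scalerAr mulrCA.
have yT : y n = (n == 0)%:R - eps ^+ 2 * T.
  apply: (hassum_uniq (y_sum n)).
  have h1 := hassum_single (u := fun l : nat => if l == 0%N then (n == 0)%:R else 0 : FE) (x0 := 0%N).
  have {}h1 := h1 (fun x => ifN_eq _ _).
  have h2 : hassum (fun l : nat => if l is l'.+1 then
      (-1) ^+ l' *: (eps ^+ (2 * l') * psC (pw l'.+1 n)) else 0) T.
    apply: (hassum_inj (g := S) (@succn_inj)) hl.
    by case=> // l h; case: (h l).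
  apply: hassum_ext (hassumB h1 (hassumM (eps ^+ 2) h2)) => -[|l].
    rewrite eqxx mulr0 subr0 muln0 !expr0 mul1r scale1r pw0.
    by rewrite (rmorph_nat (@psC FR)).
  have -> : (l.+1 == 0)%N = false by [].
  have -> : (eps : FE) ^+ (2 * l.+1) = eps ^+ 2 * eps ^+ (2 * l) by rewrite mulnS exprD.
    have -> : (-1) ^+ l.+1 = - (-1) ^+ l :> K by rewrite exprS mulN1r.
    by rewrite [in RHS]scaleNr -[in RHS]mulrA [in RHS]scalerAr sub0r.
have h1 := hassum_single (u := fun s : int => 1 *+ (s == 0) * y (n - s)) (x0 := 0).
have {}h1 : hassum (fun s : int => 1 *+ (s == 0) * y (n - s)) (y n).
  rewrite eqxx mul1r subr0 in h1; apply: h1 => s /negbTE ->; exact: mul0r.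
have := hassumD h1 (hassumM (eps ^+ 2) hs); rewrite yT subrK.
by apply: hassum_ext => s; rewrite /bt_ mulrDl mulrA.
Qed.

(** When the sum over m is taken first, y is inverse to [bt_] and only r = n remains; the total is
    A_n g_n = 0. *)
Lemma inverse_conv0 (A g : int -> FE) (B : int -> FE) n : (forall r, nice 0 r (A r)) ->
    (forall r, nice 0 0 (g r)) -> g n = 0 ->
    (forall m, hassum (fun r => A r * bt_ (n + m - r) * g r) (B m)) ->
    hassum (fun m => y (- m) * B m) 0.
Proof.
move=> nA ng gn hB.
pose w (p : int * int) : FE := y (- p.1) * A p.2 * (bt_ (n + p.1 - p.2) * g p.2).
have wE m r : w (m, r) = y (- m) * (A r * bt_ (n + m - r) * g r).
  by rewrite /w /= !mulrA.
have w_nice p : nice 0 n (w p).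
  have := niceM (niceM (y_nice (- p.1)) (nA p.2)) (niceM (nice_bt K (n + p.1 - p.2)) (ng p.2)).
  by have -> : - p.1 + p.2 + (n + p.1 - p.2 + 0) = n by lia.
have [T hT] : exists T, hassum w T.
  apply: (nice_hassum_exists _ w_nice).
  apply: (null_pair (u := fun m => y (- m)) (v := A)
    (fun p => bt_ (n + p.1 - p.2) * g p.2)); last exact: (null_int nA).
  apply: (null_int_sub (n := 0) (D := 0%N)) => r; rewrite sub0r; exact: y_nice.
have T0 : T = 0.
  have hT' := hassum_reindex (g := fun p : int * int => (p.2, p.1))
    (g' := fun p : int * int => (p.2, p.1))
    (fun p => esym (surjective_pairing p)) (fun p => esym (surjective_pairing p)) hT.
  apply: (hassum_uniq _ (hassum0 _ int)).
  apply: (hassum_fubini hT') => r /=.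
  have -> : 0 = A r * g r * (n - r == 0)%:R :> FE.
    case: (eqVneq (n - r) 0) => [nr|_]; last by rewrite mulr0.
    by move/eqP: nr; rewrite subr_eq0 => /eqP <-; rewrite gn mulr0 mul0r.
  have hi := hassum_reindex (g := fun m : int => n - r + m) (g' := fun s : int => s - (n - r))
    (fun m => ltac:(lia)) (fun s => ltac:(lia)) (inverse_sum (n - r)).
  apply: hassum_ext (hassumM (A r * g r) hi) => m /=.
  rewrite wE; have -> : n - r - (n - r + m) = - m by lia.
  have -> : n + m - r = n - r + m by lia.
  by ring.
rewrite -T0; apply: (hassum_fubini hT) => m.
apply: hassum_ext (hassumM (y (- m)) (hB m)) => r.
by rewrite wE.
Qed.

(** Every kernel is reduced to terms vanishing at the index n selected by [inverse_conv0]. For two b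
    the difference Z(s-m) - Z(s-n), where s - m = n - r, is split at 1 into two kernels, each
    depending on one of the indices r and s and vanishing when that index is n. *)
Lemma casimir_gen x : hassum (fun z => fderE z X * br c x z) 0.
Proof.
have inr0 : hassum (fun m => y (- m) * br c x (inr m)) 0 ->
    hassum (fun z => fderE z X * br c x z) 0.
  move=> h; apply: (hassum_inj (g := fun m : int => inr m : zvar)).
  - by move=> m m' [].
  - by case=> m hm; [rewrite fder_casimir_a mul0r|case: (hm m)].
  - by apply: hassum_ext h => m /=; rewrite fder_casimir_b.
have ng n s : nice 0 0 (zquot c (s - n) 0) by exact: nice_zquot.
have zz i : zquot c i i = 0.
  by apply: epseriesP => k; rewrite zquotE /zdiff subrr scale0r.
apply: inr0; case: x => n.
- have := @inverse_conv0 at_ (fun s => zquot c (s - n) 0) (fun m => br_ba c m n) n (@nice_at K) (ng n).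
  rewrite subrr zz => /(_ erefl) h.
  rewrite -oppr0; apply: hassum_ext (fun m => esym (mulrN _ _)) _.
  apply: hassumN; apply: h => m.
  have := hassum_reindex (g := fun s : int => m + n - s) (g' := fun s : int => m + n - s)
    (fun m => ltac:(lia)) (fun s => ltac:(lia)) (br_ba_hassum c m n).
  apply: hassum_ext => s /=.
  have -> : m + n - (m + n - s) = s by lia.
  have -> : n + m - s = m + n - s by lia.
  by rewrite [bt_ _ * _]mulrC.
- have fam (i : int -> int) : exists B : int -> FE, forall m,
      hassum (fun r => bt_ r * bt_ (n + m - r) * zquot c (i r) 0) (B m).
    suff h m : exists B : FE, hassum (fun r => bt_ r * bt_ (n + m - r) * zquot c (i r) 0) B.
      by have [B hB] := choice h; exists B.
    apply: (nice_hassum_exists (D := 0%N) (n := n + m)).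
      have h0 := nullM (fun r => bt_ (n + m - r) * zquot c (i r) 0) (null_int (@nice_bt K)).
      by move=> M k; have [S hS] := h0 M k; exists S => r /hS; rewrite mulrA.
    move=> r; have := niceM (niceM (nice_bt K r) (nice_bt K (n + m - r))) (nice_zquot c (i r) 0).
    by rewrite addr0 addrC subrK.
  have [B1 hB1] := fam (fun r => n - r).
  have [B2 hB2] := fam (fun r => r - n).
  have c1 := @inverse_conv0 bt_ (fun s => zquot c (n - s) 0) B1 n (@nice_bt K)
    (fun r => nice_zquot c (n - r) 0).
  rewrite subrr zz in c1; have {}c1 := c1 erefl hB1.
  have c2 := @inverse_conv0 bt_ (fun s => zquot c (s - n) 0) B2 n (@nice_bt K) (ng n).
  rewrite subrr zz in c2; have {}c2 := c2 erefl hB2.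
  have := hassumB c1 c2; rewrite subrr; apply: hassum_ext => m.
  rewrite -mulrBr; congr (_ * _).
  have hB2' := hassum_reindex (g := fun s : int => n + m - s) (g' := fun s : int => n + m - s)
    (fun m => ltac:(lia)) (fun s => ltac:(lia)) (hB2 m).
  apply: (hassum_uniq (hassumB (hB1 m) hB2')).
  apply: hassum_ext (br_bb_hassum c n m) => r /=.
  have -> : n + m - r - m = n - r by lia.
  have -> : n + m - (n + m - r) = r by lia.
  have -> : zquot c (n - r) (n + m - r - n) = zquot c (n - r) 0 - zquot c (n + m - r - n) 0.
    apply: epseriesP => k.
    change (zquot c (n - r) (n + m - r - n) k = zquot c (n - r) 0 k - zquot c (n + m - r - n) 0 k).
    rewrite !zquotE -scalerBl /zdiff; apply: (congr1 (fun z : K => z *: (1 : FR))).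
      by ring.
  by rewrite mulrBr [bt_ (n + m - r) * _]mulrC.
Qed.

End Inverse.

Lemma casimir F : tame_series F -> pb F X = 0.
Proof.
have [y hy] := choice y_exists.
have gen0 := casimir_gen (fun n => (hy n).1) (fun n => (hy n).2).
move=> tF; apply: hassum_uniq (pb_hassum br_n X tF) _.
have hx x : hassum (fun z : zvar => fderE x F * fderE z X * br c x z) 0.
  by rewrite -(mulr0 (fderE x F)); apply: hassum_ext (hassumM (fderE x F) (gen0 x)) => z;
    rewrite mulrA.
have e := hassum_uniq (hassum_fubini (pb_hassum br_n X tF) hx) (hassum0 _ zvar).
by rewrite -e; exact: pb_hassum.
Qed.

End Casimir.

(** * Density of the polynomials in the betahat_k *)

Section Density.
Variable K : comNzRingType.
Local Notation FR := (fourier_ring K).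
Local Notation FE := (epseries FR).
Variables (S P : set FE).
Hypothesis P_scalar : forall e : K, P e%:A.
Hypothesis P_eps : P eps.
Hypothesis PD : forall F G, P F -> P G -> P (F + G).
Hypothesis PM : forall F G, P F -> P G -> P (F * G).

Definition subring_ideal : set FE := [set y + z | y in P & z in clideal S].
Local Notation P' := subring_ideal.

Lemma subring_idealP y z : P y -> clideal S z -> P' (y + z).
Proof. by move=> hy hz; exists y => //; exists z. Qed.

Lemma subring_ideal_l y : P y -> P' y.
Proof. by move=> hy; rewrite -[y]addr0; apply: subring_idealP hy (@clideal0 _ _). Qed.

Lemma subring_ideal_r z : clideal S z -> P' z.
Proof.
move=> hz; rewrite -[z]add0r; apply: subring_idealP hz.
by have := P_scalar 0; rewrite scale0r.
Qed.

Lemma subring_idealD F G : P' F -> P' G -> P' (F + G).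
Proof.
move=> [y hy [z hz <-]] [y' hy' [z' hz' <-]]; rewrite addrACA.
by apply: subring_idealP; [exact: PD|exact: clidealD].
Qed.

Lemma subring_idealM F G : P' F -> P' G -> P' (F * G).
Proof.
move=> [y hy [z hz <-]] [y' hy' [z' hz' <-]]; rewrite mulrDl mulrDr -addrA.
apply: subring_idealP; first exact: PM.
apply: clidealD; first exact: clidealM.
by rewrite mulrC; apply: clidealM.
Qed.

Lemma subring_idealZ e F : P' F -> P' (e *: F).
Proof.
move=> hF; rewrite -mulr_algl; apply: subring_idealM hF; exact: subring_ideal_l (P_scalar e).
Qed.

Lemma subring_idealB F G : P' F -> P' G -> P' (F - G).
Proof.
move=> hF hG; apply: subring_idealD hF _; rewrite -scaleN1r; exact: subring_idealZ.
Qed.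

Let pevalD (p q : pol K zvar) :
  peval (@fgen K) (p + q) = peval (@fgen K) p + peval (@fgen K) q.
Proof. exact: rmorphD. Qed.

Let pevalM (p q : pol K zvar) :
  peval (@fgen K) (p * q) = peval (@fgen K) p * peval (@fgen K) q.
Proof. exact: rmorphM. Qed.

Let psCD (x z : FR) : psC (x + z) = psC x + psC z. Proof. exact: rmorphD. Qed.
Let psCM (x z : FR) : psC (x * z) = psC x * psC z. Proof. exact: rmorphM. Qed.
Let psCB (x z : FR) : psC (x - z) = psC x - psC z. Proof. exact: rmorphB. Qed.

Lemma fseq_peval N (p : pol K zvar) : fseq (peval (@fgen K) p) N = ftrunc N p.
Proof.
elim/pol_ind: p => [e|x|p q hp hq|p q hp hq].
- by rewrite peval_scalar linearZ /= ftrunc1.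
- by rewrite peval_var ftrunc_pvar.
- by rewrite pevalD (raddfD (ftrunc N)) /= -hp -hq.
- by rewrite pevalM (rmorphM (ftrunc N)) /= -hp -hq.
Qed.

Definition approx F : Prop := exists y G, P' y /\ F = y + eps * G.

Lemma approx_coef0 y x : P' y -> y 0%N = x -> approx (psC x).
Proof.
move=> hy <-; exists y, (- epsdiv y); split=> //.
by rewrite mulrN {2}(psC_eps_decomp y) addrK.
Qed.

Hypothesis gen_approx : forall x, approx (psC (fgen K x)).

Lemma approx_peval p : approx (psC (peval (@fgen K) p)).
Proof.
elim/pol_ind: p => [e|x|p q [y [G [hy Ey]]] [y' [G' [hy' Ey']]]|
  p q [y [G [hy Ey]]] [y' [G' [hy' Ey']]]].
- rewrite peval_scalar; apply: (approx_coef0 (y := e%:A)) => //.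
  exact: subring_ideal_l (P_scalar e).
- by rewrite peval_var.
- exists (y + y'), (G + G'); split; first exact: subring_idealD.
  rewrite pevalD psCD Ey Ey'.
  by rewrite mulrDr; exact: addrACA.
- exists (y * y'), (y * G' + G * y' + eps * (G * G')); split; first exact: subring_idealM.
  rewrite pevalM psCM Ey Ey'.
  by ring.
Qed.

(** Successive approximation: the constant term is matched modulo eps and M_N, and the error moves
    into the next coefficients, to which the induction hypothesis applies. *)
Lemma density F N n : exists2 y, P' y & fnbhd N n (F - y).
Proof.
elim: n F => [|n IHn] F; first by exists 0 => //; apply: subring_ideal_r; exact: clideal0.
(* At level N the constant term is a polynomial in finitely many generators; its lift through [fgen]
   differs from it by an element of M_N. *)
have [y [G [hy Ey]]] := approx_peval (fseq (F 0%N) N).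
have [y' hy' Gy] := IHn (epsdiv F + G).
exists (y + eps * y').
  by apply: subring_idealD hy _; apply: subring_idealM hy'; exact: subring_ideal_l.
have -> : F - (y + eps * y') = psC (F 0%N - peval (@fgen K) (fseq (F 0%N) N)) +
    eps * (epsdiv F + G - y').
  by rewrite {1}(psC_eps_decomp F) psCB Ey; ring.
move=> [|k] kn.
  change (fseq (F 0%N) N - fseq (peval (@fgen K) (fseq (F 0%N) N)) N +
    ev N 0 (eps * (epsdiv F + G - y')) = 0).
  rewrite fseq_peval -[eps]expr1 ev_epsX addr0.
  by rewrite -[ftrunc N _]/(ftrunc N (ev N 0 F)) (ev_trunc _ _ (leqnn N)) subrr.
change (0 + ev N k.+1 (eps * (epsdiv F + G - y')) = 0).
by rewrite add0r -[eps]expr1 ev_epsX subn1; exact: Gy.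
Qed.

Lemma closure_subring_ideal : closure P' = setT.
Proof. by apply/seteqP; split=> // F _; apply/closure_fnbhd => N n; exact: density. Qed.

End Density.

Section BetaDensity.
Variables (K : numFieldType) (c : K).
Local Notation FR := (fourier_ring K).
Local Notation FE := (epseries FR).
Local Notation fa s := (fgen K (inl s)).
Local Notation fb s := (fgen K (inr s)).
Variables (L : int -> FE) (X : FE) (P : set FE) (betah : int -> FE).
Local Notation S := ([set X] `|` [set L q | q in [set q | q != 0]]).
Hypothesis L0 : forall m, L m 0%N = fa m - fb m.
Hypothesis X0 : X 0%N = fb 0.
Hypothesis betahE : forall n, clideal S (betah n - beta c L n).
Hypothesis P_scalar : forall e : K, P e%:A.
Hypothesis P_eps : P eps.
Hypothesis PD : forall F G, P F -> P G -> P (F + G).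
Hypothesis PM : forall F G, P F -> P G -> P (F * G).
Hypothesis P_betah : forall n, P (betah n).

(** L_0 is not a generator of the ideal, so at index 0 its part is taken by X, whose leading term is
    b_0; then 2 beta_0 - X starts with a_0. For n <> 0, beta_n + L_n / 2 and beta_n - L_n / 2 start
    with a_n and b_n. *)
Lemma closure_beta_ideal : closure (subring_ideal S P) = setT.
Proof.
apply: closure_subring_ideal => //.
have hb n : subring_ideal S P (beta c L n).
  have -> : beta c L n = betah n - (betah n - beta c L n) by rewrite subKr.
  by apply: subring_idealB => //; [exact: subring_ideal_l|exact: subring_ideal_r].
have hX : subring_ideal S P X.
  by apply: subring_ideal_r => //; apply: clideal_mem; left.
have hL n : n != 0 -> subring_ideal S P (L n).
  by move=> n0; apply: subring_ideal_r => //; apply: clideal_mem; right; exists n.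
have cB (F G : FE) k (x y : FR) : F k = x -> G k = y -> (F - G) k = x - y by move=> <- <-.
have cZ (F : FE) k (e : K) (x : FR) : F k = x -> (e *: F) k = e *: x by move=> <-.
case=> n; have [n0|n0] := eqVneq n 0.
- apply: (approx_coef0 (y := 2 *: beta c L n - X)).
    by apply: subring_idealB => //; apply: subring_idealZ.
  rewrite (cB _ _ _ _ _ (cZ _ _ _ _ (beta_coef0 c L0 n)) X0) n0; exact: two_half_sum.
- apply: (approx_coef0 (y := beta c L n - (- 2^-1) *: L n)).
    by apply: subring_idealB => //; apply: subring_idealZ => //; exact: hL.
  rewrite (cB _ _ _ _ _ (beta_coef0 c L0 n) (cZ _ _ _ _ (L0 n))); exact: half_sum_diff.
- by rewrite n0; apply: (approx_coef0 hX).
- apply: (approx_coef0 (y := beta c L n - 2^-1 *: L n)).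
    by apply: subring_idealB => //; apply: subring_idealZ => //; exact: hL.
  rewrite (cB _ _ _ _ _ (beta_coef0 c L0 n) (cZ _ _ _ _ (L0 n))); exact: half_diff_diff.
Qed.

End BetaDensity.

(** * The reduction as a series of bounded degrees *)

Section Degree.
Variables (K : comNzRingType) (I : choiceType).
Implicit Types (F G : pol K I) (m : cmonom I).

Definition degle (n : nat) F : Prop := forall m, m \in msupp F -> (mdeg m <= n)%N.

Lemma degleW n n' F : (n <= n')%N -> degle n F -> degle n' F.
Proof. by move=> nn' hF m /hF /leq_trans; apply. Qed.

Lemma degle0 n : degle n 0.
Proof. by move=> m; rewrite msupp0. Qed.

Lemma degleD n F G : degle n F -> degle n G -> degle n (F + G).
Proof. by move=> hF hG m /(fsubsetP (msuppD_le _ _)); rewrite in_fsetU => /orP[/hF|/hG]. Qed.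

Lemma degleZ n (e : K) F : degle n F -> degle n (e *: F).
Proof. by move=> hF m /(fsubsetP (msuppZ_le _ _)) /hF. Qed.

Lemma degleN n F : degle n F -> degle n (- F).
Proof. by move=> hF m; rewrite msuppN => /hF. Qed.

Lemma degleM n n' F G : degle n F -> degle n' G -> degle (n + n') (F * G).
Proof.
move=> hF hG m /msuppM_le[m1 [m2 [/hF h1 /hG h2 ->]]].
by rewrite [mdeg _]mdegM leq_add.
Qed.

Lemma degle_sum n (J : eqType) (r : seq J) (F : J -> pol K I) :
  (forall j, j \in r -> degle n (F j)) -> degle n (\sum_(j <- r) F j).
Proof.
move=> h; rewrite big_seq; apply: big_ind => //; first exact: degle0.
exact: degleD.
Qed.

Lemma degleU m (e : K) : degle (mdeg m) (mkmalgU m e).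
Proof.
move=> m'; rewrite msuppU; case: ifP => _; first by rewrite in_fset0.
by rewrite in_fset1 => /eqP ->.
Qed.

Lemma degle_var x : degle 1 (pvar K x).
Proof. by have := @degleU (ucm x) 1; rewrite mdegU. Qed.

Lemma degle1 : degle 0 1.
Proof. by have := @degleU mone 1; rewrite mdeg1. Qed.

Lemma degleX n F k : degle n F -> degle (k * n) (F ^+ k).
Proof.
move=> hF; elim: k => [|k IHk]; first by rewrite mul0n expr0; exact: degle1.
by rewrite mulSn exprS; apply: degleM.
Qed.

End Degree.

(** * Degrees of U and Q *)

Section RootDegree.
Variables (K : numFieldType) (A : comAlgType K) (d : {linear A -> A}).
Variable D : nat -> A -> Prop.
Hypotheses (DW : forall n n' a, (n <= n')%N -> D n a -> D n' a) (D0 : forall n, D n 0).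
Hypotheses (DD : forall n a b, D n a -> D n b -> D n (a + b)).
Hypotheses (DZ : forall n (e : K) a, D n a -> D n (e *: a)).
Hypotheses (DM : forall n n' a b, D n a -> D n' b -> D (n + n')%N (a * b)).
Hypothesis Dd : forall n a, D n a -> D n (d a).
Local Notation AE := (epseries A).

(** The bound k + 1 is stable under the quadratic term of [root_step], since (i + 1) + (k - 2 - i +
    1) = k when eps^2 takes two orders. It is what makes the L_n [nice] with D = 1. *)
Definition degrees (F : AE) : Prop := forall k, D k.+1 (F k).

Let Dsum n (J : Type) (r : seq J) (F : J -> A) : (forall j, D n (F j)) ->
  D n (\sum_(j <- r) F j).
Proof. by move=> h; apply: big_ind => //; exact: DD. Qed.

Lemma degrees_sh e F : degrees F -> degrees (sh d e F).
Proof.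
move=> hF k; apply: Dsum => i; apply: DZ.
have hi : D k.+1 (F (k - i)%N) by apply: DW (hF _); rewrite ltnS leq_subr.
by move: (F _) hi => a ha; elim: (nat_of_ord i) => // j IHj; exact: Dd.
Qed.

Lemma degreesD F G : degrees F -> degrees G -> degrees (F + G).
Proof. by move=> hF hG k; exact: DD. Qed.

Lemma degreesN F : degrees F -> degrees (- F).
Proof.
move=> hF k; change (D k.+1 (- F k)); rewrite -scaleN1r; exact: DZ.
Qed.

Lemma degrees_eps2 F G : degrees F -> degrees G -> degrees (eps ^+ 2 * (F * G)).
Proof.
move=> hF hG k; rewrite epsXMcoef; case: ltnP => // k2.
apply: Dsum => i; apply: (DW _ (DM (hF i) (hG _))).
by have := ltn_ord i; lia.
Qed.

Lemma root_degrees w U : degrees w -> root_step d w U = U -> degrees U.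
Proof.
move=> hw rootU.
(* The fixed point is constructed anew with the degree bound as invariant and then identified with U
   by uniqueness. *)
have [//|u hu j|u v n _ _ h _ k kn|s hs j k|u [hu uE]] := @epseries_fixpoint unit A
    (fun u => forall j, degrees (u j)) (fun u _ => root_step d w (u tt)).
- by move=> ? k; exact: D0.
- rewrite /root_step => k; apply: DZ; move: k; apply: degreesD.
    apply: degreesD => //; apply: degreesN; apply: degreesD; last exact: degreesN.
    exact: degrees_sh.
  by apply: degreesN; apply: degrees_eps2 => //; exact: degrees_sh.
- by apply: (@root_step_contracting _ _ d w n) => // i; apply: h.
- exact: (hs k.+1 j k).
by rewrite (root_unique rootU (uE tt)); exact: hu.
Qed.

Lemma reduction_degrees w U : degrees w -> root_step d w U = U -> degrees (reduction d U).
Proof.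
move=> hw rootU; have hU := root_degrees hw rootU.
by apply: degreesD => //; exact: degrees_sh.
Qed.

End RootDegree.

Section ReductionExists.
Variable R : realType.
Local Notation DR := (pol R[i] dvar).

Lemma degle_dR n (F : DR) : degle n F -> degle n (dR F).
Proof.
move=> hF; rewrite /dR /pderivation; apply: degle_sum => m mF.
apply: degle_sum => x xm; apply: (degleW (hF m mF)).
have m0 : m x != 0%N by rewrite cmE_neq0.
have -> : mdeg m = (mdeg (divcm m (ucm x)) + 1)%N.
  by rewrite -{1}(divcmK m0) [mdeg _]mdegM mdegU.
by apply: degleM; [exact: degleU|exact: degle_var].
Qed.

Theorem toda_reduction_exists : exists Q : epseries DR,
  [/\ in_R0 Q,
      [/\ Q 0%N = pvar R[i] (inr 0%N), Q 1%N = - 2^-1 *: pvar R[i] (inr 1%N) &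
      Q 2%N = (2^-1 ^+ 2 / 2) *: pvar R[i] (inr 2%N)
        - 2^-1 ^+ 2 *: (pvar R[i] (inr 0%N) * pvar R[i] (inr 0%N))],
      forall k, degle k.+1 (Q k) &
      forall (k : nat) (F : epseries DR),
        diff_ideal Q F -> diff_ideal Q (toda_der k F)].
Proof.
have [U rootU] := root_exists (dlin R) (w0 R).
exists (reduction (dlin R) U); split.
- exact: in_R0_keep_w (keep_w_reduction rootU).
- have [-> -> ->] := reduction_coefs rootU (erefl (w0 R)).
  by have := @iter_dR_var R (inr 0%N) 1; have := @iter_dR_var R (inr 0%N) 2 => /= -> ->.
- apply: (reduction_degrees (D := @degle _ _) _ _ _ _ _ _ _ rootU).
  + exact: degleW.
  + exact: degle0.
  + exact: degleD.
  + exact: degleZ.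
  + exact: degleM.
  + exact: degle_dR.
  + case=> [|k]; first exact: degle_var.
    exact: degle0.
- by move=> k F; apply: toda_der_diff_ideal.
Qed.

End ReductionExists.

(** * Fourier coefficients *)

Section WeightComponents.
Variable K : comNzRingType.
Local Notation wt n := (fun m : cmonom zvar => weight m == n).

Lemma pkeepU (p : pred (cmonom zvar)) m (e : K) :
  pkeep p (mkmalgU m e : pol K zvar) = if p m then mkmalgU m e else 0.
Proof.
apply/malgP => m'; rewrite mcoeff_pkeep mcoeffU.
case: (m =P m') => [<-|mm]; last first.
  by rewrite !mul0rn; case: ifP; rewrite ?mcoeff0 // mcoeffU; case: eqP.
by case: ifP => _; rewrite ?mcoeff0 // mcoeffU eqxx.
Qed.

Lemma pkeep_varM n x (B : pol K zvar) :
  pkeep (wt n) (pvar K x * B) = pvar K x * pkeep (wt (n - idx x)) B.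
Proof.
rewrite (monalgE B) mulr_sumr !linear_sum /= mulr_sumr; apply: eq_bigr => m _.
move: (mcoeff m B) => b.
rewrite [pvar K x * _]mkmalgUM !pkeepU /= [weight (mulcm _ _)]weightM weightU.
have -> : (idx x + weight m == n) = (weight m == n - idx x) by lia.
case: (weight m == n - idx x); first exact: (esym (mkmalgUM _ _ _ _)).
exact: (esym (mulr0 _)).
Qed.

End WeightComponents.

Section FourierCoefficients.
Variable R : realType.
Local Notation C := R[i].
Local Notation DR := (pol C dvar).
Local Notation DE := (epseries DR).
Local Notation FR := (fourier_ring C).
Local Notation FE := (epseries FR).
Local Notation S1 := (pol C zvar).
Local Notation c := (twopii R).
Local Notation wt n := (fun m : cmonom zvar => weight m == n).

Lemma fseq_fcoef n (F : DR) N :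
  fseq (fcoef n F) N = pkeep (wt n) (peval (@mode_sum R N) F).
Proof. by []. Qed.

Lemma fcoefD n (F G : DR) : fcoef n (F + G) = fcoef n F + fcoef n G.
Proof.
apply: fseq_inj => N.
change (pkeep (wt n) (peval (@mode_sum R N) (F + G)) =
  pkeep (wt n) (peval (@mode_sum R N) F) + pkeep (wt n) (peval (@mode_sum R N) G)).
have -> : peval (@mode_sum R N) (F + G) = peval (@mode_sum R N) F + peval (@mode_sum R N) G.
  exact: rmorphD.
exact: raddfD.
Qed.

Lemma fcoefZ n (e : C) (F : DR) : fcoef n (e *: F) = e *: fcoef n F.
Proof.
apply: fseq_inj => N.
change (pkeep (wt n) (peval (@mode_sum R N) (e *: F)) =
  e *: pkeep (wt n) (peval (@mode_sum R N) F)).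
by rewrite pevalZ linearZ.
Qed.

Lemma fcoef0 n : fcoef n (0 : DR) = 0.
Proof. by apply: (addrI (fcoef n 0)); rewrite -fcoefD !addr0. Qed.

Lemma fcoefN n (F : DR) : fcoef n (- F) = - fcoef n F.
Proof. by apply/eqP; rewrite -addr_eq0 -fcoefD addNr fcoef0. Qed.

Lemma fcoef_var n k : (fcoef n (pvar C (inl k)) = (c * n%:~R) ^+ k *: fgen C (inl n)) *
  (fcoef n (pvar C (inr k)) = (c * n%:~R) ^+ k *: fgen C (inr n)).
Proof.
have key (y : int -> zvar) N : (forall j, idx (y j) = j) ->
    pkeep (wt n) (\sum_(j <- zrange N) (c * j%:~R) ^+ k *: pvar C (y j)) =
    (c * n%:~R) ^+ k *: (if (`|n| < N)%N then pvar C (y n) else 0).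
  move=> yj; rewrite linear_sum /=.
  have e j : pkeep (wt n) ((c * j%:~R) ^+ k *: pvar C (y j)) =
      if j == n then (c * n%:~R) ^+ k *: pvar C (y n) else 0.
    rewrite linearZ /= pkeepU weightU yj; case: eqP => [->|_] //.
    exact: scaler0.
  rewrite (eq_bigr _ (fun j _ => e j)) -mem_zrange; case: ifP => nN.
    by rewrite (bigD1_seq n nN (uniq_zrange N)) /= eqxx big1 ?addr0 // => j /negbTE ->.
  rewrite scaler0 big_seq big1 // => j; case: eqP => // ->; by rewrite nN.
split; apply: fseq_inj => N; rewrite fseq_fcoef peval_var.
  exact: (key inl).
exact: (key inr).
Qed.

(** The substituted sums of modes are linear forms in the a_j and b_j, so the degree does not
    grow. *)
Lemma degle_fcoef D n (F : DR) N : degle D F -> degle D (fseq (fcoef n F) N).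
Proof.
move=> hF m; rewrite fseq_fcoef -mcoeff_neq0 mcoeff_pkeep => h.
have : m \in msupp (peval (@mode_sum R N) F).
  by rewrite -mcoeff_neq0; apply: contraNneq h => ->; rewrite mul0rn.
move: m {h}; change (degle D (peval (@mode_sum R N) F)).
rewrite pevalE; apply: degle_sum => m mF; apply: degleZ.
apply: (degleW (hF m mF)); rewrite /meval mdegE.
apply: (big_ind2 (fun (a : nat) (b : S1) => degle a b)).
- exact: degle1.
- by move=> a b a' b'; exact: degleM.
move=> x _; suff h : degle 1 (@mode_sum R N x) by have := @degleX _ _ 1 _ (m x) h; rewrite muln1.
have key (y : int -> zvar) (e : int -> C) : degle 1 (\sum_(j <- zrange N) e j *: pvar C (y j)).
  by apply: degle_sum => j _; apply: degleZ; exact: degle_var.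
by case: x => i; exact: key.
Qed.

Lemma nice_fE D n (F : DE) : (forall k, degle (k + D) (F k)) -> nice D n (fE n F).
Proof.
move=> hF; split=> N k m mF; split; last exact: degle_fcoef (hF k) _ mF.
move: mF; rewrite -mcoeff_neq0 mcoeff_pkeep.
by case: (weight m =P n) => // _; rewrite mulr0n eqxx.
Qed.

Definition wpow (l : nat) (n : int) : FR := fcoef n (pvar C (inr 0%N) ^+ l).

Lemma wpow0 n : wpow 0 n = (n == 0)%:R.
Proof.
apply: fseq_inj => N; rewrite fseq_fcoef expr0.
have -> : peval (@mode_sum R N) (1 : DR) = mkmalgU mone 1 by exact: rmorph1.
rewrite pkeepU weight1 eq_sym; by case: eqP.
Qed.

(** The product rule for f_n with w as one factor. At level N only |r| < N contributes, so it is an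
    identity of finite sums. *)
Lemma wpowS l n : hassum (fun r => @bv C r * psC (wpow l (n - r))) (psC (wpow l.+1 n)).
Proof.
have e r : @bv C r * psC (wpow l (n - r)) = psC (fgen C (inr r) * wpow l (n - r)).
  by apply: esym; exact: rmorphM.
apply: hassum_ext (fun r => esym (e r)) _ => N [|k]; last first.
  by apply: fsumto_ext (fsumto0 _ _) => r; rewrite ev_psCS.
exists [fset j in zrange N]%fset; split=> [r rN|].
  change (fseq (fgen C (inr r)) N * fseq (wpow l (n - r)) N = 0) => /=.
  case: ifP => h; last exact: mul0r.
  by case/negP: rN; apply/imfsetP; exists r => //=; rewrite mem_zrange.
have -> : \sum_(x <- [fset j in zrange N]%fset) ev N 0 (psC (fgen C (inr x) * wpow l (n - x))) =
    \sum_(j <- zrange N) ev N 0 (psC (fgen C (inr j) * wpow l (n - j))).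
  apply: perm_big; apply: uniq_perm; rewrite ?uniq_zrange ?fset_uniq // => j.
  by rewrite inE.
change (\sum_(j <- zrange N) fseq (fgen C (inr j)) N * fseq (wpow l (n - j)) N =
  fseq (wpow l.+1 n) N).
rewrite fseq_fcoef exprS.
have -> : peval (@mode_sum R N) (pvar C (inr 0%N) * pvar C (inr 0%N) ^+ l) =
    peval (@mode_sum R N) (pvar C (inr 0%N)) * peval (@mode_sum R N) (pvar C (inr 0%N) ^+ l).
  exact: rmorphM.
rewrite peval_var /= mulr_suml linear_sum /= big_seq [RHS]big_seq.
apply: eq_bigr => j; rewrite mem_zrange => jN.
by rewrite jN expr0 scale1r [RHS]pkeep_varM.
Qed.

End FourierCoefficients.

Fact first_order_coef (K : numFieldType) (c z : K) : - (- 2^-1 * (c * z)) = c / 2 * z.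
Proof. by field. Qed.

Fact second_order_coef (K : numFieldType) (c z : K) :
  - (2^-1 ^+ 2 / 2 * (c * z) ^+ 2) = - ((c / 2) ^+ 2 * z ^+ 2 / 2).
Proof. by field. Qed.

Fact half_double (K : numFieldType) (a b : K) : 2 * a * b / 2 = a * b.
Proof. by field. Qed.

Fact psC_coef0 (T : comNzRingType) (x : T) : psC x 0%N = x. Proof. by []. Qed.
Fact psC_coefS (T : comNzRingType) (x : T) k : psC x k.+1 = 0. Proof. by []. Qed.

Fact sub0_comb1 (K : numFieldType) (V : lmodType K) (x y : K) (u : V) :
  - x = y -> 0 - x *: u = y *: u.
Proof. by move=> <-; rewrite sub0r scaleNr. Qed.

Fact sub0_comb2 (K : numFieldType) (V : lmodType K) (x y z : K) (u v : V) :
  - x = z -> 0 - (x *: u - y *: v) = z *: u + y *: v.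
Proof. by move=> <-; rewrite sub0r opprB scaleNr addrC. Qed.

Fact sub_comb2 (K : numFieldType) (V : lmodType K) (x y z : K) (a b u w : V) :
  a = z *: u -> b = w -> x *: a - y *: b = (x * z) *: u - y *: w.
Proof. by move=> -> ->; rewrite scalerA. Qed.

Fact add_opp_chain (V : zmodType) (x y z y' u v : V) :
  x = y + z -> z = - y' -> y = u -> y' = v -> x = u - v.
Proof. by move=> -> -> -> ->. Qed.

Fact add_sub_cancel (V : zmodType) (x y z : V) : x + y - (x + z) = y - z.
Proof. by rewrite opprD addrACA subrr add0r. Qed.

(** * Application to the Toda reduction *)

Section SecondTodaBracket.
Variable R : realType.
Local Notation C := R[i].
Local Notation DR := (pol C dvar).
Local Notation DE := (epseries DR).
Local Notation FR := (fourier_ring C).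
Local Notation FE := (epseries FR).
Local Notation c := (twopii R).
Local Notation piC := (pi : R)%:C%C.
Local Notation I := 'i%C.

Variable Q : DE.
Hypothesis Q0 : Q 0%N = pvar C (inr 0%N).
Hypothesis Q1 : Q 1%N = - 2^-1 *: pvar C (inr 1%N).
Hypothesis Q2 : Q 2%N = (2^-1 ^+ 2 / 2) *: pvar C (inr 2%N)
  - 2^-1 ^+ 2 *: (pvar C (inr 0%N) * pvar C (inr 0%N)).
Hypothesis Qdeg : forall k, degle k.+1 (Q k).

Local Notation L := (Lser Q).

Lemma twopii_neq0 : c != 0.
Proof.
rewrite /twopii !mulf_neq0 ?pnatr_eq0 ?neq0Ci //.
by rewrite (fmorph_eq0 (real_complex R)) gt_eqF // pi_gt0.
Qed.

Lemma half_twopii : c / 2 = piC * I.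
Proof. exact: half_double. Qed.

Lemma Lser_nice m : nice 1 m (L m).
Proof.
apply: nice_fE => k; rewrite addn1; apply: (degleD (F := v0 R k)); last first.
  by change (degle k.+1 (- (Q k))); apply: degleN; exact: Qdeg.
by case: k => [|k]; [rewrite psC_coef0; exact: degle_var|rewrite psC_coefS; exact: degle0].
Qed.

Let LE m k : L m k = fcoef m (v0 R k) - fcoef m (Q k).
Proof. by change (fcoef m (v0 R k - Q k) = fcoef m (v0 R k) - fcoef m (Q k)); rewrite fcoefD fcoefN. Qed.

Let fcoef_comb m (x y : C) (F G : DR) :
  fcoef m (x *: F - y *: G) = x *: fcoef m F - y *: fcoef m G.
Proof.
exact: (add_opp_chain (fcoefD m (x *: F) (- (y *: G))) (fcoefN m (y *: G))
  (fcoefZ m x F) (fcoefZ m y G)).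
Qed.

Let fv0 m : fcoef m (v0 R 0%N) = fgen C (inl m).
Proof. by rewrite /v0 psC_coef0 (fcoef_var R m 0).1 expr0 scale1r. Qed.

Let fv1 m k : fcoef m (v0 R k.+1) = 0.
Proof. by rewrite /v0 psC_coefS; exact: fcoef0. Qed.

Lemma Lser0 m : L m 0%N = fgen C (inl m) - fgen C (inr m).
Proof.
have e : fcoef m (Q 0%N) = fgen C (inr m) by rewrite Q0 (fcoef_var R m 0).2 expr0 scale1r.
by rewrite LE fv0 e.
Qed.

Lemma Lser1 m : L m 1%N = (c / 2 * m%:~R) *: fgen C (inr m).
Proof.
have e : fcoef m (Q 1%N) = (- 2^-1 * (c * m%:~R)) *: fgen C (inr m).
  rewrite Q1 (fcoefZ m (- 2^-1) (pvar C (inr 1%N))) (fcoef_var R m 1).2 expr1.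
  exact: scalerA.
rewrite LE fv1 e; apply: sub0_comb1.
exact: first_order_coef.
Qed.

Lemma Lser2 m : L m 2%N =
  (- ((c / 2) ^+ 2 * m%:~R ^+ 2 / 2)) *: fgen C (inr m) + 4^-1 *: @wpow R 2 m.
Proof.
pose x : C := 2^-1 ^+ 2 / 2; pose y : C := 2^-1 ^+ 2.
have e : fcoef m (Q 2%N) = (x * (c * m%:~R) ^+ 2) *: fgen C (inr m) - y *: @wpow R 2 m.
  rewrite Q2; apply: etrans (fcoef_comb m x y _ _) _.
  exact: (sub_comb2 x y (fcoef_var R m 2).2 (erefl (@wpow R 2 m))).
have -> : 4^-1 = y by rewrite /y exprVn -natrX.
rewrite LE fv1 e; apply: sub0_comb2; rewrite /x.
exact: second_order_coef.
Qed.

Lemma bv_square m : hassum (fun r => @bv C r * @bv C (m - r)) (psC (@wpow R 2 m)).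
Proof.
apply: hassum_ext (@wpowS R 1 m) => r.
by rewrite (pw1 (@wpow0 R) (@wpowS R)).
Qed.

Let Xterm (l : nat) : FE := ((-1) ^+ l / l.+1%:R) *: (eps ^+ (2 * l) * psC (@wpow R l.+1 0)).

Lemma Xcas_hassum : hassum Xterm (Xcas R).
Proof.
have nX l : nice 1 0 (Xterm l).
  apply: niceZ; apply: nice_epsX.
  by apply: (niceW _ (nice_pw (@wpow0 R) (@wpowS R) l.+1 0)); lia.
have [H hH] : exists H, hassum Xterm H.
  apply: (nice_hassum_exists _ nX) => N k.
  have [A hA] := null_eps (fun l => ((-1) ^+ l / l.+1%:R) *: psC (@wpow R l.+1 0)) N k.
  by exists A => l /hA; rewrite -scalerAr.
suff -> : Xcas R = H by [].
apply: FE_lim => N n; have [A [_ hA]] := hassum_fnbhd N n hH.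
have [M hM] := seq_bounded A (fun l : nat => l.+1); exists M => i Mi.
have -> : \sum_(0 <= l < i) ((-1) ^+ l / l.+1%:R) *: (eps ^+ (2 * l) * fE 0 (w0 R ^+ l.+1)) =
    \sum_(l <- [fset l in index_iota 0 i]%fset) Xterm l.
  transitivity (\sum_(0 <= l < i) Xterm l).
    apply: eq_bigr => l _; congr (_ *: (_ * _)).
    have -> : w0 R ^+ l.+1 = psC (pvar C (inr 0%N) ^+ l.+1) by apply: esym; exact: rmorphXn.
    apply: epseriesP => -[|k]; first by [].
    exact: fcoef0.
  apply: perm_big; apply: uniq_perm; rewrite ?iota_uniq ?fset_uniq // => j.
  by rewrite inE.
apply: hA; apply/fsubsetP => l lA; rewrite inE /= mem_index_iota /=.
exact: leq_trans (hM _ lA) Mi.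
Qed.

Lemma Xcas0 : Xcas R 0%N = fgen C (inr 0).
Proof.
rewrite (hassum_coef_single (k := 0%N) (x0 := 0%N) Xcas_hassum) => [|l l0].
  change (((-1) ^+ 0 / 1%:R) *: (eps ^+ 0 * psC (@wpow R 1 0)) 0%N = fgen C (inr 0)).
  rewrite (pw1 (@wpow0 R) (@wpowS R)) !expr0 divr1 scale1r mul1r; exact: erefl.
change (((-1) ^+ l / l.+1%:R) *: (eps ^+ (2 * l) * psC (@wpow R l.+1 0)) 0%N = 0).
rewrite epsXMcoef; have -> : (0 < 2 * l)%N by lia.
exact: scaler0.
Qed.

Lemma Xcas_casimir F : tame_series F -> pb (br c) F (Xcas R) = 0.
Proof. exact: (casimir c (@wpow0 R) (@wpowS R) Xcas_hassum). Qed.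

Lemma tail_ideal n : IQ' Q (tail L n).
Proof.
apply: clideal_hassum (tail_hassum Lser_nice n) _ => k.
rewrite /tail_term; case: eqP => [_|/eqP k0]; first exact: clideal0.
by apply: clidealZ; apply: clidealM; apply: clideal_mem; right; exists k.
Qed.

Lemma L_bhat_ideal : IQ' Q (zsum (fun k => if k == 0 then 0 else L k * bhat R (- k))).
Proof.
set u := fun k : int => _.
have [H hH] : exists H, hassum u H.
  apply: (nice_hassum_exists (D := 2) (n := 0)) => [|k].
    have h0 := null_int Lser_nice.
    have h1 := nullM (fun k => if k == 0 then 0 else bhat R (- k)) h0.
    move=> N k; have [A hA] := h1 N k; exists A => x /hA <-.
    by rewrite /u; case: (x == 0); rewrite ?mulr0.
  rewrite /u; case: eqP => _; first exact: nice0.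
  by have := niceM (Lser_nice k) (nice_bv C (- k)); rewrite subrr.
rewrite (zsum_hassum hH); apply: clideal_hassum hH _ => k.
rewrite /u; case: eqP => [_|/eqP k0]; first exact: clideal0.
by rewrite mulrC; apply: clidealM; apply: clideal_mem; right; exists k.
Qed.

(** For n <> 0 the two elements are equal, by t = i pi and t^2 = - pi^2. For n = 0 the quadratic
    sums in which they differ consist of multiples of the L_k with k <> 0. *)
Lemma betahat_beta n : IQ' Q (betahat Q n - beta c L n).
Proof.
rewrite /betahat /beta; case: eqP => [->|/eqP n0].
  have e := add_sub_cancel (2^-1 *: (ahat R 0 + bhat R 0))
    (2^-1 *: zsum (fun k => if k == 0 then 0 else L k * bhat R (- k))) (eps ^+ 2 * tail L 0).
  have I1 : IQ' Q (2^-1 *: zsum (fun k => if k == 0 then 0 else L k * bhat R (- k))).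
    by apply: clidealZ; exact: L_bhat_ideal.
  have I2 : IQ' Q (eps ^+ 2 * tail L 0) by apply: clidealM; exact: tail_ideal.
  have I3 := clidealB I1 I2; rewrite -e in I3; exact: I3.
set F := (X in IQ' Q (X - _)); set G := (X in IQ' Q (_ - X)).
suff -> : F = G by rewrite subrr; exact: clideal0.
rewrite /F /G; apply: (congr2 +%R).
  apply: (congr1 (fun x => @bv C n + x * L n)).
  rewrite -scaleNr half_twopii.
  apply: (congr2 (fun z z' : C => 2^-1%:A + z *: eps + z' *: eps ^+ 2)).
    by field.
  by rewrite exprMn sqrCi; field.
apply: (congr1 (fun x => eps ^+ 2 * zsum x)); apply/funext => k.
by rewrite /tail_term /coefk (negbTE n0).
Qed.

(** Since i^3 = - i, the central term - i pi^3 n^3 is (i pi)^3 n^3, that is, t^3 n^3. *)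
Lemma virasoro_rhsE n m : virasoro_rhs Q n m = eps ^+ 2 *
  ((c / 2 * (n%:~R - m%:~R)) *: betahat Q (n + m) +
   ((n + m == 0)%:R * ((c / 2) ^+ 3 * n%:~R ^+ 3))%:A).
Proof.
rewrite /virasoro_rhs scalerAr; congr (_ * _).
rewrite scalerBr !scalerA -scaleNr half_twopii.
apply: (congr2 (fun z z' : C => z *: betahat Q (n + m) + z'%:A)).
  by rewrite rmorphB /=; ring.
have -> : (n == - m) = (n + m == 0) by rewrite addr_eq0.
have I3 : I ^+ 3 = - I :> C by rewrite exprS sqrCi mulrN1.
by rewrite !exprMn I3; case: eqP => _; rewrite ?mulr1n ?mulr0n; ring.
Qed.

(** Guarantees that the congruence below, stated for all representatives [h], is not vacuous. *)
Lemma induced_bracket_exists n m : exists h, induced_bracket Q (betahat Q n) (betahat Q m) h.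
Proof.
have good := good_beta twopii_neq0 Lser_nice Lser0 Lser1 Lser2 bv_square betahat_beta.
have [p [_ [gp tp _]]] := good n; have [p' [_ [gp' _ _]]] := good m.
exists (pbracket p p'), p, p'; split; [exact: gp|exact: gp'|by left|].
by rewrite subrr; exact: clideal0.
Qed.

Lemma induced_bracket_virasoro n m h :
  induced_bracket Q (betahat Q n) (betahat Q m) h ->
  mod_eps (IQ' Q) 3 (h - virasoro_rhs Q n m).
Proof.
move=> [p [p' [gp gp' tpp hh]]]; rewrite virasoro_rhsE.
exact: (good_bracket twopii_neq0 Lser_nice Lser0 Lser1 Lser2 bv_square Xcas_casimir
  betahat_beta gp gp' tpp hh).
Qed.

Lemma beta_polynomials_dense :
  closure [set y + z | y in beta_polynomials Q & z in IQ' Q] = setT.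
Proof.
apply: (closure_beta_ideal (c := c) Lser0 Xcas0 betahat_beta).
- by move=> e; exists e%:A => //; exact: peval_scalar.
- by exists (pvar C None) => //; rewrite peval_var.
- move=> _ _ [F _ <-] [G _ <-]; exists (F + G) => //; exact: rmorphD.
- move=> _ _ [F _ <-] [G _ <-]; exists (F * G) => //; exact: rmorphM.
- by move=> n; exists (pvar C (Some n)) => //; rewrite peval_var.
Qed.

End SecondTodaBracket.

Theorem theorem5p5p1 (R : realType) :
  exists Q : epseries (pol R[i] dvar),
    [/\ in_R0 Q,
        Q 0%N = pvar R[i] (inr 0%N),
        forall (k : nat) (F : epseries (pol R[i] dvar)),
          diff_ideal Q F -> diff_ideal Q (toda_der k F),
        forall n m : int,
          (exists h, induced_bracket Q (betahat Q n) (betahat Q m) h) /\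
          (forall h, induced_bracket Q (betahat Q n) (betahat Q m) h ->
             mod_eps (IQ' Q) 3 (h - virasoro_rhs Q n m)) &
        closure [set y + z | y in beta_polynomials Q & z in IQ' Q] = setT].
Proof.
have [Q [Q_R0 [Q0 Q1 Q2] Qdeg Qinv]] := toda_reduction_exists R.
exists Q; split=> //; last exact: beta_polynomials_dense.
move=> n m; split; first exact: induced_bracket_exists.
by move=> h; apply: induced_bracket_virasoro.
Qed.
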